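(* Let $D\in\mathcal D_n$ be a random diagonal matrix and $X=(x_1,\dots,x_n)\in\mathcal M_{p,n}$ a random matrix, in the regime $p\le O(n)$. Assume: (i) $(X,D)\propto\mathcal E_2$; (ii) the columns $x_1,\dots,x_n$ are independent; (iii) $O(1)\le\sup_{1\le i\le n}\|\mathbb E[x_i]\|\le O(1)$; (iv) for all $i\in\{1,\dots,n\}$ there exists a random diagonal matrix $D^{(i)}\in\mathcal D_n$, independent of $x_i$, such that $\sup_{1\le i\le n}\|D_{-i}-D_{-i}^{(i)}\|_F\le O(1)$; (v) there exist three constants $\kappa_X,\kappa_D,\varepsilon>0$ (with $\varepsilon\ge O(1)$ and $\kappa_X,\kappa_D\le O(1)$) such that $\|X\|\le\sqrt n\,\kappa_X$, $\|D\|\le\kappa_D$ and $\kappa_X^2\kappa_D\le1-\varepsilon$. Then the resolvent $Q\equiv(I_p-\frac1nXDX^T)^{-1}$ satisfies the linear concentration $$Q\in\mathcal E_2\left(\frac{\log^{3/2}n}{\sqrt n}\right)+\mathcal E_{1/2}\left(\frac{\log^{3/2}n}{n}\right)\qquad\text{in }(\mathcal M_p,\|\cdot\|).$$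
   Context: $\mathcal M_{p,n}$ is the set of real $p\times n$ matrices, $\mathcal M_p=\mathcal M_{p,p}$, $\mathcal D_n$ the set of $n\times n$ diagonal matrices; $\|\cdot\|$ is the Euclidean norm on vectors and the spectral norm on matrices, $\|\cdot\|_F$ the Frobenius norm. All objects are sequences indexed by the dimensions $(p,n)$; $a\le O(b)$ (resp. $a\ge O(b)$) means $a\le Cb$ (resp. $a\ge Cb$) for a constant $C>0$ independent of the indices; a ''constant'' does not depend on the indices. For $\Delta=\mathrm{Diag}(\Delta_1,\dots,\Delta_n)\in\mathcal D_n$, $\Delta_{-i}=\mathrm{Diag}(\Delta_1,\dots,\Delta_{i-1},0,\Delta_{i+1},\dots,\Delta_n)$. $(X,D)\propto\mathcal E_2$ means: there exist constants $C,c>0$ independent of the indices such that for all $f:\mathcal M_{p,n}\times\mathcal D_n\to\mathbb R$ that are $1$-Lipschitz for the product norm built from the Frobenius norms and all $t>0$, $\mathbb P(|f(X,D)-\mathbb E[f(X,D)]|\ge t)\le Ce^{-(t/c)^2}$. Linear concentration: for a (sequence of) random vectors $Z$ in a normed space $(E,\|\cdot\|_E)$, $Z\in\sum_l\mathcal E_{q_l}(\sigma_l)$ means that there exist a (sequence of) deterministic vectors $\tilde Z\in E$ and constants $C,c>0$ such that for all indices, all linear forms $f$ on $E$ with $|f(x)|\le\|x\|_E$ for all $x$, and all $t>0$, $\mathbb P(|f(Z)-f(\tilde Z)|\ge t)\le C\sum_le^{-(t/(c\sigma_l))^{q_l}}$. *)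

(* Defs.v *)
From HB Require Import structures.
From mathcomp Require Import all_boot all_order all_algebra.
From mathcomp Require Import all_classical all_reals all_analysis.

Set Implicit Arguments.
Unset Strict Implicit.
Unset Printing Implicit Defensive.
Import Order.TTheory GRing.Theory Num.Theory.
Import numFieldNormedType.Exports.
Local Open Scope classical_set_scope.
Local Open Scope ring_scope.

(* On column vectors (n = 1) this is the Euclidean norm; the norm `|A| that
   the library puts on matrices is the entrywise maximum norm. *)
Definition frobenius_norm (R : realType) (m n : nat) (A : 'M[R]_(m, n)) : R :=
  Num.sqrt (\sum_i \sum_j A i j ^+ 2).

Definition spectral_norm (R : realType) (m n : nat) (A : 'M[R]_(m, n)) : R :=
  sup [set frobenius_norm (A *m v) | v in
        [set v : 'cV[R]_n | frobenius_norm v <= 1]].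

(* Delta_{-i}: the i-th diagonal entry is replaced by 0. *)
Definition diag_remove (R : realType) (n : nat) (i : 'I_n) (Delta : 'M[R]_n) :
    'M[R]_n :=
  diag_mx (\row_j (if j == i then 0 else Delta j j)).

Definition borel_mx (R : realType) (m n : nat) : set (set 'M[R]_(m, n)) :=
  <<s [set A | exists (i : 'I_m) (j : 'I_n) (B : set R),
         measurable B /\ A = [set M : 'M[R]_(m, n) | B (M i j)]] >>.

Section random_matrices.
Context {R : realType} {d : measure_display} {T : measurableType d}.
Variable P : probability T R.

Definition random_mx (m n : nat) (X : T -> 'M[R]_(m, n)) : Prop :=
  forall i j, measurable_fun [set: T] (fun w => X w i j).

Definition expectation_mx (m n : nat) (X : T -> 'M[R]_(m, n)) : 'M[R]_(m, n) :=
  \matrix_(i, j) fine 'E_P[fun w => X w i j].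

Definition independent_mx (m n m' n' : nat)
    (X : T -> 'M[R]_(m, n)) (Y : T -> 'M[R]_(m', n')) : Prop :=
  forall A B, borel_mx A -> borel_mx B ->
    (P (X @^-1` A `&` Y @^-1` B) = P (X @^-1` A) * P (Y @^-1` B))%E.

Definition mutually_independent_mx (k m n : nat)
    (Y : 'I_k -> T -> 'M[R]_(m, n)) : Prop :=
  forall (J : {set 'I_k}) (B : 'I_k -> set 'M[R]_(m, n)),
    (forall j, borel_mx (B j)) ->
    (P (\bigcap_(j in [set` J]) (Y j @^-1` B j))
     = \prod_(j in J) P (Y j @^-1` B j))%E.

End random_matrices.

(* The product norm on M_{p,n} x D_n is taken to be the l^2 one; the l^1 and
   l^oo ones are equivalent to it up to a universal factor, which the constant
   c of the concentration inequality absorbs. *)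
Definition lipschitz1_mx_diag (R : realType) (p n : nat)
    (f : 'M[R]_(p, n) -> 'M[R]_n -> R) : Prop :=
  forall (X X' : 'M[R]_(p, n)) (D D' : 'M[R]_n),
    is_diag_mx D -> is_diag_mx D' ->
    `|f X D - f X' D'| <=
      Num.sqrt (frobenius_norm (X - X') ^+ 2 + frobenius_norm (D - D') ^+ 2).

(* Objects are indexed by the pairs of dimensions (p, n) in a regime S; the
   "constants" are those that do not depend on (p, n). *)
Section concentration.
Context {R : realType} {d : nat -> nat -> measure_display}
  {T : forall p n, measurableType (d p n)}.
Variables (S : nat -> nat -> Prop) (P : forall p n, probability (T p n) R).

(* (X, D) \propto E_2; D is meant to be diagonal-valued. *)
Definition lipschitz_concentrated2
    (X : forall p n, T p n -> 'M[R]_(p, n))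
    (D : forall p n, T p n -> 'M[R]_n) : Prop :=
  exists C c : R, [/\ 0 < C, 0 < c &
    forall p n, S p n ->
    forall f : 'M[R]_(p, n) -> 'M[R]_n -> R, lipschitz1_mx_diag f ->
      let g := fun w => f (X p n w) (D p n w) in
      (P p n).-integrable setT (EFin \o g) /\
      forall t : R, 0 < t ->
        (P p n [set w | (t <= `|g w - fine 'E_(P p n)[g]|)%R]
         <= (C * expR (- (t / c) ^+ 2))%:E)%E].

(* Z \in \sum_l E_{q_l}(sigma_l) in the normed spaces (E p n, nrm p n);
   the list L enumerates the pairs (q_l, sigma_l). *)
Definition linearly_concentrated (E : nat -> nat -> lmodType R)
    (nrm : forall p n, E p n -> R) (Z : forall p n, T p n -> E p n)
    (L : seq (R * (nat -> nat -> R))) : Prop :=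
  exists (Zt : forall p n, E p n) (C c : R), [/\ 0 < C, 0 < c &
    forall p n, S p n ->
    forall f : {scalar E p n}, (forall x, `|f x| <= nrm p n x) ->
    forall t : R, 0 < t ->
      (P p n [set w | (t <= `|f (Z p n w) - f (Zt p n)|)%R]
       <= (C * \sum_(l <- L) expR (- (t / (c * l.2 p n)) `^ l.1))%:E)%E].

End concentration.

Definition resolvent (R : realType) (p n : nat)
    (X : 'M[R]_(p, n)) (D : 'M[R]_n) : 'M[R]_p :=
  invmx (1%:M - n%:R^-1 *: (X *m D *m X^T)).

(* Main.v *)
(* A linear form f on matrices dominated by the spectral norm factors as
   f A = tr(C^T A E) with C, E of Frobenius norm at most 1.  By the resolvent
   identity, the variation of f(Q) in (X, D) is governed by |C^T Q x_j| and
   |E^T Q x_j|; removing x_j from Q bounds these by a constant times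
     gamma_j = |C^T x_j| + |E^T x_j| + n^-1/2 |(x_k^T x_j)_{k != j}|.
   On the event sum_j gamma_j^4 <= W^4 the map f(Q) is therefore Lipschitz with
   constant O(W^2 / n), and a McShane extension off this event inherits the
   Gaussian concentration of (X, D).

   The l^4 norm of gamma is itself a Lipschitz function of X, so it suffices to
   show that it is typically of order n^1/4 (log n)^1/2.  By independence of the
   columns this amounts to sum_j (tr(C_j H))^2 = O(n log^2 n), where
   C_j = E[x_j x_j^T] and H = n^-1 sum_j C_j.  Here the almost sure bound on the
   operator norm of X matters: it holds simultaneously for the extreme values of
   all the independent columns.  If Pi projects on a
   q-dimensional subspace and tau_j = E|Pi x_j|^2, dual Sudakov minoration says
   that <a, Pi x_j> reaches values of order tau_j for most Gaussian directions a;
   averaging |X^T a|^2 <= n kappa^2 |a|^2 over a gives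
   sum_j tau_j^2 = O(n q), whence the l-th eigenvalue of H is O(l^-1/2), and an
   Abel summation over the spectrum of H concludes.

   Finally, for a deviation t of f(Q) one takes W of order
   max(n^1/4 (log n)^1/2, (t n)^1/4). *)
Require Import Defs.
From HB Require Import structures.
From mathcomp Require Import all_boot all_order all_algebra.
From mathcomp Require Import all_classical all_reals all_analysis.
From mathcomp Require Import measurable_realfun ring lra.
Import Order.TTheory GRing.Theory Num.Theory.
Import numFieldNormedType.Exports.
Local Open Scope classical_set_scope.
Local Open Scope ring_scope.
Set Implicit Arguments.
Unset Strict Implicit.
Unset Printing Implicit Defensive.

(** * Frobenius and operator norms *)

Section matrix_norms.
Context {R : realType}.

(** The obstacle is the variation in [D]. Moving [X] changes f(Q) with Lipschitz constant O(n^-1/2)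
    by operator norms alone. Moving [D] by [Dl] contributes n^-1 sum_i Dl_i <C^T Q x_i, E^T Q'
    x_i'>; as [Dl] is controlled in Frobenius norm, Cauchy-Schwarz leaves the sum of the |C^T Q
    x_i|^2 |E^T Q' x_i'|^2, whence the l^4 norm of gamma.

    The Gaussian measure on directions is replaced by Gaussian weights on a finite grid: averages
    become finite sums, and disjoint translates of a set of directions are compared by counting.

    The factor log^2 n in sum_j gamma_j^4 has two sources of the same size: the harmonic sum
    produced by the Abel summation, and the union bound over the n columns.

    Replacing f(Q) by its extension shifts the mean by at most a constant times the probability of
    the bad event. This is below t/2 once t is at least a constant times n^-1/2; for smaller t the
    claimed bound exceeds 1 with a suitable factor in front. *)

Lemma cauchy_sum (I : finType) (a b : I -> R) :
  (\sum_i a i * b i) ^+ 2 <= (\sum_i a i ^+ 2) * (\sum_i b i ^+ 2).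
Proof.
have H : 0 <= \sum_i \sum_j (a i * b j - a j * b i) ^+ 2.
  by apply: sumr_ge0 => i _; apply: sumr_ge0 => j _; exact: sqr_ge0.
have E : \sum_i \sum_j (a i * b j - a j * b i) ^+ 2 =
    2 * ((\sum_i a i ^+ 2) * (\sum_i b i ^+ 2)) - 2 * (\sum_i a i * b i) ^+ 2.
  have -> : \sum_i \sum_j (a i * b j - a j * b i) ^+ 2 =
    \sum_i \sum_j (a i ^+ 2 * b j ^+ 2) + \sum_i \sum_j (b i ^+ 2 * a j ^+ 2)
    - 2 * \sum_i \sum_j ((a i * b i) * (a j * b j)).
    rewrite mulr_sumr -big_split -sumrB /=; apply: eq_bigr => i _.
    rewrite mulr_sumr -big_split -sumrB /=; apply: eq_bigr => j _; ring.
  rewrite -!big_distrlr /= -expr2; ring.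
rewrite E in H; lra.
Qed.

Definition mdot {m n} (A B : 'M[R]_(m, n)) : R := \sum_i \sum_j A i j * B i j.

Lemma mdot_trace m n (A B : 'M[R]_(m, n)) : mdot A B = \tr (A^T *m B).
Proof.
rewrite /mdot /mxtrace exchange_big; apply: eq_bigr => j _.
by rewrite mxE; apply: eq_bigr => i _; rewrite mxE.
Qed.

Lemma mdotC m n (A B : 'M[R]_(m, n)) : mdot A B = mdot B A.
Proof. by apply: eq_bigr => i _; apply: eq_bigr => j _; rewrite mulrC. Qed.

Lemma mdotDl m n (A B C : 'M[R]_(m, n)) : mdot (A + B) C = mdot A C + mdot B C.
Proof. by rewrite !mdot_trace linearD mulmxDl linearD. Qed.

Lemma mdotZl m n a (A C : 'M[R]_(m, n)) : mdot (a *: A) C = a * mdot A C.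
Proof. by rewrite !mdot_trace linearZ -scalemxAl linearZ. Qed.

Lemma mdotNl m n (A C : 'M[R]_(m, n)) : mdot (- A) C = - mdot A C.
Proof. by rewrite -scaleN1r mdotZl mulN1r. Qed.

Lemma mdotDr m n (A B C : 'M[R]_(m, n)) : mdot C (A + B) = mdot C A + mdot C B.
Proof. by rewrite mdotC mdotDl !(mdotC C). Qed.

Lemma mdotZr m n a (A C : 'M[R]_(m, n)) : mdot C (a *: A) = a * mdot C A.
Proof. by rewrite mdotC mdotZl (mdotC C). Qed.

Lemma mdotNr m n (A C : 'M[R]_(m, n)) : mdot C (- A) = - mdot C A.
Proof. by rewrite mdotC mdotNl (mdotC C). Qed.

Lemma mdot0r m n (A : 'M[R]_(m, n)) : mdot A 0 = 0.
Proof. by rewrite -(scale0r 0) mdotZr mul0r. Qed.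

Lemma mdot_tr m n (A B : 'M[R]_(m, n)) : mdot A^T B^T = mdot A B.
Proof.
rewrite /mdot exchange_big; apply: eq_bigr => i _; apply: eq_bigr => j _.
by rewrite !mxE.
Qed.

Lemma mdot_mull m n r (A : 'M[R]_(m, r)) (B : 'M[R]_(r, n)) (C : 'M[R]_(m, n)) :
  mdot (A *m B) C = mdot B (A^T *m C).
Proof. by rewrite !mdot_trace trmx_mul mulmxA. Qed.

Lemma mdot_mulr m n r (A : 'M[R]_(r, n)) (B : 'M[R]_(m, r)) (C : 'M[R]_(m, n)) :
  mdot (B *m A) C = mdot B (C *m A^T).
Proof. by rewrite !mdot_trace trmx_mul -mulmxA mxtrace_mulC mulmxA. Qed.

Local Notation fn := (@frobenius_norm R _ _).

Lemma fn_ge0 m n (A : 'M[R]_(m, n)) : 0 <= fn A.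
Proof. exact: sqrtr_ge0. Qed.

Lemma mdot_ge0 m n (A : 'M[R]_(m, n)) : 0 <= mdot A A.
Proof.
by apply: sumr_ge0 => i _; apply: sumr_ge0 => j _; rewrite -expr2 sqr_ge0.
Qed.

Lemma fn_sqrt m n (A : 'M[R]_(m, n)) : fn A = Num.sqrt (mdot A A).
Proof. by []. Qed.

Lemma fn_sqr m n (A : 'M[R]_(m, n)) : fn A ^+ 2 = mdot A A.
Proof. by rewrite fn_sqrt sqr_sqrtr// mdot_ge0. Qed.

Lemma fn_sqrE m n (A : 'M[R]_(m, n)) : fn A ^+ 2 = \sum_i \sum_j A i j ^+ 2.
Proof. by rewrite fn_sqr; apply: eq_bigr => i _; apply: eq_bigr => j _; rewrite expr2. Qed.

Lemma le_of_sqr (x y : R) : 0 <= y -> x ^+ 2 <= y ^+ 2 -> x <= y.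
Proof. by move=> y0 h; have := ler_norm x; rewrite -sqrtr_sqr => /le_trans; apply; rewrite -(ger0_norm y0) -sqrtr_sqr ler_wsqrtr. Qed.

Lemma fn_eq0 m n (A : 'M[R]_(m, n)) : fn A = 0 -> A = 0.
Proof.
move=> h; have := fn_sqrE A; rewrite h expr0n/= => /esym/eqP.
rewrite psumr_eq0; last by move=> i _; apply: sumr_ge0 => j _; exact: sqr_ge0.
move=> /allP H; apply/matrixP => i j; rewrite mxE.
have := H i (mem_index_enum _); rewrite implyTb psumr_eq0; last by move=> k _; exact: sqr_ge0.
by move=> /allP /(_ j (mem_index_enum _)); rewrite implyTb sqrf_eq0 => /eqP.
Qed.

Lemma mdot_le m n (A B : 'M[R]_(m, n)) : `|mdot A B| <= fn A * fn B.
Proof.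
apply: le_of_sqr; first by rewrite mulr_ge0 ?fn_ge0.
rewrite -normrX ger0_norm ?sqr_ge0// exprMn !fn_sqrE /mdot !pair_bigA /=.
exact: cauchy_sum.
Qed.

Lemma fn0 m n : fn (0 : 'M[R]_(m, n)) = 0.
Proof. by rewrite fn_sqrt mdot0r sqrtr0. Qed.

Lemma fnZ m n a (A : 'M[R]_(m, n)) : fn (a *: A) = `|a| * fn A.
Proof. by rewrite !fn_sqrt mdotZl mdotZr mulrA -expr2 sqrtrM ?sqr_ge0// sqrtr_sqr. Qed.

Lemma fnN m n (A : 'M[R]_(m, n)) : fn (- A) = fn A.
Proof. by rewrite !fn_sqrt mdotNl mdotNr opprK. Qed.

Lemma fn_tr m n (A : 'M[R]_(m, n)) : fn A^T = fn A.
Proof. by rewrite !fn_sqrt mdot_tr. Qed.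

Lemma fnD m n (A B : 'M[R]_(m, n)) : fn (A + B) <= fn A + fn B.
Proof.
apply: le_of_sqr; first by rewrite addr_ge0 ?fn_ge0.
rewrite sqrrD !fn_sqr mdotDl !mdotDr (mdotC B A).
have := le_trans (ler_norm _) (mdot_le A B); lra.
Qed.

Lemma fn_subC m n (A B : 'M[R]_(m, n)) : fn (A - B) = fn (B - A).
Proof. by rewrite -fnN opprB. Qed.

Lemma fn_dist m n (A B : 'M[R]_(m, n)) : `|fn A - fn B| <= fn (A - B).
Proof.
have h1 := fnD (A - B) B; rewrite subrK in h1.
have h2 := fnD (B - A) A; rewrite subrK (fn_subC B) in h2.
rewrite ler_norml; lra.
Qed.

Lemma fn_mulmx m n r (A : 'M[R]_(m, r)) (B : 'M[R]_(r, n)) :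
  fn (A *m B) <= fn A * fn B.
Proof.
apply: le_of_sqr; first by rewrite mulr_ge0 ?fn_ge0.
rewrite exprMn -(fn_tr B) !fn_sqrE mulr_suml; apply: ler_sum => i _.
rewrite mulr_sumr; apply: ler_sum => j _; rewrite mxE.
have := cauchy_sum (A i) (fun k => B k j).
by under [X in _ <= _ * X -> _]eq_bigr do rewrite -(mxE trmx_key (fun j i => B i j)).
Qed.

Lemma fn_col m n (A : 'M[R]_(m, n)) : fn A ^+ 2 = \sum_j fn (col j A) ^+ 2.
Proof.
rewrite fn_sqrE exchange_big; apply: eq_bigr => j _; rewrite fn_sqrE.
by apply: eq_bigr => i _; rewrite big_ord1 mxE.
Qed.

Lemma fn_col_le m n (A : 'M[R]_(m, n)) j : fn (col j A) <= fn A.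
Proof.
apply: le_of_sqr; first exact: fn_ge0.
by rewrite [leRHS]fn_col (bigD1 j)//= lerDl sumr_ge0// => k _; exact: sqr_ge0.
Qed.

(** A spectral norm bound without the supremum, so that it composes directly; [spectral_opb] and
    [opb_spectral] translate in both directions. *)
Definition opb {m n} (A : 'M[R]_(m, n)) (c : R) : Prop :=
  forall v : 'cV[R]_n, fn (A *m v) <= c * fn v.

Lemma opb_fn m n (A : 'M[R]_(m, n)) : opb A (fn A).
Proof. by move=> v; exact: fn_mulmx. Qed.

Lemma opb_le m n (A : 'M[R]_(m, n)) c c' : c <= c' -> opb A c -> opb A c'.
Proof. by move=> h H v; apply: le_trans (H v) _; rewrite ler_wpM2r ?fn_ge0. Qed.

Lemma opb_mul m n r (A : 'M[R]_(m, r)) (B : 'M[R]_(r, n)) a b :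
  0 <= a -> opb A a -> opb B b -> opb (A *m B) (a * b).
Proof.
move=> a0 hA hB v; rewrite -mulmxA; apply: le_trans (hA _) _.
by rewrite -mulrA ler_wpM2l.
Qed.

(** |A^T u|^2 = <u, A A^T u> <= |u| c |A^T u|, and one factor cancels. *)
Lemma opb_tr m n (A : 'M[R]_(m, n)) c : 0 <= c -> opb A c -> opb A^T c.
Proof.
move=> c0 h u; have [->|nz] := eqVneq (fn (A^T *m u)) 0.
  by rewrite mulr_ge0 ?fn_ge0.
have pos : 0 < fn (A^T *m u) by rewrite lt_neqAle eq_sym nz fn_ge0.
rewrite -(ler_pM2r pos) -expr2 fn_sqr mdot_mull trmxK.
apply: le_trans (le_trans (ler_norm _) (mdot_le _ _)) _.
by rewrite mulrAC mulrC ler_wpM2r ?fn_ge0.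
Qed.

Lemma opbZ m n (A : 'M[R]_(m, n)) a c : opb A c -> opb (a *: A) (`|a| * c).
Proof. by move=> h v; rewrite -scalemxAl fnZ -mulrA ler_wpM2l. Qed.

Lemma fn_op_mul m n r (A : 'M[R]_(m, r)) (B : 'M[R]_(r, n)) a :
  0 <= a -> opb A a -> fn (A *m B) <= a * fn B.
Proof.
move=> a0 hA; apply: le_of_sqr; first by rewrite mulr_ge0 ?fn_ge0.
rewrite exprMn !fn_col mulr_sumr; apply: ler_sum => j _.
rewrite [col j (A *m B)]colE -mulmxA -colE -exprMn ler_sqr ?nnegrE ?mulr_ge0 ?fn_ge0//; exact: hA.
Qed.

Lemma fn_mul_op m n r (A : 'M[R]_(m, r)) (B : 'M[R]_(r, n)) b :
  0 <= b -> opb B b -> fn (A *m B) <= fn A * b.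
Proof.
move=> b0 hB; rewrite -fn_tr trmx_mul -(fn_tr A) mulrC.
by apply: fn_op_mul => //; exact: opb_tr.
Qed.

Lemma opb_col m n (A : 'M[R]_(m, n)) c j : opb A c -> fn (col j A) <= c.
Proof.
move=> h; have := h (delta_mx j 0); rewrite -colE; suff -> : fn (delta_mx j 0 : 'cV_n) = 1 by rewrite mulr1.
apply/eqP; rewrite -(@eqrXn2 _ 2%N) ?fn_ge0// expr1n fn_sqrE.
rewrite (bigD1 j)//= big_ord1 mxE !eqxx expr1n big1 ?addr0// => i ij.
by rewrite big_ord1 mxE (negPf ij) expr0n.
Qed.

Lemma opb_entry m n (A : 'M[R]_(m, n)) c i j : opb A c -> `|A i j| <= c.
Proof.
move=> /(opb_col j); apply: le_trans; apply: le_of_sqr; first exact: fn_ge0.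
rewrite real_normK ?num_real// fn_sqrE (bigD1 i)//= big_ord1 mxE lerDl.
by apply: sumr_ge0 => k _; apply: sumr_ge0 => l _; exact: sqr_ge0.
Qed.

Lemma spectral_opb m n (A : 'M[R]_(m, n)) c : spectral_norm A <= c -> opb A c.
Proof.
move=> h v; have [v0|nz] := eqVneq (fn v) 0.
  by rewrite v0 mulr0 (fn_eq0 v0) mulmx0 fn0.
have pos : 0 < fn v by rewrite lt_neqAle eq_sym nz fn_ge0.
rewrite -ler_pdivrMr//; apply: le_trans h; apply: ub_le_sup.
  exists (fn A) => _ [u /= hu <-]; apply: le_trans (fn_mulmx _ _) _.
  by rewrite ler_piMr ?fn_ge0.
exists ((fn v)^-1 *: v) => /=.
  by rewrite fnZ gtr0_norm ?invr_gt0// mulVf.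
by rewrite -scalemxAr fnZ gtr0_norm ?invr_gt0// mulrC.
Qed.

Lemma opb_spectral m n (A : 'M[R]_(m, n)) c :
  0 <= c -> opb A c -> spectral_norm A <= c.
Proof.
move=> c0 h; apply: ge_sup.
  by exists (fn (A *m (0 : 'cV[R]_n))); exists 0 => //=; rewrite fn0 ler01.
move=> _ [v /= hv <-]; apply: le_trans (h v) _.
by rewrite ler_piMr.
Qed.

End matrix_norms.

(** * Spectral decomposition and trace duality *)

Section psd_spectral.
Context {R : realType}.
Local Notation fn := (@frobenius_norm R _ _).

Lemma quad_continuous p (H : 'M[R]_p) :
  continuous (fun v : 'rV[R]_p => mdot v^T (H *m v^T)).
Proof.
have -> : (fun v : 'rV[R]_p => mdot v^T (H *m v^T)) =
    (fun v => \sum_i \sum_k H i k * (v 0 i * v 0 k)).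
  apply/funext => v; apply: eq_bigr => i _; rewrite big_ord1 !mxE mulr_sumr.
  by apply: eq_bigr => k _; rewrite !mxE; ring.
have addc : continuous (fun x : R * R => x.1 + x.2) by exact: add_continuous.
have H1 i k : continuous (fun v : 'rV[R]_p => H i k * (v 0 i * v 0 k)).
  move=> v; apply: (@continuousM _ _ (fun=> H i k) (fun v : 'rV[R]_p => v 0 i * v 0 k)).
    exact: cst_continuous.
  apply: (@continuousM _ _ (fun v : 'rV[R]_p => v 0 i) (fun v : 'rV[R]_p => v 0 k));
    exact: coord_continuous.
have H2 i : continuous (fun v : 'rV[R]_p => \sum_k H i k * (v 0 i * v 0 k)).
  exact: (@continuous_big R _ +%R 0 xpredT addc _ _ _ (fun k _ => H1 i k)).
exact: (@continuous_big R _ +%R 0 xpredT addc _ _ _ (fun k _ => H2 k)).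
Qed.

Lemma quad_max p (H : 'M[R]_p) : exists2 u : 'cV[R]_p, fn u <= 1 &
  forall v : 'cV[R]_p, fn v <= 1 -> mdot v (H *m v) <= mdot u (H *m u).
Proof.
pose A := [set v : 'rV[R]_p | mdot v^T (1%:M *m v^T) <= 1].
have AE (v : 'rV[R]_p) : A v <-> fn v^T <= 1.
  rewrite /A /= mul1mx -fn_sqr; split => h; last by rewrite expr_le1 ?fn_ge0.
  by apply: le_of_sqr => //; rewrite expr1n.
have cA : compact A.
  apply: (@subclosed_compact _ _ [set v : 'rV[R]_p | forall i, v ord0 i \in `[(- 1), 1]]).
  - have -> : A = (fun v : 'rV[R]_p => mdot v^T (1%:M *m v^T)) @^-1` [set x | x <= 1] by [].
    apply: closed_comp; last exact: closed_le.
    by move=> v _; exact: quad_continuous.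
  - apply: (@rV_compact _  _ (fun=> `[(- 1 : R), 1]%classic)).
    by move=> _; exact: segment_compact.
  move=> v /AE hv i; rewrite in_itv/= -ler_norml.
  apply: le_of_sqr; rewrite // real_normK ?num_real// expr1n.
  have : fn v^T ^+ 2 <= 1 by rewrite expr_le1 ?fn_ge0.
  apply: le_trans; rewrite fn_sqrE (bigD1 i)//= big_ord1 mxE lerDl.
  by apply: sumr_ge0 => k _; apply: sumr_ge0 => l _; exact: sqr_ge0.
have [||u uA hu] := compact_EVT_max _ cA (f := fun v => mdot v^T (H *m v^T)).
- by exists 0; apply/AE; rewrite trmx0 fn0.
- by apply: continuous_subspaceT; exact: quad_continuous.
exists u^T; first by apply/AE; rewrite inE in uA.
by move=> v hv; have := hu v^T; rewrite trmxK; apply; rewrite inE; apply/AE; rewrite trmxK.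
Qed.

(** The form at v - t u is a nonnegative polynomial in t, evaluated at its minimum t = b / c. If c =
    0 it is affine in t and would take the value -1 unless its slope vanishes. *)
Lemma quad_cauchy p (H : 'M[R]_p) (u v : 'cV[R]_p) : H^T = H ->
  (forall w : 'cV[R]_p, 0 <= mdot w (H *m w)) ->
  mdot v (H *m u) ^+ 2 <= mdot v (H *m v) * mdot u (H *m u).
Proof.
move=> Hs Hp; set a := mdot v (H *m v); set b := mdot v (H *m u).
set c := mdot u (H *m u).
have q (t : R) : 0 <= a - 2 * t * b + t ^+ 2 * c.
  have := Hp (v - t *: u); rewrite mulmxBr -scalemxAr mdotDl !mdotDr !mdotNr !mdotNl.
  rewrite !mdotZr !mdotZl.
  have -> : mdot u (H *m v) = b by rewrite mdotC mdot_mull Hs.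
  by rewrite -/a -/b -/c; congr (0 <= _); ring.
have [c0|cn0] := eqVneq c 0.
  rewrite c0 mulr0; have [->|bn0] := eqVneq b 0; first by rewrite expr0n.
  have := q ((a + 1) / (2 * b)); rewrite c0 mulr0 addr0.
  have -> : a - 2 * ((a + 1) / (2 * b)) * b = -1 by field.
  by rewrite lerNr oppr0 ler10.
have cp : 0 < c by rewrite lt_neqAle eq_sym cn0 Hp.
have := q (b / c).
have -> : a - 2 * (b / c) * b + (b / c) ^+ 2 * c = a - b ^+ 2 / c by field.
by rewrite subr_ge0 ler_pdivrMr.
Qed.

Definition outer p (e : 'cV[R]_p) : 'M[R]_p := e *m e^T.

Lemma outer_mul p (e v : 'cV[R]_p) : outer e *m v = mdot e v *: e.
Proof.
by rewrite /outer -mulmxA [in LHS](mx11_scalar (e^T *m v)) mul_mx_scalar mdot_trace trace_mx11.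
Qed.

Lemma outer_tr p (e : 'cV[R]_p) : (outer e)^T = outer e.
Proof. by rewrite /outer trmx_mul trmxK. Qed.

(** Deflation, by induction on the rank: a maximiser [u] of the quadratic form on the unit ball is
    an eigenvector for the top eigenvalue [la], and H - la u u^T is positive semidefinite of smaller
    rank. Only the positive eigenvalues are listed. *)
Lemma psd_spectral p (H : 'M[R]_p) : H^T = H ->
  (forall w : 'cV[R]_p, 0 <= mdot w (H *m w)) ->
  exists (r : nat) (lam : nat -> R) (e : nat -> 'cV[R]_p),
  [/\ (r <= p)%N,
      forall l k, (l < r)%N -> (k < r)%N -> mdot (e l) (e k) = (l == k)%:R,
      forall l, (l < r)%N -> 0 < lam l,
      forall l k, (l <= k)%N -> (k < r)%N -> lam k <= lam l &
      H = \sum_(l < r) lam l *: outer (e l)].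
Proof.
move=> Hs Hp.
suff : exists (r : nat) (lam : nat -> R) (e : nat -> 'cV[R]_p),
  [/\ (r <= \rank H)%N,
      forall l k, (l < r)%N -> (k < r)%N -> mdot (e l) (e k) = (l == k)%:R,
      forall l, (l < r)%N -> 0 < lam l,
      forall l k, (l <= k)%N -> (k < r)%N -> lam k <= lam l &
      H = \sum_(l < r) lam l *: outer (e l)].
  move=> [r [lam [e [h1 h2 h3 h4 h5]]]]; exists r, lam, e; split => //.
  exact: leq_trans h1 (rank_leq_row _).
have [N] := ubnP (\rank H); elim: N => // N IH in H Hs Hp * => rH.
have [u u1 hu] := quad_max H; set la := mdot u (H *m u) in hu.
have la0 : 0 <= la by exact: Hp.
have [laz|lan] := eqVneq la 0.
  exists 0%N, (fun=> 0), (fun=> 0); split => //; rewrite big_ord0.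
  have Hv0 (v : 'cV[R]_p) : fn v <= 1 -> H *m v = 0.
    move=> v1; have hvv : mdot v (H *m v) = 0.
      by apply/eqP; rewrite eq_le Hp -laz hu.
    have := quad_cauchy v (H *m v) Hs Hp; rewrite hvv mulr0 -fn_sqr -exprM => h.
    apply: fn_eq0; apply/eqP; have : fn (H *m v) ^+ (2 * 2) == 0.
      by rewrite eq_le h exprn_ge0// fn_ge0.
    by rewrite expf_eq0 => /andP[].
  apply/matrixP => i j; have := Hv0 (delta_mx j 0); rewrite -colE => /(_ _)/matrixP/(_ i 0).
  rewrite !mxE; apply; rewrite fn_sqrt /mdot (bigD1 j)//= big_ord1 !mxE !eqxx mulr1.
  rewrite big1 ?addr0 ?sqrtr1// => k kj; rewrite big_ord1 mxE (negPf kj) mul0r//.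
have lap : 0 < la by rewrite lt_neqAle eq_sym lan.
have un0 : fn u != 0.
  apply: contra lan => /eqP/fn_eq0 u0.
  by rewrite /la u0 mulmx0 mdot0r.
have up : 0 < fn u by rewrite lt_neqAle eq_sym un0 fn_ge0.
have nu : fn u = 1.
  apply/eqP; rewrite eq_le u1 /=.
  have := hu ((fn u)^-1 *: u); rewrite fnZ ger0_norm ?invr_ge0 ?fn_ge0// mulVf// => /(_ (lexx _)).
  rewrite -scalemxAr mdotZl mdotZr -/la mulrA -{2}(mul1r la) ler_pM2r// -expr2 exprVn.
  by rewrite invf_le1 ?exprn_gt0// -[X in X <= _](expr1n _ 2) ler_sqr ?nnegrE ?fn_ge0.
have uu : mdot u u = 1 by rewrite -fn_sqr nu expr1n.
(* Maximality at the normalised H u and Cauchy-Schwarz for the form give |H u| <= la; then |H u - la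
   u|^2 = |H u|^2 - la^2 <= 0. *)
have Hu : H *m u = la *: u.
  have h1 : fn (H *m u) <= la.
    have [z|nz] := eqVneq (fn (H *m u)) 0; first by rewrite z.
    have pos : 0 < fn (H *m u) by rewrite lt_neqAle eq_sym nz fn_ge0.
    have := hu ((fn (H *m u))^-1 *: (H *m u)).
    rewrite fnZ ger0_norm ?invr_ge0 ?fn_ge0// mulVf// => /(_ (lexx _)).
    rewrite -scalemxAr mdotZl mdotZr mulrA -invfM mulrC ler_pdivrMr ?mulr_gt0// => h2.
    have := quad_cauchy u (H *m u) Hs Hp; rewrite -fn_sqr -/la => h3.
    have h4 := le_trans h3 (ler_wpM2r la0 h2).
    apply: le_of_sqr => //.
    have : (fn (H *m u)) ^+ 2 * (fn (H *m u)) ^+ 2 <= la ^+ 2 * (fn (H *m u)) ^+ 2.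
      suff -> : la ^+ 2 * fn (H *m u) ^+ 2 = la * fn (H *m u) ^+ 2 * la by rewrite -expr2.
      by ring.
    by rewrite ler_pM2r ?exprn_gt0.
  apply/eqP; rewrite -subr_eq0; apply/eqP/fn_eq0/eqP.
  rewrite -sqrf_eq0 eq_le sqr_ge0 andbT fn_sqr mdotDl !mdotDr !mdotNr !mdotNl.
  rewrite !mdotZr !mdotZl (mdotC (H *m u) u) -/la uu -fn_sqr.
  have : fn (H *m u) ^+ 2 <= la ^+ 2 by rewrite ler_sqr ?nnegrE ?fn_ge0.
  by rewrite expr2 [la ^+ 2]expr2; lra.
pose H' := H - la *: outer u.
have H's : H'^T = H' by rewrite /H' linearB linearZ /= outer_tr Hs.
have H'v (v : 'cV[R]_p) : mdot v (H' *m v) = mdot v (H *m v) - la * mdot u v ^+ 2.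
  rewrite /H' mulmxBl -scalemxAl outer_mul mdotDr mdotNr !mdotZr (mdotC v u); ring.
have H'p (w : 'cV[R]_p) : 0 <= mdot w (H' *m w).
  rewrite H'v subr_ge0 -(ler_pM2r lap).
  have := quad_cauchy u w Hs Hp; rewrite -/la Hu mdotZr (mdotC w u); apply: le_trans.
  by rewrite exprMn; move: (mdot u w) => x; rewrite le_eqVlt; apply/orP; left; apply/eqP; ring.
have H'u : H' *m u = 0.
  by rewrite /H' mulmxBl -scalemxAl outer_mul uu scale1r Hu subrr.
(* H' = (1 - u u^T) H gives the inclusion of row spaces; it is strict because H' kills [u] while H u
   = la u is nonzero. *)
have sub : (H' < H)%MS.
  rewrite ltmxE; apply/andP; split.
    apply/submxP; exists (1%:M - outer u); rewrite mulmxBl mul1mx /H'; congr (_ - _).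
    have -> : outer u *m H = u *m (H *m u)^T by rewrite trmx_mul Hs mulmxA.
    by rewrite Hu linearZ /= -scalemxAr.
  apply/negP => /submxP [B hB].
  have := Hu; rewrite hB -mulmxA H'u mulmx0 => /esym/eqP; rewrite scaler_eq0 (negPf lan)/=.
  by move=> /eqP u0; move: un0; rewrite u0 fn0 eqxx.
have rk : (\rank H' < N)%N by apply: leq_trans (rank_ltmx sub) _.
have [r [lam [e [h1 h2 h3 h4 h5]]]] := IH H' H's H'p rk.
have eig l : (l < r)%N -> H' *m e l = lam l *: e l.
  move=> lr; rewrite h5 mulmx_suml (bigD1 (Ordinal lr))//= -scalemxAl outer_mul h2// eqxx scale1r.
  rewrite big1 ?addr0// => k kl; rewrite -scalemxAl outer_mul h2//.
  by rewrite (_ : (k : nat) == l = false) ?scale0r ?scaler0//; apply: contraNF kl => /eqP kl; apply/eqP/val_inj.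
have ue l : (l < r)%N -> mdot u (e l) = 0.
  move=> lr; apply/eqP; have := mdotZr (lam l) (e l) u.
  rewrite -eig// -{1}H's -mdot_mull H'u mdotC mdot0r => /esym/eqP.
  by rewrite mulf_eq0 gt_eqF ?h3.
have ne l : (l < r)%N -> fn (e l) = 1.
  by move=> lr; rewrite fn_sqrt h2// eqxx sqrtr1.
have lle l : (l < r)%N -> lam l <= la.
  move=> lr; have := hu (e l); rewrite ne// => /(_ (lexx _)); apply: le_trans.
  have := H'v (e l); rewrite ue// eig// mdotZr h2// eqxx mulr1 expr0n/= mulr0 subr0.
  by move=> ->.
exists r.+1, (fun l => if l is l'.+1 then lam l' else la),
  (fun l => if l is l'.+1 then e l' else u); split.
- by apply: leq_ltn_trans h1 (rank_ltmx sub).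
- move=> [|l] [|k] lr kr; rewrite ?eqSS; first by rewrite uu eqxx.
  + by rewrite ue.
  + by rewrite mdotC ue.
  + by rewrite h2.
- by move=> [|l] lr //; exact: h3.
- move=> [|l] [|k] lk kr //; first exact: lle.
  exact: h4.
by rewrite big_ord_recl /= -h5 /H' addrC subrK.
Qed.

End psd_spectral.

Section trace_norm_duality.
Context {R : realType}.
Local Notation fn := (@frobenius_norm R _ _).

Lemma mdot_sumr (I : Type) (s : seq I) m n (A : 'M[R]_(m, n)) (F : I -> 'M[R]_(m, n)) :
  mdot A (\sum_(i <- s) F i) = \sum_(i <- s) mdot A (F i).
Proof.
by apply: (big_morph (mdot A)) => [B C|]; [exact: mdotDr|exact: mdot0r].
Qed.

Lemma mdot_suml (I : Type) (s : seq I) m n (A : 'M[R]_(m, n)) (F : I -> 'M[R]_(m, n)) :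
  mdot (\sum_(i <- s) F i) A = \sum_(i <- s) mdot (F i) A.
Proof. by rewrite mdotC mdot_sumr; apply: eq_bigr => i _; rewrite mdotC. Qed.

Lemma mdot_rank1 m n (B : 'M[R]_(m, n)) (a : 'cV_m) (b : 'cV_n) : mdot B (a *m b^T) = mdot (B *m b) a.
Proof. by rewrite mdotC mdot_mulr trmxK [LHS]mdotC. Qed.

Section orthonormal.
Variables (p r : nat) (e : nat -> 'cV[R]_p).
Hypothesis e_ortho :
  forall l k, (l < r)%N -> (k < r)%N -> mdot (e l) (e k) = (l == k)%:R.

Lemma ortho_coord (x : 'I_r -> R) (l : 'I_r) :
  mdot (e l) (\sum_(k < r) x k *: e k) = x l.
Proof.
rewrite mdot_sumr (bigD1 l)//= mdotZr e_ortho// eqxx mulr1 big1 ?addr0// => k kl.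
by rewrite mdotZr e_ortho// eq_sym (inj_eq val_inj) (negPf kl) mulr0.
Qed.

Lemma ortho_norm (x : 'I_r -> R) :
  fn (\sum_(k < r) x k *: e k) ^+ 2 = \sum_(k < r) x k ^+ 2.
Proof.
rewrite fn_sqr mdot_suml; apply: eq_bigr => k _.
by rewrite mdotZl ortho_coord expr2.
Qed.

Lemma bessel z : \sum_(l < r) mdot (e l) z ^+ 2 <= fn z ^+ 2.
Proof.
have := sqr_ge0 (fn (z - \sum_(l < r) mdot (e l) z *: e l)).
set y := \sum_(l < r) _; have yy : mdot y y = \sum_(l < r) mdot (e l) z ^+ 2.
  by rewrite -fn_sqr ortho_norm.
have yz : mdot y z = \sum_(l < r) mdot (e l) z ^+ 2.
  by rewrite /y mdot_suml; apply: eq_bigr => l _; rewrite mdotZl expr2.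
rewrite !fn_sqr mdotDl !mdotDr !mdotNl !mdotNr yy (mdotC z y) yz; lra.
Qed.

End orthonormal.

(* The singular value decomposition of the matrix representing [f], split
   symmetrically, bounds the nuclear norm of that matrix by the dual norm. *)
Lemma spectral_form_factor p (f : {scalar 'M[R]_p}) :
  (forall A, `|f A| <= spectral_norm A) ->
  exists r (C E : 'M[R]_(p, r)),
    [/\ fn C <= 1, fn E <= 1 & forall A, f A = mdot C (A *m E)].
Proof.
move=> hf; pose B : 'M[R]_p := \matrix_(i, j) f (delta_mx i j).
have fB A : f A = mdot B A.
  rewrite {1}(matrix_sum_delta A) linear_sum; apply: eq_bigr => i _.
  by rewrite linear_sum; apply: eq_bigr => j _; rewrite linearZ mxE mulrC.
have Hs : (B^T *m B)^T = B^T *m B by rewrite trmx_mul trmxK.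
have Hq (w v : 'cV[R]_p) : mdot w (B^T *m B *m v) = mdot (B *m w) (B *m v).
  by rewrite -mulmxA -mdot_mull.
have Hp (w : 'cV[R]_p) : 0 <= mdot w (B^T *m B *m w) by rewrite Hq mdot_ge0.
have [r [lam [e [_ eo l0 _ HE]]]] := psd_spectral Hs Hp.
have eig l : (l < r)%N -> B^T *m B *m e l = lam l *: e l.
  move=> lr; rewrite HE mulmx_suml (bigD1 (Ordinal lr))//= -scalemxAl outer_mul eo// eqxx scale1r.
  rewrite big1 ?addr0// => k kl; rewrite -scalemxAl outer_mul eo//.
  by rewrite (_ : (k : nat) == l = false) ?scale0r ?scaler0//; apply: contraNF kl => /eqP kl; apply/eqP/val_inj.
have Be l k : (l < r)%N -> (k < r)%N -> mdot (B *m e l) (B *m e k) = lam k * (l == k)%:R.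
  by move=> lr kr; rewrite -Hq eig// mdotZr eo.
pose s l := Num.sqrt (lam l).
have s0 l : (l < r)%N -> 0 < s l by move=> lr; rewrite sqrtr_gt0 l0.
have ss l : (l < r)%N -> lam l = s l * s l.
  by move=> lr; rewrite -expr2 sqr_sqrtr// ltW// l0.
(* A vector minus its projection on the [e l] lies in the kernel of B^T B, hence in that of B. *)
have BE : B = \sum_(l < r) (B *m e l) *m (e l)^T.
  apply/eqP; rewrite -subr_eq0; apply/eqP/fn_eq0/eqP; rewrite -sqrf_eq0 fn_col.
  rewrite big1// => j _; rewrite colE; set v := delta_mx j 0.
  have -> : (B - \sum_(l < r) B *m e l *m (e l)^T) *m v =
      B *m (v - \sum_(l < r) mdot (e l) v *: e l).
    rewrite mulmxBl mulmxBr; congr (_ - _); rewrite mulmx_suml mulmx_sumr.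
    apply: eq_bigr => l _; rewrite -scalemxAr -!mulmxA.
    by have := outer_mul (e l) v; rewrite /outer -mulmxA => ->; rewrite -scalemxAr.
  rewrite fn_sqr -Hq; set y := v - _.
  suff -> : B^T *m B *m y = 0 by rewrite mdot0r.
  rewrite HE mulmx_suml big1// => l _; rewrite -scalemxAl outer_mul /y mdotDr mdotNr.
  by rewrite (ortho_coord eo (fun l : 'I_r => mdot (e l) v)) subrr scale0r scaler0.
(* The partial isometry of the polar decomposition of B. Testing [f] on it gives the sum of the
   singular values [s l], which is therefore at most 1. *)
pose O := \sum_(l < r) (s l)^-1 *: ((B *m e l) *m (e l)^T).
have Oop : opb O 1.
  move=> z; rewrite mul1r; apply: le_of_sqr; first exact: fn_ge0.
  apply: le_trans (bessel eo z); rewrite le_eqVlt; apply/orP; left; apply/eqP.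
  have -> : O *m z = \sum_(l < r) ((s l)^-1 * mdot (e l) z) *: (B *m e l).
    rewrite /O mulmx_suml; apply: eq_bigr => l _; rewrite -scalemxAl -!mulmxA.
    by have := outer_mul (e l) z; rewrite /outer -mulmxA => ->; rewrite -scalemxAr scalerA.
  rewrite fn_sqr mdot_suml; apply: eq_bigr => l _; rewrite mdotZl mdot_sumr.
  rewrite (bigD1 l)//= mdotZr Be// eqxx mulr1 big1 ?addr0; last first.
    move=> k kl; rewrite mdotZr Be// (_ : (l : nat) == k = false) ?mulr0//.
    by apply: contraNF kl => /eqP kl; apply/eqP/val_inj.
  by rewrite ss//; field; rewrite gt_eqF ?s0.
have fO : f O = \sum_(l < r) s l.
  rewrite fB mdot_sumr; apply: eq_bigr => l _; rewrite mdotZr mdot_rank1 Be// eqxx mulr1.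
  by rewrite ss// mulKf// gt_eqF ?s0.
have sum1 : \sum_(l < r) s l <= 1.
  rewrite -fO; apply: le_trans (ler_norm _) (le_trans (hf _) _).
  exact: opb_spectral.
pose q l := Num.sqrt (s l).
have q0 l : (l < r)%N -> 0 < q l by move=> lr; rewrite sqrtr_gt0 s0.
have qq l : (l < r)%N -> s l = q l * q l.
  by move=> lr; rewrite -expr2 sqr_sqrtr// ltW// s0.
(* The columns of C and E are the left and right singular vectors scaled by the square root [q l] of
   the singular value, so both squared Frobenius norms are the sum of the [s l]. *)
pose C : 'M[R]_(p, r) := \matrix_(i, l) ((q l)^-1 * (B *m e l) i 0).
pose E : 'M[R]_(p, r) := \matrix_(i, l) (q l * e l i 0).
have Ccol (l : 'I_r) : col l C = (q l)^-1 *: (B *m e l).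
  by apply/matrixP => i j; rewrite !mxE ord1.
have Ecol (l : 'I_r) : col l E = q l *: e l.
  by apply/matrixP => i j; rewrite !mxE ord1.
exists r, C, E; split.
- apply: le_of_sqr => //; rewrite expr1n fn_col; apply: le_trans sum1.
  apply: ler_sum => l _; rewrite Ccol fn_sqr mdotZl mdotZr Be// eqxx mulr1 ss// qq//.
  rewrite le_eqVlt; apply/orP; left; apply/eqP; field; by rewrite gt_eqF ?q0.
- apply: le_of_sqr => //; rewrite expr1n fn_col; apply: le_trans sum1.
  by apply: ler_sum => l _; rewrite Ecol fn_sqr mdotZl mdotZr eo// eqxx mulr1 qq.
move=> A; rewrite fB -[E]trmxK -mdot_mulr; congr mdot.
rewrite {1}BE; apply/matrixP => i j; rewrite summxE mxE; apply: eq_bigr => l _.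
rewrite [in LHS]mxE big_ord1 !mxE mulrACA mulVf ?mul1r// gt_eqF ?q0//.
Qed.

End trace_norm_duality.

(** * Leave-one-out and Lipschitz estimates for the resolvent *)

Section resolvent_bounds.
Context {R : realType}.
Local Notation fn := (@frobenius_norm R _ _).

Lemma opb_unit p (M : 'M[R]_p) c : 0 <= c < 1 -> opb M c -> 1%:M - M \in unitmx.
Proof.
move=> /andP[c0 c1] hM; rewrite unitmxE unitfE; apply/det0P => -[v v0 hv].
have /eqP : v - v *m M = 0 by rewrite -{1}(mulmx1 v) -mulmxBr.
rewrite subr_eq0 => /eqP vM; have := opb_tr c0 hM v^T.
rewrite -trmx_mul -vM fn_tr => h.
have : fn v <= 0.
  have : (1 - c) * fn v <= 0 by lra.
  by rewrite pmulr_rle0// subr_gt0.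
move=> h0; have /fn_eq0 vz : fn v = 0 by apply/eqP; rewrite eq_le h0 fn_ge0.
by rewrite vz eqxx in v0.
Qed.

Lemma opb_inv p (M : 'M[R]_p) c : 0 <= c < 1 -> opb M c ->
  opb (invmx (1%:M - M)) (1 - c)^-1.
Proof.
move=> c01 hM v; have U := opb_unit c01 hM; case/andP: c01 => c0 c1.
set w := _ *m v; have wE : w = v + M *m w.
  have : (1%:M - M) *m w = v by rewrite /w mulKVmx.
  by rewrite mulmxBl mul1mx => <-; rewrite subrK.
have := fnD v (M *m w); rewrite -wE => h1; have h2 := hM w.
rewrite mulrC ler_pdivlMr ?subr_gt0//; lra.
Qed.

Section admissible.
Variables (p n : nat) (kX kD eps : R).
Hypotheses (n0 : (0 < n)%N) (kX0 : 0 < kX) (kD0 : 0 < kD) (eps0 : 0 < eps)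
  (kk : kX ^+ 2 * kD <= 1 - eps).

Local Notation sn := (Num.sqrt (n%:R : R)).

Let nR0 : 0 < n%:R :> R. Proof. by rewrite ltr0n. Qed.
Let sn0 : 0 < sn. Proof. by rewrite sqrtr_gt0. Qed.
Let snn : sn * sn = n%:R. Proof. by rewrite -expr2 sqr_sqrtr// ltW. Qed.
Let e01 : 0 <= 1 - eps < 1.
Proof.
by rewrite gtrBl eps0 andbT; apply: le_trans kk; rewrite mulr_ge0 ?exprn_ge0 ?ltW.
Qed.

Definition adm (X : 'M[R]_(p, n)) (D : 'M[R]_n) :=
  [/\ opb X (sn * kX), opb D kD & is_diag_mx D].

Lemma diagE (D : 'M[R]_n) i j : is_diag_mx D -> i != j -> D i j = 0.
Proof. by move=> /is_diag_mxP; apply. Qed.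

Lemma diag_tr (D : 'M[R]_n) : is_diag_mx D -> D^T = D.
Proof.
move=> dD; apply/matrixP => i j; rewrite mxE.
by have [->//|ij] := eqVneq i j; rewrite !diagE// eq_sym.
Qed.

Lemma diag_mul r (D : 'M[R]_n) (Y : 'M[R]_(n, r)) i j :
  is_diag_mx D -> (D *m Y) i j = D i i * Y i j.
Proof.
move=> dD; rewrite mxE (bigD1 i)//= big1 ?addr0// => k ki.
by rewrite diagE ?mul0r// eq_sym.
Qed.

Lemma opb_diag (D : 'M[R]_n) i : opb D kD -> `|D i i| <= kD.
Proof. exact: opb_entry. Qed.

Definition gram (X : 'M[R]_(p, n)) (D : 'M[R]_n) : 'M[R]_p :=
  n%:R^-1 *: (X *m D *m X^T).

Lemma gram_opb X D : adm X D -> opb (gram X D) (1 - eps).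
Proof.
move=> [hX hD _]; apply: opb_le kk _.
have -> : kX ^+ 2 * kD = `|n%:R^-1| * (sn * kX * kD * (sn * kX)).
  rewrite ger0_norm ?invr_ge0 ?ler0n//.
  have -> : sn * kX * kD * (sn * kX) = (sn * sn) * (kX ^+ 2 * kD) by ring.
  by rewrite snn mulKf// gt_eqF.
have h0 : 0 <= sn * kX by rewrite mulr_ge0 ?ltW.
apply: opbZ; apply: opb_mul; last exact: opb_tr.
  by rewrite !mulr_ge0 ?ltW.
exact: opb_mul.
Qed.

Lemma res_unit X D : adm X D -> 1%:M - gram X D \in unitmx.
Proof. by move=> /gram_opb; exact: opb_unit. Qed.

Lemma res_opb X D : adm X D -> opb (resolvent X D) eps^-1.
Proof.
move=> /gram_opb h; have := opb_inv e01 h.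
by rewrite (_ : 1 - (1 - eps) = eps)//; ring.
Qed.

Lemma gram_tr X D : is_diag_mx D -> (gram X D)^T = gram X D.
Proof.
by move=> dD; rewrite /gram linearZ /= !trmx_mul trmxK (diag_tr dD) mulmxA.
Qed.

Lemma res_tr X D : adm X D -> (resolvent X D)^T = resolvent X D.
Proof.
case=> _ _ dD; rewrite /resolvent trmx_inv linearB /= -/(gram X D) gram_tr//.
by rewrite trmx1.
Qed.

Lemma res_diff X D X' D' : adm X D -> adm X' D' ->
  resolvent X D - resolvent X' D' =
  resolvent X D *m (gram X D - gram X' D') *m resolvent X' D'.
Proof.
move=> h h'; have U := res_unit h; have U' := res_unit h'.
have -> : gram X D - gram X' D' = (1%:M - gram X' D') - (1%:M - gram X D).
  by rewrite opprB [RHS]addrC addrA subrK.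
rewrite mulmxBr mulmxBl /resolvent -/(gram X D) -/(gram X' D') mulVmx// mul1mx -mulmxA.
by rewrite mulmxV// mulmx1.
Qed.

Lemma res_expand X D : adm X D ->
  resolvent X D = 1%:M + resolvent X D *m gram X D.
Proof.
move=> h; have U := res_unit h; have := mulVmx U.
rewrite mulmxBr mulmx1 -/(resolvent X D) => /eqP.
by rewrite subr_eq => /eqP.
Qed.

Lemma diag_removeE i (D : 'M[R]_n) : is_diag_mx D ->
  D - diag_remove i D = D i i *: delta_mx i i.
Proof.
move=> dD; apply/matrixP => k l; rewrite !mxE.
have [->|kl] := eqVneq k l.
  by rewrite mulr1n andbb; case: eqVneq => [->|_] /=; rewrite ?subr0 ?mulr1 ?mulr0 ?subrr.
rewrite mulr0n subr0 (diagE dD kl).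
have [ki|] := eqVneq k i; last by rewrite mulr0.
by have [li|] := eqVneq l i; rewrite ?mulr0//; rewrite ki li eqxx in kl.
Qed.

Lemma adm_remove i X D : adm X D -> adm X (diag_remove i D).
Proof.
move=> [hX hD dD]; split => //; last exact: diag_mx_is_diag.
move=> v; apply: le_trans (hD v); apply: le_of_sqr; first exact: fn_ge0.
rewrite !fn_sqrE; apply: ler_sum => k _; apply: ler_sum => l _.
rewrite !diag_mul ?diag_mx_is_diag// !mxE eqxx mulr1n.
by case: eqVneq => // _; rewrite mul0r expr0n/= sqr_ge0.
Qed.

Definition offcol (X : 'M[R]_(p, n)) i : 'cV[R]_n :=
  \col_k (if k == i then 0 else (X^T *m col i X) k 0).

Definition beta X i := fn (offcol X i) / sn.

Lemma beta_ge0 X i : 0 <= beta X i.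
Proof. by rewrite divr_ge0 ?fn_ge0 ?ltW. Qed.

(** The first factor bounds 1 + D_i x_i^T Q x_i / n; the second comes from replacing Q' x_i by x_i,
    where Q' is the resolvent without x_i. *)
Definition loo_const := (1 + kD * kX ^+ 2 / eps) * (1 + kX * kD / eps).

Lemma loo_const_ge1 : 1 <= loo_const.
Proof.
rewrite /loo_const -[X in X <= _]mulr1; apply: ler_pM => //;
  by rewrite lerDl divr_ge0 ?mulr_ge0 ?exprn_ge0 ?ltW.
Qed.

(* Removing [x_i] from the resolvent costs the bounded factor
   1 + D_i x_i^T Q x_i / n, and the remaining resolvent only sees [x_i] through
   its inner products with the other columns. *)
Lemma res_col r (C : 'M[R]_(p, r)) X D i : adm X D -> fn C <= 1 ->
  fn (C^T *m (resolvent X D *m col i X)) <=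
    loo_const * (fn (C^T *m col i X) + beta X i).
Proof.
move=> h hC; have h' := adm_remove i h; set D' := diag_remove i D in h'.
set Q := resolvent X D; set Q' := resolvent X D'; set x := col i X.
have hx : fn x <= sn * kX by case: h => /(opb_col i).
have opQ : opb Q eps^-1 := res_opb h.
have opQ' : opb Q' eps^-1 := res_opb h'.
have gd : gram X D' - gram X D = - (n%:R^-1 * D i i) *: (x *m x^T).
  rewrite /gram -scalerBr -mulmxBl -mulmxBr -opprB diag_removeE; last by case: h.
  rewrite mulmxN mulNmx scalerN scaleNr -scalerA; congr (- (_ *: _)).
  rewrite -scalemxAr -scalemxAl; congr (_ *: _).
  by rewrite -(mul_delta_mx (0 : 'I_1)) mulmxA -colE -mulmxA -rowE -tr_col.
(* The resolvent identity for the rank-one change [gd], applied to [x]. *)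
have Qx : Q *m x = (1 + n%:R^-1 * D i i * mdot x (Q *m x)) *: (Q' *m x).
  have := res_diff h' h; rewrite gd -/Q -/Q' => /eqP; rewrite subr_eq => /eqP e.
  have {e} : Q = Q' - (- (n%:R^-1 * D i i) *: Q' *m (x *m x^T)) *m Q.
    by rewrite {1}e addrAC -scalemxAl -scalemxAr subrr add0r.
  move=> /(congr1 (mulmx^~ x)); rewrite mulmxBl -!mulmxA => {1}->.
  rewrite scalerDl scale1r; congr (_ + _); rewrite scaleNr mulNmx opprK -scalemxAl -scalerA.
  congr (_ *: _); rewrite [x^T *m _]mx11_scalar mul_mx_scalar -scalemxAr.
  by rewrite mdot_trace trace_mx11.
have sc : `|1 + n%:R^-1 * D i i * mdot x (Q *m x)| <= 1 + kD * kX ^+ 2 / eps.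
  apply: le_trans (ler_normD _ _) _; rewrite normr1 lerD2l !normrM.
  rewrite ger0_norm ?invr_ge0 ?ler0n//.
  have hD : `|D i i| <= kD by apply: opb_diag; case: h.
  have hm : `|mdot x (Q *m x)| <= n%:R * (kX ^+ 2 / eps).
    apply: le_trans (mdot_le _ _) _.
    have h1 := opQ x.
    have h2 : fn x * fn (Q *m x) <= fn x * (eps^-1 * fn x).
      by apply: ler_wpM2l; rewrite ?fn_ge0.
    apply: le_trans h2 _; rewrite mulrCA mulrC -snn mulrA ler_pM2r ?invr_gt0//.
    rewrite (_ : sn * sn * kX ^+ 2 = (sn * kX) * (sn * kX)); last by ring.
    by apply: ler_pM; rewrite ?fn_ge0.
  rewrite -mulrA ler_pdivrMl//; apply: le_trans (ler_pM _ _ hD hm) _ => //.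
  by rewrite le_eqVlt; apply/orP; left; apply/eqP; ring.
have tl : fn (C^T *m (Q' *m x)) <= fn (C^T *m x) + kX * kD / eps * beta X i.
  have -> : Q' *m x = x + Q' *m (gram X D' *m x).
    by rewrite {1}/Q' (res_expand h') -/Q' mulmxDl mul1mx mulmxA.
  rewrite mulmxDr; apply: le_trans (fnD _ _) _; rewrite lerD2l.
  (* The zero i-th entry of D' suppresses the coordinate |x_i|^2 of X^T x_i, which leaves
     [offcol]. *)
  have -> : gram X D' *m x = n%:R^-1 *: (X *m (D' *m offcol X i)).
    rewrite /gram -scalemxAl -!mulmxA; congr (_ *: (_ *m _)).
    apply/matrixP => k l; rewrite !diag_mul ?diag_mx_is_diag// !mxE eqxx mulr1n ord1.
    by case: eqVneq => [->|]; rewrite ?mul0r.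
  have h0 : 0 <= sn * kX by rewrite mulr_ge0 ?ltW.
  have h1 := fn_mulmx C^T (Q' *m (n%:R^-1 *: (X *m (D' *m offcol X i)))).
  apply: le_trans h1 _; rewrite fn_tr.
  have h2 := opQ' (n%:R^-1 *: (X *m (D' *m offcol X i))).
  have h3 : fn (X *m (D' *m offcol X i)) <= sn * kX * (kD * fn (offcol X i)).
    case: h' => hX hD' _; apply: le_trans (hX _) _.
    by rewrite ler_wpM2l.
  rewrite fnZ ger0_norm ?invr_ge0 ?ler0n// in h2.
  apply: le_trans (ler_pM (fn_ge0 _) (fn_ge0 _) hC h2) _; rewrite mul1r.
  have h5 : eps^-1 * (n%:R^-1 * fn (X *m (D' *m offcol X i))) <=
      eps^-1 * (n%:R^-1 * (sn * kX * (kD * fn (offcol X i)))).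
    by apply: ler_wpM2l; [rewrite invr_ge0 ltW|apply: ler_wpM2l => //; rewrite invr_ge0 ltW].
  apply: le_trans h5 _.
  have -> : n%:R^-1 = sn^-1 * sn^-1 by rewrite -invfM snn.
  rewrite /beta le_eqVlt; apply/orP; left; apply/eqP; field.
  by rewrite !gt_eqF.
rewrite -/Q -/x Qx -scalemxAr fnZ /loo_const -[leRHS]mulrA; apply: ler_pM => //; first exact: fn_ge0.
apply: le_trans tl _.
have := fn_ge0 (C^T *m x); have := beta_ge0 X i.
have : 0 <= kX * kD / eps by rewrite divr_ge0 ?mulr_ge0 ?ltW.
by nra.
Qed.

End admissible.
End resolvent_bounds.

(** * The l^4 norm of gamma and the Lipschitz constant of the resolvent *)

Section fourth_power_functional.
Context {R : realType}.
Local Notation fn := (@frobenius_norm R _ _).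

(** Minkowski's inequality in l^4 without roots: convexity of the fourth power with weights A and B,
    applied to a_i / A and b_i / B. The cases A = 0 and B = 0 are apart because of the divisions. *)
Lemma mink4 (I : finType) (a b : I -> R) (A B : R) :
  (forall i, 0 <= a i) -> (forall i, 0 <= b i) -> 0 <= A -> 0 <= B ->
  \sum_i a i ^+ 4 <= A ^+ 4 -> \sum_i b i ^+ 4 <= B ^+ 4 ->
  \sum_i (a i + b i) ^+ 4 <= (A + B) ^+ 4.
Proof.
move=> a0 b0 A0 B0 hA hB.
have zero (c : I -> R) : \sum_i c i ^+ 4 <= 0 -> forall i, c i = 0.
  move=> h i; have : c i ^+ 4 <= 0.
    apply: le_trans h; rewrite (bigD1 i)//= lerDl sumr_ge0// => k _.
    by rewrite exprn_even_ge0.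
  move=> h4; have : c i ^+ 4 == 0 by rewrite eq_le h4 exprn_even_ge0.
  by rewrite expf_eq0 => /andP[_ /eqP].
have [Az|An] := eqVneq A 0.
  move: hA; rewrite Az expr0n => /zero az; rewrite add0r; apply: le_trans hB.
  by apply: ler_sum => i _; rewrite az add0r.
have [Bz|Bn] := eqVneq B 0.
  move: hB; rewrite Bz expr0n => /zero bz; rewrite addr0; apply: le_trans hA.
  by apply: ler_sum => i _; rewrite bz addr0.
have Ap : 0 < A by rewrite lt_neqAle eq_sym An.
have Bp : 0 < B by rewrite lt_neqAle eq_sym Bn.
have pt (s t : R) : (A * s + B * t) ^+ 4 <= (A + B) ^+ 3 * (A * s ^+ 4 + B * t ^+ 4).
  have sq (x y : R) : (A * x + B * y) ^+ 2 <= (A + B) * (A * x ^+ 2 + B * y ^+ 2).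
    rewrite -subr_ge0.
    have -> : (A + B) * (A * x ^+ 2 + B * y ^+ 2) - (A * x + B * y) ^+ 2 =
      A * B * (x - y) ^+ 2 by ring.
    by apply: mulr_ge0; [exact: mulr_ge0|exact: sqr_ge0].
  have h1 := sq s t; have h2 := sq (s ^+ 2) (t ^+ 2); rewrite -!exprM in h2.
  rewrite (exprM _ 2 2).
  have h3 : ((A * s + B * t) ^+ 2) ^+ 2 <= ((A + B) * (A * s ^+ 2 + B * t ^+ 2)) ^+ 2.
    by rewrite ler_sqr ?nnegrE ?sqr_ge0//; apply: le_trans h1; exact: sqr_ge0.
  apply: le_trans h3 _; rewrite exprMn.
  have -> : (A + B) ^+ 3 * (A * s ^+ 4 + B * t ^+ 4) =
    (A + B) ^+ 2 * ((A + B) * (A * s ^+ 4 + B * t ^+ 4)) by ring.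
  by apply: ler_wpM2l => //; exact: sqr_ge0.
have h i : (a i + b i) ^+ 4 <= (A + B) ^+ 3 * (a i ^+ 4 / A ^+ 3 + b i ^+ 4 / B ^+ 3).
  have := pt (a i / A) (b i / B).
  have -> : A * (a i / A) + B * (b i / B) = a i + b i by field; rewrite An Bn.
  by have -> : A * (a i / A) ^+ 4 + B * (b i / B) ^+ 4 =
    a i ^+ 4 / A ^+ 3 + b i ^+ 4 / B ^+ 3 by field; rewrite An Bn.
apply: le_trans (ler_sum _ (fun i _ => h i)) _.
rewrite -mulr_sumr (exprSr _ 3) ler_wpM2l ?exprn_ge0 ?addr_ge0//.
rewrite big_split -!mulr_suml /=; apply: lerD.
  by rewrite ler_pdivrMr ?exprn_gt0// -exprS.
by rewrite ler_pdivrMr ?exprn_gt0// -exprS.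
Qed.

Definition root4 (x : R) := Num.sqrt (Num.sqrt x).

Lemma root4_ge0 x : 0 <= root4 x. Proof. exact: sqrtr_ge0. Qed.

Lemma root4K x : 0 <= x -> root4 x ^+ 4 = x.
Proof. by move=> x0; rewrite (exprM _ 2 2) sqr_sqrtr ?sqrtr_ge0// sqr_sqrtr. Qed.

Lemma le_of_pow4 (x y : R) : 0 <= y -> x ^+ 4 <= y ^+ 4 -> x <= y.
Proof.
move=> y0; rewrite !(exprM _ 2 2) => h.
have [x0|x0] := ltP x 0; first exact: le_trans (ltW x0) y0.
apply: le_of_sqr => //; apply: le_of_sqr => //; exact: sqr_ge0.
Qed.

Section admissible.
Variables (p n r : nat) (kX kD eps : R) (C E : 'M[R]_(p, r)).
Hypotheses (n0 : (0 < n)%N) (kX0 : 0 < kX) (kD0 : 0 < kD) (eps0 : 0 < eps)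
  (kk : kX ^+ 2 * kD <= 1 - eps) (C1 : fn C <= 1) (E1 : fn E <= 1).

Local Notation sn := (Num.sqrt (n%:R : R)).

Let nR0 : 0 < n%:R :> R. Proof. by rewrite ltr0n. Qed.
Let sn0 : 0 < sn. Proof. by rewrite sqrtr_gt0. Qed.
Let snn : sn * sn = n%:R. Proof. by rewrite -expr2 sqr_sqrtr// ltW. Qed.

Definition gam (X : 'M[R]_(p, n)) i : R :=
  fn (C^T *m col i X) + fn (E^T *m col i X) + beta X i.

Lemma gam_ge0 X i : 0 <= gam X i.
Proof. by rewrite !addr_ge0 ?fn_ge0 ?beta_ge0. Qed.

Definition sum4 X := \sum_i gam X i ^+ 4.

Lemma sum4_ge0 X : 0 <= sum4 X.
Proof. by apply: sumr_ge0 => i _; rewrite exprn_even_ge0. Qed.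

Definition dist2 (X X' : 'M[R]_(p, n)) (D D' : 'M[R]_n) : R :=
  Num.sqrt (fn (X - X') ^+ 2 + fn (D - D') ^+ 2).

Lemma dist2_l X X' D D' : fn (X - X') <= dist2 X X' D D'.
Proof.
apply: le_of_sqr; first exact: sqrtr_ge0.
by rewrite [leRHS]sqr_sqrtr ?addr_ge0 ?sqr_ge0// lerDl sqr_ge0.
Qed.

Lemma dist2_r X X' D D' : fn (D - D') <= dist2 X X' D D'.
Proof.
apply: le_of_sqr; first exact: sqrtr_ge0.
by rewrite [leRHS]sqr_sqrtr ?addr_ge0 ?sqr_ge0// lerDr sqr_ge0.
Qed.

Variable f : {scalar 'M[R]_p}.
Hypothesis f_spec : forall A, `|f A| <= spectral_norm A.
Hypothesis f_fact : forall A, f A = mdot C (A *m E).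

Local Notation G := (loo_const kX kD eps).

(** The trace form splits over the columns as sum_i Dl_i <C^T Q x_i, E^T Q' x_i'>. One
    Cauchy-Schwarz separates [Dl] from the products of norms, a second separates the two fourth
    power sums, and [res_col] bounds each by [sum4]. *)
Lemma res_sandwich (X X' : 'M[R]_(p, n)) D D' (Dl : 'M[R]_n) W :
  adm kX kD X D -> adm kX kD X' D' -> is_diag_mx Dl -> 0 <= W ->
  sum4 X <= W ^+ 4 -> sum4 X' <= W ^+ 4 ->
  `|f (resolvent X D *m (X *m Dl *m X'^T) *m resolvent X' D')| <=
    fn Dl * (G ^+ 2 * W ^+ 2).
Proof.
move=> h h' dDl W0 hW hW'; rewrite f_fact.
set Q := resolvent X D; set Q' := resolvent X' D'.
pose Y := X^T *m (Q *m C); pose Y' := X'^T *m (Q' *m E).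
pose a i := fn (col i Y^T); pose a' i := fn (col i Y'^T).
have -> : mdot C (Q *m (X *m Dl *m X'^T) *m Q' *m E) = \sum_i Dl i i * mdot (col i Y^T) (col i Y'^T).
  have -> : Q *m (X *m Dl *m X'^T) *m Q' *m E = (Q *m X) *m (Dl *m Y').
    by rewrite /Y' !mulmxA.
  rewrite mdotC mdot_mull mdotC trmx_mul (res_tr h) -/Q -mulmxA -/Y.
  apply: eq_bigr => i _; rewrite mulr_sumr; apply: eq_bigr => l _.
  by rewrite big_ord1 diag_mul// !mxE mulrCA.
have aE i : a i <= G * gam X i.
  have -> : a i = fn (C^T *m (Q *m col i X)).
    rewrite /a; congr fn; rewrite /Y !trmx_mul trmxK (res_tr h) -/Q -mulmxA.
    by rewrite !colE !mulmxA.
  apply: le_trans (res_col n0 kX0 kD0 eps0 kk i h C1) _.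
  rewrite ler_wpM2l ?(le_trans ler01 (loo_const_ge1 _ _ _))// /gam lerD2r.
  by rewrite lerDl fn_ge0.
have a'E i : a' i <= G * gam X' i.
  have -> : a' i = fn (E^T *m (Q' *m col i X')).
    rewrite /a'; congr fn; rewrite /Y' !trmx_mul trmxK (res_tr h') -/Q' -mulmxA.
    by rewrite !colE !mulmxA.
  apply: le_trans (res_col n0 kX0 kD0 eps0 kk i h' E1) _.
  rewrite ler_wpM2l ?(le_trans ler01 (loo_const_ge1 _ _ _))// /gam lerD2r.
  by rewrite lerDr fn_ge0.
have G0 : 0 <= G by rewrite (le_trans ler01 (loo_const_ge1 _ _ _)).
have GW0 : 0 <= G * W by exact: mulr_ge0.
have s4 (b : 'I_n -> R) X0 : (forall i, 0 <= b i) -> (forall i, b i <= G * gam X0 i) ->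
    sum4 X0 <= W ^+ 4 -> \sum_i (b i ^+ 2) ^+ 2 <= (G * W) ^+ 4.
  move=> b0 hb hs; rewrite exprMn; apply: le_trans (ler_wpM2l _ hs); last exact: exprn_ge0.
  rewrite /sum4 mulr_sumr; apply: ler_sum => i _; rewrite -exprM -exprMn.
  by apply: lerXn2r; rewrite ?nnegrE// mulr_ge0// gam_ge0.
have hs : \sum_i (a i * a' i) ^+ 2 <= (G * W) ^+ 4.
  apply: le_of_sqr; first exact: exprn_ge0.
  under eq_bigr do rewrite exprMn.
  apply: le_trans (cauchy_sum _ _) _; rewrite (expr2 ((G * W) ^+ 4)).
  apply: ler_pM; try by apply: sumr_ge0 => i _; exact: sqr_ge0.
    by apply: (s4 a X) => // i; exact: fn_ge0.
  by apply: (s4 a' X') => // i; exact: fn_ge0.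
apply: le_trans (ler_norm_sum _ _ _) _.
have h1 : \sum_i `|Dl i i * mdot (col i Y^T) (col i Y'^T)| <=
    \sum_i `|Dl i i| * (a i * a' i).
  by apply: ler_sum => i _; rewrite normrM ler_wpM2l//; exact: mdot_le.
apply: le_trans h1 _; rewrite -exprMn; apply: le_of_sqr.
  by apply: mulr_ge0; [exact: fn_ge0|exact: sqr_ge0].
apply: le_trans (cauchy_sum _ _) _; rewrite [leRHS]exprMn; apply: ler_pM.
- by apply: sumr_ge0 => i _; exact: sqr_ge0.
- by apply: sumr_ge0 => i _; exact: sqr_ge0.
- rewrite fn_sqrE; apply: ler_sum => i _; rewrite real_normK ?num_real//.
  by rewrite (bigD1 i)//= lerDl sumr_ge0// => k _; exact: sqr_ge0.
by apply: le_trans hs _; rewrite -exprM.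
Qed.

(** The first term is the cost of moving [X], by operator norms; the second that of moving [D], by
    [res_sandwich]. *)
Definition res_lip W := 2 * (kX * kD / eps ^+ 2) / sn + G ^+ 2 * W ^+ 2 / n%:R.

Lemma res_lipschitz (X X' : 'M[R]_(p, n)) D D' W :
  adm kX kD X D -> adm kX kD X' D' -> 0 <= W ->
  sum4 X <= W ^+ 4 -> sum4 X' <= W ^+ 4 ->
  `|f (resolvent X D) - f (resolvent X' D')| <= res_lip W * dist2 X X' D D'.
Proof.
move=> h h' W0 hW hW'; rewrite -linearB (res_diff n0 kX0 kD0 eps0 kk h h').
set Q := resolvent X D; set Q' := resolvent X' D'.
have opQ : opb Q eps^-1 := res_opb n0 kX0 kD0 eps0 kk h.
have opQ' : opb Q' eps^-1 := res_opb n0 kX0 kD0 eps0 kk h'.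
have [hX hD dD] := h; have [hX' hD' dD'] := h'.
have dDl : is_diag_mx (D - D').
  by apply/is_diag_mxP => i j ij; rewrite !mxE !diagE ?subrr.
(* Telescoped so that in the term with D - D' each resolvent stands next to its own matrix, Q X and
   X'^T Q', as the leave-one-out bound requires. *)
have -> : gram X D - gram X' D' = n%:R^-1 *: (X *m D *m (X - X')^T +
    X *m (D - D') *m X'^T + (X - X') *m D' *m X'^T).
  rewrite /gram -scalerBr; congr (_ *: _); rewrite linearB /= !mulmxBr !mulmxBl.
  by rewrite !addrA !subrK.
rewrite -scalemxAr -scalemxAl linearZ /= normrM ger0_norm ?invr_ge0 ?ler0n//.
have split3 (A1 A2 A3 : 'M[R]_p) : f (Q *m (A1 + A2 + A3) *m Q') =
    f (Q *m A1 *m Q') + f (Q *m A2 *m Q') + f (Q *m A3 *m Q').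
  by rewrite !mulmxDr !mulmxDl !linearD.
rewrite split3.
have ei : 0 <= eps^-1 by rewrite invr_ge0 ltW.
have xi : 0 <= sn * kX by rewrite mulr_ge0 ?ltW.
have dist := dist2_l X X' D D'; have dist' := dist2_r X X' D D'.
set d := dist2 _ _ _ _ in dist dist' *.
have d0 : 0 <= d by exact: le_trans (fn_ge0 _) dist.
have t1 : `|f (Q *m (X *m D *m (X - X')^T) *m Q')| <= sn * (kX * kD / eps ^+ 2) * d.
  apply: le_trans (f_spec _) _; apply: opb_spectral.
    by rewrite !mulr_ge0 ?invr_ge0 ?exprn_ge0//; exact: ltW.
  have -> : sn * (kX * kD / eps ^+ 2) * d = eps^-1 * (sn * kX * kD * d) * eps^-1.
    by field; rewrite gt_eqF.
  apply: opb_mul => //; first by rewrite !mulr_ge0 ?invr_ge0//; exact: ltW.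
  apply: opb_mul => //; apply: opb_mul; first by rewrite !mulr_ge0//; exact: ltW.
    exact: opb_mul.
  by apply: opb_le (opb_fn _); rewrite fn_tr.
have t3 : `|f (Q *m ((X - X') *m D' *m X'^T) *m Q')| <= sn * (kX * kD / eps ^+ 2) * d.
  apply: le_trans (f_spec _) _; apply: opb_spectral.
    by rewrite !mulr_ge0 ?invr_ge0 ?exprn_ge0//; exact: ltW.
  have -> : sn * (kX * kD / eps ^+ 2) * d = eps^-1 * (d * kD * (sn * kX)) * eps^-1.
    by field; rewrite gt_eqF.
  apply: opb_mul => //; first by rewrite !mulr_ge0 ?invr_ge0//; exact: ltW.
  apply: opb_mul => //; apply: opb_mul; first by rewrite !mulr_ge0//; exact: ltW.
    by apply: opb_mul => //; apply: opb_le (opb_fn _).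
  exact: opb_tr.
have t2 := res_sandwich h h' dDl W0 hW hW'; rewrite -/Q -/Q' in t2.
have t2' : fn (D - D') * (G ^+ 2 * W ^+ 2) <= d * (G ^+ 2 * W ^+ 2).
  by rewrite ler_wpM2r// -exprMn sqr_ge0.
rewrite ler_pdivrMl//.
have -> : n%:R * (res_lip W * d) = sn * (kX * kD / eps ^+ 2) * d + d * (G ^+ 2 * W ^+ 2)
    + sn * (kX * kD / eps ^+ 2) * d.
  have := snn; have := sn0; rewrite /res_lip; move: sn => s s0 ss; rewrite -ss.
  by field; rewrite !gt_eqF.
apply: le_trans (ler_normD _ _) _; apply: lerD => //.
apply: le_trans (ler_normD _ _) _; apply: lerD => //.
exact: le_trans t2 t2'.
Qed.

(** Its square dominates 2 (2 + kX)^2 + 2 kX^2, the sum that arises in [gam_diff]. *)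
Definition gam_lip := 3 + 3 * kX.

(** The increments are controlled jointly in l^2 rather than one by one. This yields at once the
    Lipschitz bound for a single coordinate and, since the l^4 norm is below the l^2 norm, the one
    for [gam4]. *)
Lemma gam_diff (X X' : 'M[R]_(p, n)) :
  opb X (sn * kX) -> opb X' (sn * kX) ->
  exists2 dl : 'I_n -> R, (forall i, 0 <= dl i /\ gam X i <= gam X' i + dl i) &
    \sum_i dl i ^+ 2 <= (gam_lip * fn (X - X')) ^+ 2.
Proof.
move=> hX hX'; pose Z := X - X'.
have xi : 0 <= sn * kX by rewrite mulr_ge0 ?ltW.
pose dl i := 2 * fn (col i Z) + (sn * kX * fn (col i Z) + fn (Z^T *m col i X')) / sn.
have c0 i : 0 <= fn (col i Z) by exact: fn_ge0.
exists dl => [i|].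
  split; first by rewrite addr_ge0 ?divr_ge0 ?addr_ge0 ?mulr_ge0 ?fn_ge0 ?ltW.
  have colZ : col i X = col i X' + col i Z.
    by apply/matrixP => k l; rewrite !mxE addrC subrK.
  have cl (A : 'M[R]_(p, r)) : fn A <= 1 -> fn (A^T *m col i X) <= fn (A^T *m col i X') + fn (col i Z).
    move=> A1; rewrite colZ mulmxDr; apply: le_trans (fnD _ _) _; rewrite lerD2l.
    by apply: le_trans (fn_mulmx _ _) _; rewrite fn_tr ler_piMl ?fn_ge0.
  have bt : beta X i <= beta X' i + (sn * kX * fn (col i Z) + fn (Z^T *m col i X')) / sn.
    rewrite /beta -mulrDl ler_pM2r ?invr_gt0//.
    have -> : offcol X i = offcol X' i + (offcol X i - offcol X' i) by rewrite addrC subrK.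
    apply: le_trans (fnD _ _) _; rewrite lerD2l.
    have hh : fn (offcol X i - offcol X' i) <= fn (X^T *m col i Z + Z^T *m col i X').
      apply: le_of_sqr; first exact: fn_ge0.
      rewrite !fn_sqrE; apply: ler_sum => k _; rewrite !big_ord1.
      have -> : X^T *m col i Z + Z^T *m col i X' = X^T *m col i X - X'^T *m col i X'.
        have -> : Z^T = X^T - X'^T by rewrite /Z linearB.
        by rewrite colZ mulmxDr mulmxBl addrCA addrA.
      by rewrite !mxE; case: eqVneq => // _; rewrite subrr expr0n/= sqr_ge0.
    apply: le_trans hh _; apply: le_trans (fnD _ _) _; rewrite lerD2r.
    by apply: opb_tr.
  have := cl C C1; have := cl E E1; rewrite /gam /dl; lra.
have s1 : \sum_i fn (col i Z) ^+ 2 = fn Z ^+ 2 by rewrite fn_col.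
have s2 : \sum_i (fn (Z^T *m col i X') / sn) ^+ 2 <= (kX * fn Z) ^+ 2.
  under eq_bigr do rewrite expr_div_n.
  rewrite -mulr_suml ler_pdivrMr ?exprn_gt0//.
  have -> : \sum_i fn (Z^T *m col i X') ^+ 2 = fn (Z^T *m X') ^+ 2.
    by rewrite [RHS]fn_col; apply: eq_bigr => i _; rewrite !colE mulmxA.
  rewrite -exprMn ler_sqr ?nnegrE ?fn_ge0 ?mulr_ge0 ?fn_ge0 ?sqrtr_ge0 ?(ltW kX0)//.
  have := fn_mul_op Z^T xi hX'; rewrite fn_tr => hz; apply: le_trans hz _.
  by rewrite le_eqVlt; apply/orP; left; apply/eqP; ring.
have pt i : dl i ^+ 2 <= 2 * ((2 + kX) ^+ 2 * fn (col i Z) ^+ 2) + 2 * (fn (Z^T *m col i X') / sn) ^+ 2.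
  have -> : dl i = (2 + kX) * fn (col i Z) + fn (Z^T *m col i X') / sn.
    by rewrite /dl; field; rewrite gt_eqF.
  rewrite -exprMn; move: (_ * fn (col i Z)) (_ / sn) => x y.
  rewrite -subr_ge0 (_ : _ - _ = (x - y) ^+ 2) ?sqr_ge0//; ring.
apply: le_trans (ler_sum _ (fun i _ => pt i)) _.
rewrite big_split /= -!mulr_sumr s1 exprMn -/Z; rewrite exprMn in s2.
have fz := sqr_ge0 (fn Z); set F := fn Z ^+ 2 in fz s2 *.
rewrite /gam_lip.
have : 2 * ((2 + kX) ^+ 2 * F) + 2 * (kX ^+ 2 * F) <= (3 + 3 * kX) ^+ 2 * F.
  rewrite -subr_ge0.
  have -> : (3 + 3 * kX) ^+ 2 * F - (2 * ((2 + kX) ^+ 2 * F) + 2 * (kX ^+ 2 * F)) =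
    (1 + 10 * kX + 5 * kX ^+ 2) * F by ring.
  by rewrite mulr_ge0// !addr_ge0 ?mulr_ge0 ?sqr_ge0// ltW.
by apply: le_trans; rewrite lerD2l ler_wpM2l.
Qed.

Lemma gam_lipschitz (X X' : 'M[R]_(p, n)) i :
  opb X (sn * kX) -> opb X' (sn * kX) ->
  `|gam X i - gam X' i| <= gam_lip * fn (X - X').
Proof.
have gl0 : 0 <= gam_lip by rewrite addr_ge0 ?mulr_ge0 ?ltW.
suff H Y Y' : opb Y (sn * kX) -> opb Y' (sn * kX) ->
    gam Y i <= gam Y' i + gam_lip * fn (Y - Y').
  move=> hX hX'; rewrite ler_norml; have h1 := H _ _ hX hX'; have h2 := H _ _ hX' hX.
  rewrite (fn_subC X') in h2; lra.
move=> hY hY'; have [dl hd hs] := gam_diff hY hY'.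
have [d0 h1] := hd i; apply: le_trans h1 _; rewrite lerD2l.
apply: le_of_sqr; first by rewrite mulr_ge0 ?fn_ge0.
apply: le_trans hs; rewrite (bigD1 i)//= lerDl sumr_ge0// => k _; exact: sqr_ge0.
Qed.

Definition gam4 X := root4 (sum4 X).

Lemma gam4_lipschitz (X X' : 'M[R]_(p, n)) :
  opb X (sn * kX) -> opb X' (sn * kX) ->
  `|gam4 X - gam4 X'| <= gam_lip * fn (X - X').
Proof.
have gl0 : 0 <= gam_lip by rewrite addr_ge0 ?mulr_ge0 ?ltW.
suff H Y Y' : opb Y (sn * kX) -> opb Y' (sn * kX) ->
    gam4 Y <= gam4 Y' + gam_lip * fn (Y - Y').
  move=> hX hX'; rewrite ler_norml; have h1 := H _ _ hX hX'; have h2 := H _ _ hX' hX.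
  rewrite (fn_subC X') in h2; lra.
move=> hY hY'; have [dl hd hs] := gam_diff hY hY'.
have g0 : 0 <= gam_lip * fn (Y - Y') by rewrite mulr_ge0 ?fn_ge0.
apply: le_of_pow4; first by rewrite addr_ge0 ?root4_ge0.
rewrite root4K ?sum4_ge0//; apply: le_trans (_ : \sum_i (gam Y' i + dl i) ^+ 4 <= _).
  apply: ler_sum => i _; have [d0 h1] := hd i.
  by rewrite lerXn2r ?nnegrE ?gam_ge0// addr_ge0 ?gam_ge0.
apply: mink4 => //.
- by move=> i; exact: gam_ge0.
- by move=> i; case: (hd i).
- exact: root4_ge0.
- by rewrite root4K ?sum4_ge0.
apply: le_trans (_ : (\sum_i dl i ^+ 2) ^+ 2 <= _); last first.
  rewrite (exprM _ 2 2) ler_sqr ?nnegrE ?sqr_ge0//.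
  by apply: sumr_ge0 => i _; exact: sqr_ge0.
rewrite expr2 mulr_suml; apply: ler_sum => i _; rewrite (exprM _ 2 2) expr2.
rewrite ler_wpM2l ?sqr_ge0// (bigD1 i)//= lerDl sumr_ge0// => k _; exact: sqr_ge0.
Qed.

End admissible.
End fourth_power_functional.

(** * Discrete Gaussian weights *)

Section discrete_gaussian.
Context {R : realType}.
Local Notation fn := (@frobenius_norm R _ _).
Variable d : R.
Hypothesis d0 : 0 < d.

Definition rho (x : R) := expR (- (d * x) ^+ 2 / 2).

Lemma rho_gt0 x : 0 < rho x. Proof. exact: expR_gt0. Qed.

Lemma rhoN x : rho (- x) = rho x.
Proof. by rewrite /rho mulrN sqrrN. Qed.

Definition rho_sum (L : nat) := \sum_(k < (2 * L).+1) rho (k%:R - L%:R).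

Lemma sym_sum (F : R -> R) L : (forall x, F (- x) = F x) -> (forall x, 0 <= F x) ->
  \sum_(k < L.+1) F k%:R <= \sum_(k < (2 * L).+1) F (k%:R - L%:R) <=
    2 * \sum_(k < L.+1) F k%:R.
Proof.
move=> Fs F0.
have -> : \sum_(k < (2 * L).+1) F (k%:R - L%:R) =
    \sum_(k < L) F k.+1%:R + \sum_(k < L.+1) F k%:R.
  rewrite -(big_mkord xpredT (fun k => F (k%:R - L%:R))).
  rewrite (big_cat_nat (n := L))//=; last by rewrite leqW// mul2n -addnn leq_addr.
  congr (_ + _).
    rewrite big_nat_rev /= add0n big_mkord; apply: eq_bigr => k _.
    rewrite -Fs opprB; congr F; rewrite natrB ?ltn_ord//.
    by rewrite opprB addrCA subrr addr0.
  rewrite -{1}(add0n L) big_addn; have -> : ((2 * L).+1 - L = L.+1)%N.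
    by rewrite mul2n -addnn -addnS addKn.
  by rewrite big_mkord; apply: eq_bigr => k _; rewrite natrD addrK.
have h : 0 <= \sum_(k < L) F k.+1%:R by apply: sumr_ge0.
have e : \sum_(k < L.+1) F k%:R = F 0 + \sum_(k < L) F k.+1%:R.
  by rewrite big_ord_recl.
have := F0 0; lra.
Qed.

Lemma rho_sum_ge1 L : 1 <= rho_sum L.
Proof.
have /andP[h _] := sym_sum L rhoN (fun x => ltW (rho_gt0 x)).
apply: le_trans h; rewrite big_ord_recl {1}/rho mulr0 expr0n oppr0 mul0r expR0 lerDl.
by apply: sumr_ge0 => k _; exact: ltW (rho_gt0 _).
Qed.

Lemma rho_sum_bounded : exists B, forall L, rho_sum L <= B.
Proof.
pose r := expR (- d ^+ 2 / 2).
have r0 : 0 < r by exact: expR_gt0.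
have r1 : r < 1 by rewrite expR_lt1 mulNr oppr_lt0 divr_gt0 ?exprn_gt0.
exists (2 * (1 - r)^-1) => L.
have /andP[_ h] := sym_sum L rhoN (fun x => ltW (rho_gt0 x)).
apply: le_trans h _; rewrite ler_pM2l//.
have step k : rho k%:R <= r ^+ k.
  rewrite /rho /r -expRM_natl ler_expR.
  have k2 : k%:R <= k%:R ^+ 2 :> R.
    by rewrite -natrX ler_nat; case: k => // k; rewrite expnS expn1 leq_pmulr.
  have := ler_wpM2l (sqr_ge0 d) k2; rewrite exprMn; lra.
apply: le_trans (_ : \sum_(k < L.+1) r ^+ k <= _); first by apply: ler_sum => k _; exact: step.
have -> : \sum_(k < L.+1) r ^+ k = (1 - r ^+ L.+1) / (1 - r).
  have := subrX1 r L.+1; set s := \sum_(i < _) _ => e.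
  apply: (@mulIf _ (1 - r)); first by rewrite subr_eq0 gt_eqF.
  rewrite divfK ?subr_eq0 ?gt_eqF//; move: e => /(congr1 -%R); rewrite opprB => ->; ring.
by rewrite ler_piMl ?invr_ge0 ?subr_ge0 ?ltW// gtrBl exprn_gt0.
Qed.

Lemma halving_sum (h : nat -> R) m :
  (forall k, 0 <= h k) -> (forall j, h (2 * j).+1 <= h (2 * j)%N) ->
  \sum_(k < m) h k <= 2 * \sum_(j < m) h (2 * j)%N.
Proof.
move=> h0 hm.
have H : \sum_(k < 2 * m) h k <= 2 * \sum_(j < m) h (2 * j)%N.
  elim: m => [|m IH]; first by rewrite muln0 !big_ord0 mulr0.
  rewrite mulnS add2n !big_ord_recr /=; have := hm m; lra.
apply: le_trans H.
rewrite -(big_mkord xpredT h) -(big_mkord xpredT h).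
rewrite [leRHS](big_cat_nat (n := m)) ?leq_pmull//= lerDl.
by apply: sumr_ge0.
Qed.

(** Half of the exponent absorbs the square, since y exp(-y) <= 1 with y = (d x)^2 / 4; the wider
    Gaussian [g] that remains is compared with [rho] by doubling the argument. The constant is 4
    (from y) times 2 (parity) times 2 (symmetry), uniformly in the mesh [d] and the cutoff [L]. *)
Lemma rho_sum_moment L :
  \sum_(k < (2 * L).+1) (d * (k%:R - L%:R)) ^+ 2 * rho (k%:R - L%:R)
    <= 16 * rho_sum L.
Proof.
pose g (x : R) := expR (- (d * x) ^+ 2 / 4).
have gs x : g (- x) = g x by rewrite /g mulrN sqrrN.
have g0 x : 0 <= g x by exact: expR_ge0.
have pt x : (d * x) ^+ 2 * rho x <= 4 * g x.
  set y := (d * x) ^+ 2 / 4.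
  have -> : (d * x) ^+ 2 = 4 * y by rewrite /y; field.
  have -> : rho x = expR (- y) * g x.
    by rewrite /rho /g -expRD /y; congr expR; field.
  rewrite -mulrA ler_pM2l// mulrA ler_piMl//.
  rewrite expRN ler_pdivrMr ?expR_gt0// mul1r.
  by apply: le_trans (expR_ge1Dx _); rewrite lerDr.
apply: le_trans (_ : \sum_(k < (2 * L).+1) 4 * g (k%:R - L%:R) <= _).
  by apply: ler_sum => k _; exact: pt.
rewrite -mulr_sumr.
have /andP[_ h1] := sym_sum L gs g0.
have /andP[h2 _] := sym_sum L rhoN (fun x => ltW (rho_gt0 x)).
have h3 := @halving_sum (fun k => g k%:R) L.+1 (fun k => g0 _).
have {}h3 : \sum_(k < L.+1) g k%:R <= 2 * \sum_(k < L.+1) rho k%:R.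
  apply: le_trans (h3 _) _.
    move=> j; rewrite /g ler_expR !mulNr lerN2 ler_pM2r ?invr_gt0//.
    rewrite !exprMn ler_pM2l ?exprn_gt0// ler_sqr ?nnegrE//.
    by rewrite ler_nat.
  rewrite ler_pM2l//; apply: ler_sum => j _.
  rewrite /g /rho ler_expR natrM.
  have := sqr_ge0 (d * j%:R).
  have -> : (d * (2 * j%:R)) ^+ 2 = 4 * (d * j%:R) ^+ 2 by ring.
  move: (_ ^+ 2) => z; lra.
rewrite /rho_sum; lra.
Qed.

Section grid.
Variable q : nat.

Definition grid L := {ffun 'I_q -> 'I_(2 * L).+1}.

Definition gpt L (a : grid L) : 'cV[R]_q := \col_l (d * ((a l)%:R - L%:R)).

Definition gwt (v : 'cV[R]_q) := expR (- fn v ^+ 2 / 2).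

Lemma gwt_gt0 v : 0 < gwt v. Proof. exact: expR_gt0. Qed.

Lemma gwt_prod L (a : grid L) : gwt (gpt a) = \prod_l rho ((a l)%:R - L%:R).
Proof.
rewrite /gwt fn_sqrE -expR_sum; congr expR; rewrite -mulr_suml -sumrN.
by congr (_ / _); apply: eq_bigr => l _; rewrite big_ord1 mxE.
Qed.

Definition gtot L := \sum_(a : grid L) gwt (gpt a).

Lemma gtotE L : gtot L = rho_sum L ^+ q.
Proof.
rewrite /gtot; under eq_bigr do rewrite gwt_prod.
rewrite -(bigA_distr_bigA (fun=> fun k : 'I_(2 * L).+1 => rho (k%:R - L%:R))) /=.
by rewrite prodr_const card_ord.
Qed.

Lemma gtot_gt0 L : 0 < gtot L.
Proof. by rewrite gtotE exprn_gt0// (lt_le_trans ltr01 (rho_sum_ge1 _)). Qed.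

(** Translates of a grid of cutoff [L] by vectors of cutoff [Z] live in cutoff [L + Z]; here the
    enlargement costs a factor 2. The total mass is bounded in [L], so it cannot double at every
    step of length [Z]. *)
Lemma gtot_double Z : exists L, gtot (L + Z) <= 2 * gtot L.
Proof.
have [B hB] := rho_sum_bounded.
apply: contrapT => H.
have grow m : 2 ^+ m <= gtot (m * Z).
  elim: m => [|m IH]; first by rewrite expr0 gtotE exprn_ege1// rho_sum_ge1.
  rewrite exprS mulSn addnC; have : ~ gtot (m * Z + Z) <= 2 * gtot (m * Z).
    by move=> h; apply: H; exists (m * Z)%N.
  by move=> /negP; rewrite -ltNge => /ltW; apply: le_trans; rewrite ler_pM2l.
have bnd m : (2 : R) ^+ m <= B ^+ q.
  apply: le_trans (grow m) _; rewrite gtotE lerXn2r ?nnegrE//.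
    exact: le_trans ler01 (rho_sum_ge1 _).
  exact: le_trans ler01 (le_trans (rho_sum_ge1 0) (hB 0%N)).
have B0 : 0 <= B ^+ q.
  by rewrite exprn_ge0//; exact: le_trans ler01 (le_trans (rho_sum_ge1 0) (hB 0%N)).
have := archi_boundP B0; set m := Num.bound _ => hm.
have := bnd m; rewrite leNgt => /negP; apply; apply: lt_le_trans hm _.
by rewrite -natrX ler_nat ltnW// ltn_expl.
Qed.

(** Replaces E|g|^2 = q for a standard Gaussian vector; the product weights reduce it to the
    one-dimensional second moment. *)
Lemma gmoment L : \sum_(a : grid L) gwt (gpt a) * fn (gpt a) ^+ 2 <= 16 * q%:R * gtot L.
Proof.
have S0 : 0 <= rho_sum L := le_trans ler01 (rho_sum_ge1 _).
have -> : \sum_(a : grid L) gwt (gpt a) * fn (gpt a) ^+ 2 =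
    \sum_(i < q) \sum_(a : grid L)
      \prod_l ((if l == i then (d * ((a l)%:R - L%:R)) ^+ 2 else 1) * rho ((a l)%:R - L%:R)).
  rewrite exchange_big; apply: eq_bigr => a _ /=; rewrite fn_sqrE mulr_sumr.
  apply: eq_bigr => i _; rewrite big_ord1 mxE big_split /= -gwt_prod mulrC; congr (_ * _).
  by rewrite -big_mkcond /= big_pred1_eq.
have -> : 16 * q%:R * gtot L = \sum_(i < q) 16 * gtot L.
  by rewrite sumr_const card_ord mulrAC -[RHS]mulr_natr.
apply: ler_sum => i _.
rewrite -(bigA_distr_bigA (fun l => fun k : 'I_(2 * L).+1 =>
  (if l == i then (d * (k%:R - L%:R)) ^+ 2 else 1) * rho (k%:R - L%:R))) /=.
have -> : 16 * gtot L = \prod_(l < q) ((if l == i then 16 else 1) * rho_sum L).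
  rewrite big_split /= prodr_const card_ord -gtotE; congr (_ * _).
  by rewrite -big_mkcond /= big_pred1_eq.
apply: ler_prod => l _; apply/andP; split.
  apply: sumr_ge0 => k _; apply: mulr_ge0; last exact: ltW (rho_gt0 _).
  by case: ifP => // _; exact: sqr_ge0.
case: ifP => _; first exact: rho_sum_moment.
by rewrite mul1r; under eq_bigr do rewrite mul1r.
Qed.

Section shift.
Variables (L Z : nat).

Definition zvec (u : 'I_q -> 'I_(2 * Z).+1) : 'cV[R]_q := \col_l (d * ((u l)%:R - Z%:R)).

Lemma gshift_subproof (a : grid L) (u : 'I_q -> 'I_(2 * Z).+1) l :
  (a l + u l < (2 * (L + Z)).+1)%N.
Proof. by rewrite ltnS mulnDr leq_add// -ltnS. Qed.

Definition gshift (u : 'I_q -> 'I_(2 * Z).+1) (a : grid L) : grid (L + Z) :=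
  [ffun l => Ordinal (gshift_subproof a u l)].

Lemma gpt_shift u a : gpt (gshift u a) = gpt a + zvec u.
Proof.
apply/matrixP => l k; rewrite !mxE ffunE /= !natrD; ring.
Qed.

Lemma gpt_inj (L' : nat) : injective (@gpt L').
Proof.
move=> a b ab; apply/ffunP => l; apply/val_inj/eqP.
have /matrixP/(_ l 0) := ab; rewrite !mxE => /(mulfI (lt0r_neq0 d0)).
by move=> /addIr/eqP; rewrite eqr_nat.
Qed.

Definition gneg (a : grid L) : grid L := [ffun l => rev_ord (a l)].

Lemma gpt_neg a : gpt (gneg a) = - gpt a.
Proof.
apply/matrixP => l k; rewrite !mxE ffunE /= subSS natrB; last by rewrite -ltnS.
rewrite natrM; ring.
Qed.

Lemma gnegK : involutive gneg.
Proof. by move=> a; apply/ffunP => l; rewrite !ffunE rev_ordK. Qed.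

(* Averaging over a and -a turns the density ratio exp(-<a,z>) into cosh >= 1. *)
Lemma gshift_weight (A : pred 'cV[R]_q) u : (forall v, A (- v) = A v) ->
  expR (- fn (zvec u) ^+ 2 / 2) * \sum_(a : grid L | A (gpt a)) gwt (gpt a) <=
  \sum_(a : grid L | A (gpt a)) gwt (gpt (gshift u a)).
Proof.
move=> As; set z := zvec u; set E := expR _.
have sy : \sum_(a : grid L | A (gpt a)) gwt (gpt (gshift u a)) =
    \sum_(a : grid L | A (gpt a)) gwt (gpt a - z).
  rewrite (reindex_inj (inv_inj gnegK)) /=; apply: eq_big => a.
    by rewrite gpt_neg As.
  move=> _; rewrite gpt_shift gpt_neg.
  have -> : - gpt a + zvec u = - (gpt a - z) by rewrite opprB addrC.
  by rewrite /gwt fnN.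
have pt v : 2 * (E * gwt v) <= gwt (v + z) + gwt (v - z).
  have e1 : gwt (v + z) = E * gwt v * expR (- mdot v z).
    rewrite /gwt /E -!expRD; congr expR; rewrite !fn_sqr mdotDl !mdotDr (mdotC z v).
    by field.
  have e2 : gwt (v - z) = E * gwt v * expR (mdot v z).
    rewrite /gwt /E -!expRD; congr expR.
    rewrite !fn_sqr mdotDl !mdotDr !mdotNl !mdotNr (mdotC z v).
    by field.
  rewrite e1 e2 -mulrDr mulrC ler_pM2l ?mulr_gt0 ?expR_gt0//.
  have := expR_ge1Dx (mdot v z); have := expR_ge1Dx (- mdot v z); lra.
suff : 2 * (E * \sum_(a : grid L | A (gpt a)) gwt (gpt a)) <=
    \sum_(a : grid L | A (gpt a)) gwt (gpt (gshift u a)) +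
    \sum_(a : grid L | A (gpt a)) gwt (gpt a - z).
  by rewrite -sy; lra.
rewrite -big_split /= !mulr_sumr; apply: ler_sum => a _.
by rewrite gpt_shift; exact: pt.
Qed.

(** By [gshift_weight] each translate of [A] keeps at least the fraction exp(-b) of its mass; the
    translates are disjoint and all lie in the larger grid. *)
Lemma gpacking (N : nat) (A : pred 'cV[R]_q) (u : 'I_N -> 'I_q -> 'I_(2 * Z).+1) b :
  (forall v, A (- v) = A v) -> (forall i, fn (zvec (u i)) ^+ 2 / 2 <= b) ->
  (forall i k v w, A v -> A w -> i != k -> v + zvec (u i) != w + zvec (u k)) ->
  N%:R * expR (- b) * \sum_(a : grid L | A (gpt a)) gwt (gpt a) <= gtot (L + Z).
Proof.
move=> As hb hd; set m := \sum_(a | _) _.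
have m0 : 0 <= m by apply: sumr_ge0 => a _; exact: ltW (gwt_gt0 _).
pose Pa := [set x : 'I_N * grid L | A (gpt x.2)]%SET.
pose F (x : 'I_N * grid L) := gshift (u x.1) x.2.
have Finj : {in Pa &, injective F}.
  move=> [i a] [k b']; rewrite !inE /= => Aa Ab e.
  have e' : gpt a + zvec (u i) = gpt b' + zvec (u k).
    by rewrite -!gpt_shift; congr gpt.
  have ik : i = k.
    by apply/eqP; apply: contraT => /(hd i k _ _ Aa Ab); rewrite e' eqxx.
  by move: e'; rewrite ik => /addIr/gpt_inj ->.
have -> : N%:R * expR (- b) * m = \sum_(i < N) expR (- b) * m.
  by rewrite sumr_const card_ord -mulrA mulr_natl.
apply: le_trans (_ : \sum_(i < N) \sum_(a : grid L | A (gpt a)) gwt (gpt (gshift (u i) a)) <= _).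
  apply: ler_sum => i _; apply: le_trans (gshift_weight (u i) As).
  by rewrite -/m ler_wpM2r// ler_expR mulNr lerN2.
rewrite pair_big_dep /= (eq_bigl (fun x => x \in Pa)); last by move=> x; rewrite inE.
rewrite -(big_imset (fun g => gwt (gpt g)) Finj) /= /gtot.
rewrite [leRHS](bigID (mem [set F x | x in Pa]%SET)) /= lerDl.
by apply: sumr_ge0 => a _; exact: ltW (gwt_gt0 _).
Qed.

End shift.
End grid.
End discrete_gaussian.

(** * Bounded random variables and concentration *)

Section bounded_rv.
Context {d : measure_display} {T : measurableType d} {R : realType}
  (P : probability T R).

(** Almost sure boundedness is inherited from the bounds on |X| and |D|. It is stable under
    products, so expectations can be handled as real numbers without integrability conditions. *)
Definition bdd (f : T -> R) :=
  measurable_fun setT f /\ exists M, {ae P, forall w, `|f w| <= M}.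

Definition Ex (f : T -> R) : R := fine (\int[P]_w (f w)%:E)%E.
Definition Pr (A : set T) : R := fine (P A).

Lemma PrE A : measurable A -> P A = (Pr A)%:E.
Proof. by move=> mA; rewrite fineK// fin_num_measure. Qed.

Lemma Pr_ge0 A : 0 <= Pr A. Proof. exact: fine_ge0. Qed.

Lemma Pr_le1 A : measurable A -> Pr A <= 1.
Proof. by move=> mA; rewrite -lee_fin -PrE// probability_le1. Qed.

Lemma Pr_le A B : measurable A -> measurable B -> A `<=` B -> Pr A <= Pr B.
Proof.
by move=> mA mB AB; rewrite -lee_fin -!PrE//; apply: le_measure; rewrite ?inE.
Qed.

Lemma PrU A B : measurable A -> measurable B -> Pr (A `|` B) <= Pr A + Pr B.
Proof.
move=> mA mB; rewrite -lee_fin EFinD -!PrE//; last exact: measurableU.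
exact: measureU2.
Qed.

Lemma PrC A : measurable A -> Pr (~` A) = 1 - Pr A.
Proof.
move=> mA; have := probability_setC P mA; rewrite !PrE//; last exact: measurableC.
by move=> [].
Qed.

Lemma Pr_ae_le A B : measurable A -> measurable B ->
  {ae P, forall w, A w -> B w} -> Pr A <= Pr B.
Proof.
move=> mA mB [N [mN N0 hN]]; have : Pr A <= Pr (B `|` N).
  apply: Pr_le => //; first exact: measurableU.
  move=> w Aw; have [Bw|nB] := pselect (B w); [by left|right].
  by apply: hN => /= h; apply: nB; exact: h.
move=> h; apply: le_trans h _; apply: le_trans (PrU mB mN) _.
by rewrite /Pr N0 /= addr0.
Qed.

Lemma Pr_bigU (I : finType) (A : I -> set T) : (forall i, measurable (A i)) ->
  Pr [set w | exists i, A i w] <= \sum_i Pr (A i).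
Proof.
move=> mA.
have H (s : seq I) : measurable [set w | exists2 i, i \in s & A i w] /\
    Pr [set w | exists2 i, i \in s & A i w] <= \sum_(i <- s) Pr (A i).
  elim: s => [|i s [ms IH]].
    rewrite big_nil (_ : [set w | _] = set0); first by split => //; rewrite /Pr measure0.
    by apply/seteqP; split => w // [i].
  rewrite (_ : [set w | _] = A i `|` [set w | exists2 i, i \in s & A i w]).
    split; first exact: measurableU.
    by rewrite big_cons; apply: le_trans (PrU _ _) _ => //; rewrite lerD2l.
  apply/seteqP; split => w.
    move=> [k]; rewrite inE => /orP[/eqP->|ks] Ak; first by left.
    by right; exists k.
  move=> [Ai|[k ks Ak]]; first by exists i; rewrite ?mem_head.
  by exists k => //; rewrite inE ks orbT.
have [_] := H (index_enum I); rewrite (_ : [set w | _] = [set w | exists i, A i w])//.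
apply/seteqP; split => w; first by move=> [i _ ?]; exists i.
by move=> [i ?]; exists i; rewrite ?mem_index_enum.
Qed.

Lemma Pr_ex A B : measurable A -> 0 < Pr A -> {ae P, forall w, B w} ->
  exists w, A w /\ B w.
Proof.
move=> mA A0 hB; apply: contrapT => H; move: A0.
have -> : Pr A = 0; last by rewrite ltxx.
apply/eqP; rewrite eq_le Pr_ge0 andbT.
have := @Pr_ae_le A set0 mA measurable0; rewrite {2}/Pr measure0; apply.
by apply: filterS hB => w Bw Aw; apply: H; exists w.
Qed.

Lemma integral_cstP c : (\int[P]_w cst c w = c)%E.
Proof.
rewrite integral_cst// -[RHS]mule1; congr (_ * _)%E.
exact: probability_setT.
Qed.

Lemma bdd_integrable f : bdd f -> P.-integrable setT (EFin \o f).
Proof.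
move=> [mf [M hM]]; apply/integrableP; split; first exact/measurable_EFinP.
apply: (@le_lt_trans _ _ (\int[P]_w (cst `|M|%:E w))%E); last first.
  by rewrite integral_cstP ltry.
have -> : (\int[P]_w (`|(EFin \o f) w|) = \int[P]_w ((Num.min `|f w| `|M|)%:E))%E.
  apply: ae_eq_integral => //.
  - by apply: measurableT_comp => //; exact/measurable_EFinP.
  - apply/measurable_EFinP; apply: measurable_minr => //.
    exact: measurableT_comp.
  apply: filterS hM => w hw _ /=; congr EFin.
  by rewrite min_l//; apply: le_trans hw (ler_norm _).
apply: ge0_le_integral => //.
- by apply/measurable_EFinP; apply: measurable_minr => //; exact: measurableT_comp.
- by move=> w _; rewrite lee_fin ge_min lexx orbT.
Qed.

Lemma bdd_cst c : bdd (cst c).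
Proof. by split; [exact: measurable_cst|exists `|c|; apply: filterE]. Qed.

Lemma bddD f g : bdd f -> bdd g -> bdd (fun w => f w + g w).
Proof.
move=> [mf [M hf]] [mg [N hg]]; split; first exact: measurable_funD.
exists (M + N); move: hf hg; apply: filterS2 => w h1 h2.
by apply: le_trans (ler_normD _ _) (lerD h1 h2).
Qed.

Lemma bddM f g : bdd f -> bdd g -> bdd (fun w => f w * g w).
Proof.
move=> [mf [M hf]] [mg [N hg]]; split; first exact: measurable_funM.
by exists (M * N); move: hf hg; apply: filterS2 => w h1 h2; rewrite normrM ler_pM.
Qed.

Lemma bddZ c f : bdd f -> bdd (fun w => c * f w).
Proof. by move=> h; apply: bddM => //; exact: bdd_cst. Qed.

Lemma bddN f : bdd f -> bdd (fun w => - f w).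
Proof.
move=> h; have := bddZ (-1) h.
by under [X in bdd X]eq_fun do rewrite mulN1r.
Qed.

Lemma bddB f g : bdd f -> bdd g -> bdd (fun w => f w - g w).
Proof. by move=> hf hg; apply: bddD => //; exact: bddN. Qed.

Lemma bddX f k : bdd f -> bdd (fun w => f w ^+ k).
Proof.
move=> h; elim: k => [|k IH].
  by under [X in bdd X]eq_fun do rewrite expr0; exact: bdd_cst.
by under [X in bdd X]eq_fun do rewrite exprS; exact: bddM.
Qed.

Lemma bdd_sum (I : Type) (s : seq I) (F : I -> T -> R) :
  (forall i, bdd (F i)) -> bdd (fun w => \sum_(i <- s) F i w).
Proof.
move=> h; elim: s => [|i s IH].
  by under [X in bdd X]eq_fun do rewrite big_nil; exact: bdd_cst.
by under [X in bdd X]eq_fun do rewrite big_cons; exact: bddD.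
Qed.

Lemma bdd_ind A : measurable A -> bdd (\1_A).
Proof.
move=> mA; split; first exact: measurable_indic.
by exists 1; apply: filterE => w; rewrite indicE; case: (_ \in _); rewrite ?normr1 ?normr0.
Qed.

Lemma bdd_norm f : bdd f -> bdd (fun w => `|f w|).
Proof.
move=> [mf [M h]]; split; first exact: measurableT_comp.
by exists M; apply: filterS h => w; rewrite normr_id.
Qed.

Lemma ExD f g : bdd f -> bdd g -> Ex (fun w => f w + g w) = Ex f + Ex g.
Proof. by move=> hf hg; apply: RintegralD => //; exact: bdd_integrable. Qed.

Lemma ExZ c f : bdd f -> Ex (fun w => c * f w) = c * Ex f.
Proof. by move=> hf; apply: RintegralZl => //; exact: bdd_integrable. Qed.

Lemma ExB f g : bdd f -> bdd g -> Ex (fun w => f w - g w) = Ex f - Ex g.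
Proof. by move=> hf hg; apply: RintegralB => //; exact: bdd_integrable. Qed.

Lemma Ex_cst c : Ex (cst c) = c.
Proof. by rewrite /Ex (integral_cstP c%:E). Qed.

Lemma Ex_sum (I : Type) (s : seq I) (F : I -> T -> R) : (forall i, bdd (F i)) ->
  Ex (fun w => \sum_(i <- s) F i w) = \sum_(i <- s) Ex (F i).
Proof.
move=> h; elim: s => [|i s IH].
  by under [X in Ex X]eq_fun do rewrite big_nil; rewrite big_nil; exact: Ex_cst.
under [X in Ex X]eq_fun do rewrite big_cons.
by rewrite ExD ?big_cons ?IH//; exact: bdd_sum.
Qed.

Lemma Ex_ind A : measurable A -> Ex (\1_A) = Pr A.
Proof. by move=> mA; rewrite /Ex integral_indic// setIT. Qed.

Lemma Ex_ge0 f : (forall w, 0 <= f w) -> 0 <= Ex f.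
Proof. by move=> f0; apply: Rintegral_ge0. Qed.

Lemma Ex_ae f g : bdd f -> bdd g -> {ae P, forall w, f w = g w} -> Ex f = Ex g.
Proof.
move=> [mf _] [mg _] h; congr fine; apply: ae_eq_integral => //.
- exact/measurable_EFinP.
- exact/measurable_EFinP.
by apply: filterS h => w -> _.
Qed.

Lemma Ex_le f g : bdd f -> bdd g -> {ae P, forall w, f w <= g w} -> Ex f <= Ex g.
Proof.
move=> hf hg h; rewrite -subr_ge0 -ExB//.
have hgf : bdd (fun w => g w - f w) by exact: bddB.
rewrite (@Ex_ae _ (fun w => `|g w - f w|)) => //.
- by apply: Ex_ge0 => w; exact: normr_ge0.
- exact: bdd_norm.
by apply: filterS h => w hw; rewrite ger0_norm// subr_ge0.
Qed.

Lemma Ex_norm f : bdd f -> `|Ex f| <= Ex (fun w => `|f w|).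
Proof.
move=> hf; rewrite ler_norml; apply/andP; split; last first.
  by apply: Ex_le => //; [exact: bdd_norm|apply: filterE => w; exact: ler_norm].
rewrite -mulN1r -ExZ; last exact: bdd_norm.
apply: Ex_le => //; first by apply: bddZ; exact: bdd_norm.
by apply: filterE => w; rewrite mulN1r lerNl -normrN ler_norm.
Qed.

Lemma Ex_sqr_le f : bdd f -> Ex f ^+ 2 <= Ex (fun w => f w ^+ 2).
Proof.
move=> hf; have h2 : bdd (fun w => f w ^+ 2) by exact: bddX.
have := @Ex_ge0 (fun w => (f w - Ex f) ^+ 2) (fun w => sqr_ge0 _).
have -> : Ex (fun w => (f w - Ex f) ^+ 2) =
    Ex (fun w => (f w ^+ 2 + (- (2 * Ex f)) * f w) + cst (Ex f ^+ 2) w).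
  congr Ex; apply/funext => w /=; ring.
rewrite ExD ?Ex_cst; [|by apply: bddD => //; exact: bddZ|exact: bdd_cst].
rewrite ExD//; last exact: bddZ.
rewrite ExZ//; rewrite !expr2; lra.
Qed.

Lemma measurable_le_set (f : T -> R) (t : R) : measurable_fun setT f -> measurable [set w | t <= f w].
Proof.
move=> mf; have := mf measurableT `[t, +oo[%classic (measurable_itv _).
rewrite setTI; congr (measurable _); apply/seteqP; split => w /=; by rewrite in_itv/= andbT.
Qed.

Lemma measurable_ltr_set (f : T -> R) (t : R) : measurable_fun setT f -> measurable [set w | t < f w].
Proof.
move=> mf; have := mf measurableT `]t, +oo[%classic (measurable_itv _).
rewrite setTI; congr (measurable _); apply/seteqP; split => w /=; by rewrite in_itv/= andbT.
Qed.

(* Y <= 1 + #{k >= 1 : k <= Y}, and the tail at k is at most C 2^-k. *)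
Lemma Ex_exp_tail Y C : bdd Y -> (forall w, 0 <= Y w) -> 0 <= C ->
  (forall t, 0 < t -> Pr [set w | t <= Y w] <= C * expR (- t)) -> Ex Y <= 1 + C.
Proof.
move=> hY Y0 C0 tail; have [mY [M hM]] := hY.
pose N := (Num.bound `|M|).
have mA k : measurable [set w | k.+1%:R <= Y w] by exact: measurable_le_set.
have hs : bdd (fun w => \sum_(k < N) \1_[set w | k.+1%:R <= Y w] w).
  by apply: bdd_sum => k; exact: bdd_ind.
have le1 : Ex Y <= Ex (fun w => cst 1 w + \sum_(k < N) \1_[set w | k.+1%:R <= Y w] w).
  apply: Ex_le => //; first by apply: bddD => //; exact: bdd_cst.
  apply: filterS hM => w hw /=.
  have YN : Y w <= N%:R.
    apply: le_trans (le_trans (ler_norm _) hw) _.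
    by apply: le_trans (ler_norm _) _; exact: ltW (archi_boundP (normr_ge0 _)).
  elim: (N) YN => [|k IH]; first by rewrite big_ord0 addr0 => h; apply: le_trans h ler01.
  rewrite big_ord_recr /= => h; have [hk|hk] := leP (Y w) k%:R.
    by apply: le_trans (IH hk) _; rewrite lerD2l lerDl indicE.
  have -> : \sum_(i < k) \1_[set w0 | i.+1%:R <= Y w0] w = k%:R :> R.
    rewrite -[in RHS](card_ord k) -sumr_const; apply: eq_bigr => i _.
    rewrite indicE mem_set//=; apply: le_trans (ltW hk).
    by rewrite ler_nat.
  rewrite indicE; have [hh|hh] := leP k.+1%:R (Y w).
    by rewrite mem_set//=; move: h; rewrite -natr1; lra.
  rewrite memNset ?addr0 /=; last by apply/negP; rewrite -ltNge.
  by move: hh; rewrite -natr1; lra.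
apply: le_trans le1 _; rewrite ExD ?Ex_cst ?lerD2l//; last exact: bdd_cst.
rewrite Ex_sum; last by move=> k; exact: bdd_ind.
have step k : Ex (\1_[set w | k.+1%:R <= Y w]) <= C * 2^-1 ^+ k.+1.
  rewrite Ex_ind//; apply: le_trans (tail _ _) _; first by rewrite ltr0n.
  rewrite ler_wpM2l// expRN -[k.+1%:R]mulr1 expRM_natl -exprVn.
  rewrite lerXn2r ?nnegrE ?invr_ge0 ?expR_ge0// lef_pV2 ?posrE ?expR_gt0//.
  by apply: le_trans (expR_ge1Dx _); lra.
apply: le_trans (_ : \sum_(k < N) C * 2^-1 ^+ k.+1 <= _).
  by apply: ler_sum => k _; exact: step.
rewrite -mulr_sumr ler_piMr//.
suff -> : \sum_(k < N) 2^-1 ^+ k.+1 = 1 - 2^-1 ^+ N :> R.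
  by rewrite gerBl exprn_ge0// invr_ge0.
elim: (N) => [|k IH]; first by rewrite big_ord0 expr0 subrr.
by rewrite big_ord_recr /= IH exprS; field.
Qed.

End bounded_rv.

(** * Bounded Lipschitz extension *)

Section mcshane.
Context {R : realType} {U : Type}.
Variables (dist : U -> U -> R) (A : set U) (g : U -> R) (L b : R).
Hypotheses (dist_ge0 : forall x y, 0 <= dist x y) (dist_xx : forall x, dist x x = 0)
  (dist_sym : forall x y, dist x y = dist y x)
  (dist_tri : forall x y z, dist x z <= dist x y + dist y z).
Hypotheses (L0 : 0 <= L) (b0 : 0 <= b)
  (gL : forall x y, A x -> A y -> `|g x - g y| <= L * dist x y)
  (gb : forall x, A x -> `|g x| <= b).

(** The infimum over [a] in [A] of g a + L dist x a, truncated to [-b, b]. Truncation keeps the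
    Lipschitz constant and the values on [A], and later bounds the error on the bad event. *)
Lemma mcshane : exists h : U -> R,
  [/\ forall x, A x -> h x = g x, forall x y, `|h x - h y| <= L * dist x y &
      forall x, `|h x| <= b].
Proof.
have [[a0 Aa0]|nA] := pselect (A !=set0); last first.
  exists (fun=> 0); split=> [x Ax|x y|x]; rewrite ?subrr ?normr0 ?mulr_ge0//.
  by case: nA; exists x.
pose E x := [set g a + L * dist x a | a in A].
have E0 x : E x !=set0 by exists (g a0 + L * dist x a0); exists a0.
have Elb x : lbound (E x) (- b).
  move=> _ [a Aa <-]; have := gb Aa; rewrite ler_norml => /andP[h _].
  by apply: le_trans h _; rewrite lerDl mulr_ge0.
have hE x : has_lbound (E x) by exists (- b).
pose h0 x := inf (E x).
have h0g x : A x -> h0 x = g x.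
  move=> Ax; apply/eqP; rewrite eq_le; apply/andP; split.
    by apply: ge_inf => //; exists x => //; rewrite dist_xx mulr0 addr0.
  apply: lb_le_inf => // _ [a Aa <-]; have := gL Ax Aa; rewrite ler_norml; lra.
have h0L x y : h0 x - h0 y <= L * dist x y.
  rewrite lerBlDr -lerBlDl; apply: lb_le_inf => // _ [a Aa <-].
  rewrite lerBlDl addrCA -mulrDr; apply: le_trans (_ : g a + L * dist x a <= _).
    by apply: ge_inf => //; exists a.
  by rewrite lerD2l ler_wpM2l.
pose cl (t : R) := Num.max (- b) (Num.min b t).
have clL s t : cl s - cl t <= `|s - t|.
  have h := ler_norm (s - t); have h2 := normr_ge0 (s - t).
  rewrite /cl /Num.max /Num.min; do ! case: ifP => //; move=> *;
  repeat match goal with H : (_ < _) = _ |- _ => move: H end; lra.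
have clb t : `|cl t| <= b.
  rewrite ler_norml; apply/andP; split; first by rewrite le_max lexx.
  rewrite ge_max ge_min lexx /= andbT; apply: le_trans b0; rewrite oppr_le0; exact: b0.
exists (fun x => cl (h0 x)); split => // [x Ax|x y].
  rewrite h0g//; have := gb Ax; rewrite ler_norml => /andP[h1 h2].
  by rewrite /cl min_r// max_r.
have hab s t : `|s - t| = `|t - s| :> R by rewrite distrC.
have hn x' y' : `|h0 x' - h0 y'| <= L * dist x' y'.
  rewrite ler_norml h0L andbT lerNl opprB dist_sym; exact: h0L.
rewrite ler_norml; apply/andP; split; last exact: le_trans (clL _ _) (hn _ _).
rewrite lerNl opprB; apply: le_trans (clL _ _) _; rewrite hab; exact: hn.
Qed.

End mcshane.

(** * Gaussian tails and functions that are Lipschitz on a subset *)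

Section concentration_tools.
Context {d : measure_display} {T : measurableType d} {R : realType}
  (P : probability T R).
Local Notation fn := (@frobenius_norm R _ _).
Local Notation Ex := (Ex P).
Local Notation Pr := (Pr P).
Local Notation bdd := (bdd P).

Definition subg (C0 v : R) (h : T -> R) := bdd h /\
  forall t, 0 < t -> Pr [set w | t <= `|h w - Ex h|] <= C0 * expR (- (t / v) ^+ 2).

Section one_variable.
Variables (C0 v : R) (h : T -> R).
Hypotheses (C00 : 0 < C0) (v0 : 0 < v) (hh : subg C0 v h).

Let bh : bdd h. Proof. by case: hh. Qed.
Let bhc : bdd (fun w => h w - Ex h). Proof. by apply: bddB => //; exact: bdd_cst. Qed.
Let mdev t : measurable [set w | t <= `|h w - Ex h|].
Proof. by apply: measurable_le_set; case: (bdd_norm bhc). Qed.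

Lemma subg_var : Ex (fun w => (h w - Ex h) ^+ 2) <= v ^+ 2 * (1 + C0).
Proof.
have -> : (fun w => (h w - Ex h) ^+ 2) =
    (fun w => v ^+ 2 * ((v^-1 * (h w - Ex h)) ^+ 2)).
  by apply/funext => w; rewrite exprMn mulrA -exprMn divff ?expr1n ?mul1r// gt_eqF.
have b2 : bdd (fun w => (v^-1 * (h w - Ex h)) ^+ 2) by apply: bddX; exact: bddZ.
rewrite ExZ// ler_pM2l ?exprn_gt0//; apply: Ex_exp_tail => //.
- by move=> w; exact: sqr_ge0.
- exact: ltW.
move=> t t0; have [_ tl] := hh.
have st : 0 < Num.sqrt t by rewrite sqrtr_gt0.
have := tl _ (mulr_gt0 v0 st).
have -> : (v * Num.sqrt t / v) ^+ 2 = t.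
  by rewrite mulrAC divff ?gt_eqF// mul1r sqr_sqrtr// ltW.
apply: le_trans; rewrite le_eqVlt; apply/orP; left; apply/eqP; congr Pr.
apply/seteqP; split => w /= hw.
  rewrite -ler_pdivlMl//; apply: le_of_sqr; first by rewrite mulr_ge0 ?invr_ge0// ltW.
  by rewrite sqr_sqrtr ?(ltW t0)// exprMn real_normK ?num_real// -exprMn.
rewrite -ler_pdivlMl// in hw.
have : Num.sqrt t ^+ 2 <= (v^-1 * `|h w - Ex h|) ^+ 2.
  by rewrite ler_sqr ?nnegrE ?sqrtr_ge0// mulr_ge0 ?invr_ge0// ltW.
by rewrite sqr_sqrtr ?(ltW t0)// !exprMn real_normK ?num_real.
Qed.

Lemma Ex_sqr : Ex (fun w => h w ^+ 2) = Ex (fun w => (h w - Ex h) ^+ 2) + Ex h ^+ 2.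
Proof.
have h2 : bdd (fun w => h w ^+ 2) by exact: bddX.
have -> : (fun w => (h w - Ex h) ^+ 2) =
    (fun w => (h w ^+ 2 + (- (2 * Ex h)) * h w) + cst (Ex h ^+ 2) w).
  apply/funext => w /=; ring.
rewrite ExD ?Ex_cst; [|by apply: bddD => //; exact: bddZ|exact: bdd_cst].
rewrite ExD//; last exact: bddZ.
rewrite ExZ//; ring.
Qed.

(** If the mean were larger, the event h <= K would be a deviation of more than v x with x = 1 + 2
    C0; since exp(x^2) >= 1 + x^2 > 2 C0, its probability would be below 1/2. *)
Lemma subg_median K : Pr [set w | K < h w] <= 2^-1 -> Ex h <= K + v * (1 + 2 * C0).
Proof.
move=> hK; have s0 : 0 < v * (1 + 2 * C0) by rewrite mulr_gt0// addr_gt0// mulr_gt0.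
rewrite leNgt; apply/negP => hlt.
have mK : measurable [set w | K < h w] by apply: measurable_ltr_set; case: bh.
have [_ /(_ _ s0) tl] := hh.
have small : C0 * expR (- (v * (1 + 2 * C0) / v) ^+ 2) < 2^-1.
  rewrite mulrAC divff ?gt_eqF// mul1r expRN ltr_pdivrMr ?expR_gt0//.
  apply: lt_le_trans (_ : 2^-1 * (1 + (1 + 2 * C0) ^+ 2) <= _).
    have -> : (1 + 2 * C0) ^+ 2 = 1 + 4 * C0 + 4 * C0 ^+ 2 by ring.
    rewrite mulrC ltr_pdivlMr//; have := sqr_ge0 C0; have := C00; lra.
  by rewrite ler_pM2l ?invr_gt0// expR_ge1Dx.
have le1 : 1 <= Pr [set w | K < h w] + Pr [set w | v * (1 + 2 * C0) <= `|h w - Ex h|].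
  apply: le_trans (PrU _ mK (mdev _)).
  have PT : Pr setT = 1 by rewrite /Pr probability_setT.
  rewrite -[leLHS]PT.
  apply: Pr_le => //; first exact: measurableU.
  move=> w _; have [hw|hw] := ltP K (h w); [by left|right => /=].
  rewrite distrC; apply: (le_trans _ (ler_norm _)). lra.
lra.
Qed.

Lemma subg_tail K t : Ex h <= K -> 0 < t ->
  Pr [set w | K + t <= h w] <= C0 * expR (- (t / v) ^+ 2).
Proof.
move=> hK t0; have [_ /(_ _ t0)] := hh; apply: le_trans; apply: Pr_le => //.
  by apply: measurable_le_set; case: bh.
by move=> w /= hw; apply: (le_trans _ (ler_norm _)); lra.
Qed.

End one_variable.

Section matrix_pair.
Variables (p n : nat) (X : T -> 'M[R]_(p, n)) (D : T -> 'M[R]_n) (C0 c0 : R).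
Hypotheses (C00 : 0 < C0) (c00 : 0 < c0) (D_diag : forall w, is_diag_mx (D w)).
Hypothesis conc : forall f : 'M[R]_(p, n) -> 'M[R]_n -> R, lipschitz1_mx_diag f ->
  let g := fun w => f (X w) (D w) in
  P.-integrable setT (EFin \o g) /\
  forall t : R, 0 < t ->
    (P [set w | (t <= `|g w - fine 'E_P[g]|)%R] <= (C0 * expR (- (t / c0) ^+ 2))%:E)%E.

Lemma sqrt_minkowski (a b c e : R) : 0 <= a -> 0 <= b -> 0 <= c -> 0 <= e ->
  Num.sqrt ((a + b) ^+ 2 + (c + e) ^+ 2) <=
  Num.sqrt (a ^+ 2 + c ^+ 2) + Num.sqrt (b ^+ 2 + e ^+ 2).
Proof.
move=> a0 b0 c0' e0; have s0 := @sqrtr_ge0 R.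
apply: le_of_sqr; first by rewrite addr_ge0.
have pp (x y : R) : 0 <= x ^+ 2 + y ^+ 2 by rewrite addr_ge0 ?sqr_ge0.
rewrite [leLHS]sqr_sqrtr// [leRHS]sqrrD !sqr_sqrtr//.
have : a * b + c * e <= Num.sqrt (a ^+ 2 + c ^+ 2) * Num.sqrt (b ^+ 2 + e ^+ 2).
  apply: le_of_sqr; first by rewrite mulr_ge0.
  rewrite exprMn !sqr_sqrtr// -subr_ge0.
  have -> : (a ^+ 2 + c ^+ 2) * (b ^+ 2 + e ^+ 2) - (a * b + c * e) ^+ 2 =
    (a * e - b * c) ^+ 2 by ring.
  exact: sqr_ge0.
rewrite !sqrrD; lra.
Qed.

(** The McShane extension divided by [L] is an admissible test function of the concentration
    hypothesis, which gives the tail at scale c0 L. *)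
Lemma conc_ext (A : 'M[R]_(p, n) -> 'M[R]_n -> Prop)
    (g : 'M[R]_(p, n) -> 'M[R]_n -> R) (L b : R) :
  0 < L -> 0 <= b ->
  (forall X1 D1 X2 D2, A X1 D1 -> A X2 D2 ->
     `|g X1 D1 - g X2 D2| <= L * dist2 X1 X2 D1 D2) ->
  (forall X1 D1, A X1 D1 -> `|g X1 D1| <= b) ->
  exists h : T -> R, [/\ subg C0 (c0 * L) h, forall w, `|h w| <= b &
    forall w, A (X w) (D w) -> h w = g (X w) (D w)].
Proof.
move=> L0 b0 gL gb.
pose U := ('M[R]_(p, n) * 'M[R]_n)%type.
have [||||||||H [Hg HL Hb]] := @mcshane R U (fun x y => dist2 x.1 y.1 x.2 y.2)
  [set x | A x.1 x.2] (fun x => g x.1 x.2) L b.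
- by move=> x y; exact: sqrtr_ge0.
- by move=> x; rewrite /dist2 !subrr !fn0 expr0n/= addr0 sqrtr0.
- by move=> x y; rewrite /dist2 (fn_subC x.1) (fn_subC x.2).
- move=> x y z; apply: le_trans (sqrt_minkowski _ _ _ _); rewrite ?fn_ge0//.
  rewrite ler_wsqrtr// lerD// ler_sqr ?nnegrE ?addr_ge0 ?fn_ge0//.
    by apply: le_trans (fnD _ _); rewrite addrA subrK.
  by apply: le_trans (fnD _ _); rewrite addrA subrK.
- exact: ltW.
- exact: b0.
- by move=> x y; exact: gL.
- by move=> x; exact: gb.
pose f X1 D1 := L^-1 * H (X1, D1).
have fl : lipschitz1_mx_diag f.
  move=> X1 X2 D1 D2 _ _; rewrite /f -mulrBr normrM gtr0_norm ?invr_gt0//.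
  by rewrite ler_pdivrMl//; exact: HL.
have [fint ftail] := conc fl.
pose h w := H (X w, D w).
(* Measurability of the extension is part of the integrability that the concentration hypothesis
   grants to Lipschitz functions. *)
have mh : measurable_fun setT h.
  have /integrableP[/measurable_EFinP mf _] := fint.
  have -> : h = (fun w => L * f (X w) (D w)).
    by apply/funext => w; rewrite /f mulVKf// gt_eqF.
  by apply: measurable_funM.
have bh : bdd h by split => //; exists b; apply: filterE => w; exact: Hb.
exists h; split; last 2 first.
- by move=> w; exact: Hb.
- by move=> w; exact: Hg (X w, D w).
split => // t t0.
have Ef : fine 'E_P[fun w => f (X w) (D w)] = L^-1 * Ex h.
  by rewrite -ExZ// unlock.
have mdev : measurable [set w | t <= `|h w - Ex h|].
  by apply: measurable_le_set; apply: measurableT_comp => //; apply: measurable_funB.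
have := ftail (t / L) (divr_gt0 t0 L0); rewrite Ef.
have -> : [set w | t / L <= `|f (X w) (D w) - L^-1 * Ex h|] = [set w | t <= `|h w - Ex h|].
  apply/seteqP; split => w /=; rewrite /f -mulrBr normrM gtr0_norm ?invr_gt0//;
  by rewrite (mulrC t) ler_pM2l// invr_gt0.
by rewrite PrE// lee_fin -mulrA -invfM (mulrC L).
Qed.

End matrix_pair.
End concentration_tools.

(** * Columns of the random matrix *)

Section independence.
Context {d : measure_display} {T : measurableType d} {R : realType}
  (P : probability T R).
Local Notation Ex := (Ex P).
Local Notation bdd := (bdd P).

Definition indep_rv (U V : T -> R) := forall A B : set R, measurable A -> measurable B ->
  (P (U @^-1` A `&` V @^-1` B) = P (U @^-1` A) * P (V @^-1` B))%E.

Lemma indep_rv_comp (U V : T -> R) (f g : R -> R) :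
  measurable_fun setT f -> measurable_fun setT g ->
  indep_rv U V -> indep_rv (f \o U) (g \o V).
Proof.
move=> mf mg h A B mA mB.
have mA' : measurable (f @^-1` A) by have := mf measurableT _ mA; rewrite setTI.
have mB' : measurable (g @^-1` B) by have := mg measurableT _ mB; rewrite setTI.
exact: h _ _ mA' mB'.
Qed.

(** Independence identifies the law of the pair with the product of the laws; Tonelli's theorem does
    the rest, for which the integrand is written with absolute values to be nonnegative on the whole
    plane. *)
Lemma Ex_indep_ge0 (U V : T -> R) : bdd U -> bdd V -> indep_rv U V ->
  (forall w, 0 <= U w) -> (forall w, 0 <= V w) ->
  Ex (fun w => U w * V w) = Ex U * Ex V.
Proof.
move=> hU hV ind U0 V0; have [mU _] := hU; have [mV _] := hV.
have mW : measurable_fun setT (fun w => (U w, V w)) by exact: measurable_fun_pair.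
pose U' : {mfun T >-> R} := mfun_Sub (mem_set mU).
pose V' : {mfun T >-> R} := mfun_Sub (mem_set mV).
pose W' : {mfun T >-> (R * R)%type} := mfun_Sub (mem_set mW).
pose f (z : R * R) : \bar R := (`|z.1| * `|z.2|)%:E.
have mf : measurable_fun setT f.
  apply/measurable_EFinP; apply: measurable_funM.
    by apply: measurableT_comp => //; exact: measurable_fst.
  by apply: measurableT_comp => //; exact: measurable_snd.
have f0 z : (0 <= f z)%E by rewrite lee_fin mulr_ge0.
have mn : measurable_fun [set: R] (fun x : R => `|x|%:E).
  by apply/measurable_EFinP; exact: normr_measurable.
have E1 : (\int[P]_w (U w * V w)%:E = \int[distribution P W']_z f z)%E.
  rewrite (ge0_integral_distribution W' mf f0); apply: eq_integral => w _ /=.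
  by rewrite /f /= !ger0_norm.
have EU : (\int[P]_w (U w)%:E = \int[distribution P U']_x (`|x|%:E))%E.
  rewrite (ge0_integral_distribution U')//.
  by apply: eq_integral => w _ /=; rewrite ger0_norm.
have EV : (\int[P]_w (V w)%:E = \int[distribution P V']_x (`|x|%:E))%E.
  rewrite (ge0_integral_distribution V')//.
  by apply: eq_integral => w _ /=; rewrite ger0_norm.
have E2 : (\int[distribution P W']_z f z =
    \int[distribution P U' \x distribution P V']_z f z)%E.
  apply: eq_measure_integral => A mA _; apply/esym.
  by apply: product_measure_unique.
suff -> : Ex (fun w => U w * V w) = fine ((\int[P]_w (U w)%:E) * (\int[P]_w (V w)%:E))%E.
  rewrite fineM//; apply: integrable_fin_num => //; exact: bdd_integrable.
rewrite /Ex E1 E2 fubini_tonelli1//; congr fine.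
have -> : (\int[distribution P U']_x fubini_F (distribution P V') f x =
    \int[distribution P U']_x (`|x|%:E * \int[P]_w (V w)%:E))%E.
  apply: eq_integral => x _; rewrite /fubini_F /f /= EV -ge0_integralZl//.
rewrite ge0_integralZr//; first by rewrite EU.
by apply: integral_ge0 => w _; rewrite lee_fin.
Qed.

Lemma bdd_comp (U : T -> R) (f : R -> R) : bdd U -> measurable_fun setT f ->
  (forall M, exists N, forall x, `|x| <= M -> `|f x| <= N) -> bdd (f \o U).
Proof.
move=> [mU [M hM]] mf hf; split; first exact: measurableT_comp.
by have [N hN] := hf M; exists N; apply: filterS hM => w /hN.
Qed.

(** Adding the almost sure bounds M and N reduces to the nonnegative case; the maximum with 0
    changes the shifted variables on a null set only. *)
Lemma Ex_indep (U V : T -> R) : bdd U -> bdd V -> indep_rv U V ->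
  Ex (fun w => U w * V w) = Ex U * Ex V.
Proof.
move=> hU hV ind; have [_ [M hM]] := hU; have [_ [N hN]] := hV.
pose f (c x : R) := Num.max (x + c) 0.
have mf c : measurable_fun setT (f c).
  by apply: measurable_maxr => //; apply: measurable_funD.
have bf c (W : T -> R) : bdd W -> bdd (f c \o W).
  move=> hW; apply: bdd_comp => // K; exists (`|K| + `|c|) => x hx.
  rewrite /f ger0_norm ?le_max ?lexx ?orbT//.
  rewrite ge_max addr_ge0// andbT lerD ?ler_norm//.
  by apply: le_trans (ler_norm _) (le_trans hx (ler_norm _)).
have eq_f c (W : T -> R) K : {ae P, forall w, `|W w| <= K} -> K <= c ->
    {ae P, forall w, (f c \o W) w = W w + c}.
  move=> hW Kc; apply: filterS hW => w; rewrite ler_norml => /andP[h _].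
  by rewrite /f /= max_l//; lra.
have hU' := eq_f M U M hM (lexx _); have hV' := eq_f N V N hN (lexx _).
have f0 c x : 0 <= f c x by rewrite le_max lexx orbT.
have E := Ex_indep_ge0 (bf M U hU) (bf N V hV)
  (indep_rv_comp (mf M) (mf N) ind) (fun w => f0 M _) (fun w => f0 N _).
have EU : Ex (f M \o U) = Ex U + M.
  rewrite (@Ex_ae _ _ _ P _ (fun w => U w + cst M w))//; last by apply: bddD => //; exact: bdd_cst.
    by rewrite ExD ?Ex_cst//; exact: bdd_cst.
  exact: bf.
have EV : Ex (f N \o V) = Ex V + N.
  rewrite (@Ex_ae _ _ _ P _ (fun w => V w + cst N w))//; last by apply: bddD => //; exact: bdd_cst.
    by rewrite ExD ?Ex_cst//; exact: bdd_cst.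
  exact: bf.
have bUV : bdd (fun w => U w * V w) by exact: bddM.
have EW : Ex (fun w => (f M \o U) w * (f N \o V) w) =
    Ex (fun w => ((U w * V w + N * U w) + M * V w) + cst (M * N) w).
  apply: Ex_ae.
  - by apply: bddM; exact: bf.
  - by do 2 (apply: bddD; last by [exact: bdd_cst|exact: bddZ]); apply: bddD => //; exact: bddZ.
  by move: hU' hV'; apply: filterS2 => w -> -> /=; ring.
have b1 : bdd (fun w => U w * V w + N * U w) by apply: bddD => //; exact: bddZ.
have b2 : bdd (fun w => (U w * V w + N * U w) + M * V w) by apply: bddD => //; exact: bddZ.
move: E; rewrite EW EU EV.
rewrite ExD ?Ex_cst//; last exact: bdd_cst.
rewrite ExD//; last exact: bddZ.
rewrite ExD//; last exact: bddZ.
rewrite !ExZ// => E; have : Ex (fun w => U w * V w) = Ex U * Ex V by move: E; lra.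
by [].
Qed.

End independence.

Section borel_functions.
Context {R : realType} (m n : nat).

Definition entry_sets : set (set 'M[R]_(m, n)) :=
  [set A | exists (i : 'I_m) (j : 'I_n) (B : set R),
         measurable B /\ A = [set M : 'M[R]_(m, n) | B (M i j)]].

Let U := g_sigma_algebraType entry_sets.

Lemma entry_measurable i j :
  measurable_fun [set: U] (fun x : U => (x : 'M[R]_(m, n)) i j).
Proof.
move=> _ B mB; rewrite setTI; apply: sub_sigma_algebra.
by exists i, j, B.
Qed.

Lemma borel_mdot (v : 'M[R]_(m, n)) (B : set R) : measurable B ->
  borel_mx [set x : 'M[R]_(m, n) | B (mdot v x)].
Proof.
move=> mB; have H : measurable_fun [set: U] (fun x : U => mdot v x).
  apply: measurable_sum => i; apply: measurable_sum => j.
  by apply: measurable_funM => //; exact: entry_measurable.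
by have := H measurableT _ mB; rewrite setTI.
Qed.

Lemma borel_entry2 i j k l (B : set R) : measurable B ->
  borel_mx [set x : 'M[R]_(m, n) | B (x i j * x k l)].
Proof.
move=> mB; have H : measurable_fun [set: U] (fun x : U => (x : 'M[R]_(m, n)) i j * (x : 'M[R]_(m, n)) k l).
  by apply: measurable_funM => //; exact: entry_measurable.
by have := H measurableT _ mB; rewrite setTI.
Qed.

Lemma borel_setT : borel_mx [set: 'M[R]_(m, n)].
Proof. exact: (@measurableT _ U). Qed.

End borel_functions.

(** * Second moments of the columns *)

Section columns.
Context {d : measure_display} {T : measurableType d} {R : realType}
  (P : probability T R).
Local Notation fn := (@frobenius_norm R _ _).
Local Notation Ex := (Ex P).
Local Notation Pr := (Pr P).
Local Notation bdd := (bdd P).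
Local Notation subg := (subg P).
Variables (p n : nat) (X : T -> 'M[R]_(p, n)) (D : T -> 'M[R]_n) (C0 c0 kX K1 : R).
Local Notation sn := (Num.sqrt (n%:R : R)).
Hypotheses (C00 : 0 < C0) (c00 : 0 < c0) (kX0 : 0 < kX) (K10 : 0 <= K1) (n0 : (0 < n)%N).
Hypothesis conc : forall f : 'M[R]_(p, n) -> 'M[R]_n -> R, lipschitz1_mx_diag f ->
  let g := fun w => f (X w) (D w) in
  P.-integrable setT (EFin \o g) /\
  forall t : R, 0 < t ->
    (P [set w | (t <= `|g w - fine 'E_P[g]|)%R] <= (C0 * expR (- (t / c0) ^+ 2))%:E)%E.
Hypothesis X_random : random_mx X.
Hypothesis X_op : {ae P, forall w, opb (X w) (sn * kX)}.
Hypothesis X_indep : mutually_independent_mx P (fun (i : 'I_n) w => col i (X w)).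
Hypothesis X_mean : forall i, fn (expectation_mx P (fun w => col i (X w))) <= K1.

Local Notation x j := (fun w => col j (X w)).

Lemma conc_X (g : 'M[R]_(p, n) -> R) L b : 0 < L -> 0 <= b ->
  (forall X1 X2, opb X1 (sn * kX) -> opb X2 (sn * kX) -> `|g X1 - g X2| <= L * fn (X1 - X2)) ->
  (forall X1, opb X1 (sn * kX) -> `|g X1| <= b) ->
  exists h : T -> R, [/\ subg C0 (c0 * L) h, forall w, `|h w| <= b &
    {ae P, forall w, h w = g (X w)}].
Proof.
move=> L0 b0 gL gb.
have [||h [h1 h2 h3]] := conc_ext conc (A := fun X1 _ => opb X1 (sn * kX)) (g := fun X1 _ => g X1) L0 b0.
- move=> X1 D1 X2 D2 a1 a2; apply: le_trans (gL _ _ a1 a2) _.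
  by rewrite ler_pM2l//; exact: dist2_l.
- by move=> X1 D1; exact: gb.
exists h; split => //; apply: filterS X_op => w; exact: h3.
Qed.

Lemma subg_ae v (g h : T -> R) : subg C0 v h -> bdd g -> {ae P, forall w, h w = g w} -> subg C0 v g.
Proof.
move=> [bh th] bg hg; split => // t t0; have E := Ex_ae bh bg hg.
have mg : measurable [set w | t <= `|g w - Ex g|].
  apply: measurable_le_set; apply: measurableT_comp => //.
  by apply: measurable_funB => //; case: bg.
apply: le_trans (th t t0); apply: Pr_ae_le => //.
  apply: measurable_le_set; apply: measurableT_comp => //.
  by apply: measurable_funB => //; case: bh.
by apply: filterS hg => w /= ->; rewrite E.
Qed.

Lemma bdd_entry i j : bdd (fun w => X w i j).
Proof.
split; first exact: X_random.
exists (sn * kX); apply: filterS X_op => w; exact: opb_entry.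
Qed.

Lemma bdd_col_entry j i k : bdd (fun w => (x j w) i k).
Proof. by under [X in bdd X]eq_fun do rewrite mxE; exact: bdd_entry. Qed.

Lemma bdd_lin (v : 'cV[R]_p) j : bdd (fun w => mdot v (x j w)).
Proof.
apply: bdd_sum => i; apply: bdd_sum => k; apply: bddZ; exact: bdd_col_entry.
Qed.

Lemma subg_lin (v : 'cV[R]_p) j L : 0 < L -> fn v <= L ->
  subg C0 (c0 * L) (fun w => mdot v (x j w)).
Proof.
move=> L0 vL.
have snk : 0 <= sn * kX by rewrite mulr_ge0 ?sqrtr_ge0 ?ltW.
have [||h [h1 _ h3]] := @conc_X (fun X1 => mdot v (col j X1)) L (L * (sn * kX)) L0 (mulr_ge0 (ltW L0) snk).
- move=> X1 X2 _ _; rewrite -mdotNr -mdotDr; apply: le_trans (mdot_le _ _) _.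
  apply: ler_pM; rewrite ?fn_ge0//; apply: le_trans (fn_col_le _ j).
  by rewrite linearB.
- move=> X1 o1; apply: le_trans (mdot_le _ _) _; apply: ler_pM; rewrite ?fn_ge0//.
  exact: opb_col.
exact: subg_ae h1 (bdd_lin v j) h3.
Qed.

Lemma Ex_lin (v : 'cV[R]_p) j : `|Ex (fun w => mdot v (x j w))| <= fn v * K1.
Proof.
have -> : Ex (fun w => mdot v (x j w)) = mdot v (expectation_mx P (x j)).
  rewrite /mdot Ex_sum; last first.
    by move=> i; apply: bdd_sum => k; apply: bddZ; exact: bdd_col_entry.
  apply: eq_bigr => i _; rewrite Ex_sum; last first.
    by move=> k; apply: bddZ; exact: bdd_col_entry.
  apply: eq_bigr => k _; rewrite ExZ; last exact: bdd_col_entry.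
  by rewrite !mxE unlock.
by apply: le_trans (mdot_le _ _) _; rewrite ler_wpM2l ?fn_ge0.
Qed.

(** The variance bound of [subg_var] at scale [c0] plus the square of the bound on the mean. *)
Definition second_moment_const := c0 ^+ 2 * (1 + C0) + K1 ^+ 2.

Lemma Ex_lin_sqr (v : 'cV[R]_p) j :
  Ex (fun w => mdot v (x j w) ^+ 2) <= fn v ^+ 2 * second_moment_const.
Proof.
have [v0|vn] := eqVneq (fn v) 0.
  have -> : (fun w => mdot v (x j w) ^+ 2) = cst 0.
    by apply/funext => w; rewrite (fn_eq0 v0) mdotC mdot0r expr0n.
  by rewrite Ex_cst v0 expr0n mul0r.
have vp : 0 < fn v by rewrite lt_neqAle eq_sym vn fn_ge0.
have hs := subg_lin j vp (lexx _).
have cv : 0 < c0 * fn v by exact: mulr_gt0.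
have v1 := subg_var C00 cv hs; rewrite (Ex_sqr hs).
have e1 : Ex (fun w => mdot v (x j w)) ^+ 2 <= fn v ^+ 2 * K1 ^+ 2.
  rewrite -exprMn -[leLHS]real_normK ?num_real// ler_sqr ?nnegrE ?mulr_ge0 ?fn_ge0//.
  exact: Ex_lin.
rewrite /second_moment_const mulrDr; apply: lerD => //; apply: le_trans v1 _.
by rewrite exprMn [X in X * _]mulrC mulrA.
Qed.

Definition smom j : 'M[R]_p := \matrix_(a, b) Ex (fun w => X w a j * X w b j).

Lemma smom_tr j : (smom j)^T = smom j.
Proof. by apply/matrixP => a b; rewrite !mxE; under eq_fun do rewrite mulrC. Qed.

Lemma smom_quad j (v : 'cV[R]_p) : mdot v (smom j *m v) = Ex (fun w => mdot v (x j w) ^+ 2).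
Proof.
have -> : (fun w => mdot v (x j w) ^+ 2) =
    (fun w => \sum_a \sum_b v a 0 * v b 0 * (X w a j * X w b j)).
  apply/funext => w; rewrite /mdot; under eq_bigr do rewrite big_ord1 mxE.
  rewrite expr2 big_distrlr /=; apply: eq_bigr => a _; apply: eq_bigr => b _; ring.
have b2 a b : bdd (fun w => X w a j * X w b j) by apply: bddM; exact: bdd_entry.
rewrite Ex_sum; last by move=> a; apply: bdd_sum => b; exact: bddZ.
apply: eq_bigr => a _; rewrite Ex_sum; last by move=> b; exact: bddZ.
rewrite big_ord1 mxE mulr_sumr; apply: eq_bigr => b _.
by rewrite ExZ// mxE; ring.
Qed.

Lemma smom_psd j (v : 'cV[R]_p) : 0 <= mdot v (smom j *m v).
Proof. by rewrite smom_quad; apply: Ex_ge0 => w; exact: sqr_ge0. Qed.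

Lemma col_indep_rv (a b a' b' : 'I_p) (j k : 'I_n) : j != k ->
  indep_rv P (fun w => X w a j * X w b j) (fun w => X w a' k * X w b' k).
Proof.
move=> jk A B mA mB.
pose F (i : 'I_n) : set 'cV[R]_p := if i == j then [set y | A (y a 0 * y b 0)]
  else if i == k then [set y | B (y a' 0 * y b' 0)] else setT.
have FB i : borel_mx (F i).
  rewrite /F; case: ifP => _; first exact: borel_entry2.
  by case: ifP => _; [exact: borel_entry2|exact: borel_setT].
have := @X_indep [set j; k]%SET F FB.
rewrite big_setU1 ?inE//= big_set1.
have -> : \bigcap_(i in [set` [set j; k]%SET]) ((fun w => col i (X w)) @^-1` F i) =
    (fun w => X w a j * X w b j) @^-1` A `&` (fun w => X w a' k * X w b' k) @^-1` B.
  apply/seteqP; split => w /=.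
    move=> h; split.
      by have := h j; rewrite /F /= !inE !eqxx /= !mxE; apply.
    by have := h k; rewrite /F /= !inE !eqxx orbT eq_sym (negPf jk) /= !mxE; apply.
  move=> [hA hB] i; rewrite /F /= !inE => /orP[]/eqP ->.
    by rewrite eqxx /= !mxE.
  by rewrite eq_sym (negPf jk) eqxx /= !mxE.
move=> ->; congr (P _ * P _)%E; apply/seteqP; split => w; rewrite /F /=.
- by rewrite eqxx /= !mxE.
- by rewrite eqxx /= !mxE.
- by rewrite eq_sym (negPf jk) eqxx /= !mxE.
- by rewrite eq_sym (negPf jk) eqxx /= !mxE.
Qed.

Lemma Ex_cross j k : j != k ->
  Ex (fun w => mdot (x j w) (x k w) ^+ 2) = mdot (smom j) (smom k).
Proof.
move=> jk; have -> : (fun w => mdot (x j w) (x k w) ^+ 2) =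
    (fun w => \sum_a \sum_b (X w a j * X w b j) * (X w a k * X w b k)).
  apply/funext => w; rewrite /mdot; under eq_bigr do rewrite big_ord1 !mxE.
  rewrite expr2 big_distrlr /=; apply: eq_bigr => a _; apply: eq_bigr => b _; ring.
have b2 i a b : bdd (fun w => X w a i * X w b i) by apply: bddM; exact: bdd_entry.
rewrite Ex_sum; last by move=> a; apply: bdd_sum => b; exact: bddM.
apply: eq_bigr => a _; rewrite Ex_sum; last by move=> b; exact: bddM.
apply: eq_bigr => b _; rewrite Ex_indep//; last exact: col_indep_rv.
by rewrite !mxE.
Qed.

(** Diagonalising one matrix turns the trace into a nonnegative combination of values of the
    quadratic form of the other. *)
Lemma smom_dot_ge0 j k : 0 <= mdot (smom j) (smom k).
Proof.
have [r [lam [e [_ _ l0 _ HE]]]] := psd_spectral (smom_tr k) (smom_psd k).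
rewrite HE mdot_sumr; apply: sumr_ge0 => l _; rewrite mdotZr mulr_ge0//.
  by apply: ltW; exact: l0.
by rewrite /outer mdot_rank1 mdotC smom_psd.
Qed.

End columns.

(** * Dual Sudakov minoration *)

Section sudakov.
Context {d : measure_display} {T : measurableType d} {R : realType}
  (P : probability T R).
Local Notation fn := (@frobenius_norm R _ _).
Local Notation Ex := (Ex P).
Local Notation Pr := (Pr P).
Local Notation bdd := (bdd P).
Local Notation subg := (subg P).
Variables (p n : nat) (X : T -> 'M[R]_(p, n)) (D : T -> 'M[R]_n) (C0 c0 kX K1 : R).
Local Notation sn := (Num.sqrt (n%:R : R)).
Hypotheses (C00 : 0 < C0) (c00 : 0 < c0) (kX0 : 0 < kX) (K10 : 0 <= K1) (n0 : (0 < n)%N).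
Hypothesis conc : forall f : 'M[R]_(p, n) -> 'M[R]_n -> R, lipschitz1_mx_diag f ->
  let g := fun w => f (X w) (D w) in
  P.-integrable setT (EFin \o g) /\
  forall t : R, 0 < t ->
    (P [set w | (t <= `|g w - fine 'E_P[g]|)%R] <= (C0 * expR (- (t / c0) ^+ 2))%:E)%E.
Hypothesis X_random : random_mx X.
Hypothesis X_op : {ae P, forall w, opb (X w) (sn * kX)}.
Hypothesis X_indep : mutually_independent_mx P (fun (i : 'I_n) w => col i (X w)).
Hypothesis X_mean : forall i, fn (expectation_mx P (fun w => col i (X w))) <= K1.

Local Notation x j := (fun w => col j (X w)).

Let bdd_lin' (v : 'cV[R]_p) j : bdd (fun w => mdot v (x j w)).
Proof. exact: bdd_lin X_random X_op v j. Qed.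

Variables (q : nat) (e : nat -> 'cV[R]_p).
Hypothesis e_ortho :
  forall l k, (l < q)%N -> (k < q)%N -> mdot (e l) (e k) = (l == k)%:R.

(** The projection Pi in the coordinates of the basis [e]; [lift] is the adjoint isometry, which
    turns a linear form of Pi x_j into one of x_j. *)
Definition coords (y : 'cV[R]_p) : 'cV[R]_q := \col_(l < q) mdot (e l) y.
Definition lift (a : 'cV[R]_q) : 'cV[R]_p := \sum_(l < q) a l 0 *: e l.

Lemma fn_lift a : fn (lift a) = fn a.
Proof.
apply/eqP; rewrite -(@eqrXn2 _ 2%N) ?fn_ge0//; apply/eqP.
rewrite (ortho_norm e_ortho (fun l => a l 0)) fn_sqrE.
by apply: eq_bigr => l _; rewrite big_ord1.
Qed.

Lemma mdot_lift a y : mdot a (coords y) = mdot (lift a) y.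
Proof.
rewrite /lift mdot_suml; apply: eq_bigr => l _.
by rewrite big_ord1 mxE mdotZl.
Qed.

Lemma fn_coords y : fn (coords y) <= fn y.
Proof.
apply: le_of_sqr; first exact: fn_ge0.
apply: le_trans (bessel e_ortho y); rewrite fn_sqrE.
by apply: ler_sum => l _; rewrite big_ord1 mxE.
Qed.

Lemma coordsB y z : coords (y - z) = coords y - coords z.
Proof. by apply/matrixP => l k; rewrite !mxE mdotDr mdotNr. Qed.

Local Notation xi j := (fun w => coords (x j w)).

Definition tau j := \sum_(l < q) Ex (fun w => mdot (e l) (x j w) ^+ 2).

(** In [xi_inner] a deviation tau / 16 meets the scale c0 sqrt(2 tau), and (tau / 16)^2 / (2 c0^2
    tau) = cc tau. *)
Definition cc := (512 * c0 ^+ 2)^-1.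
(** The threshold above which the minoration works. The first term makes the variance of |Pi x_j| at
    most tau / 8, the second bounds the contribution of the mean to inner products by tau / 16, the
    third forces exp(cc tau / 2) > 8 C0, and the 1 makes positivity immediate. *)
Definition tau0 := 8 * (c0 ^+ 2 * (1 + C0)) + 512 * K1 ^+ 2 + 16 * C0 / cc + 1.

Let cc0 : 0 < cc. Proof. by rewrite invr_gt0 mulr_gt0 ?ltr0n ?exprn_gt0. Qed.
Let C0' : 0 <= C0. Proof. exact: ltW. Qed.

Lemma tau0_gt0 : 0 < tau0.
Proof.
have h1 : 0 <= c0 ^+ 2 * (1 + C0) by rewrite mulr_ge0 ?sqr_ge0// addr_ge0.
have h2 : 0 <= 16 * C0 / cc by rewrite divr_ge0 ?mulr_ge0//; exact: ltW.
rewrite /tau0; have := sqr_ge0 K1; lra.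
Qed.

Section one_column.
Variable j : 'I_n.
Local Notation tj := (tau j).
Hypothesis big : tau0 <= tau j.

Let t0 : 0 < tj. Proof. exact: lt_le_trans tau0_gt0 big. Qed.
Let c1 : 8 * (c0 ^+ 2 * (1 + C0)) <= tj.
Proof.
apply: le_trans big; rewrite /tau0.
have h2 : 0 <= 16 * C0 / cc by rewrite divr_ge0 ?mulr_ge0//; exact: ltW.
have := sqr_ge0 K1; lra.
Qed.
Let c2 : 512 * K1 ^+ 2 <= tj.
Proof.
apply: le_trans big; rewrite /tau0.
have h1 : 0 <= c0 ^+ 2 * (1 + C0) by rewrite mulr_ge0 ?sqr_ge0// addr_ge0.
have h2 : 0 <= 16 * C0 / cc by rewrite divr_ge0 ?mulr_ge0//; exact: ltW.
lra.
Qed.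
Let c3 : 8 * C0 <= cc * tj / 2.
Proof.
rewrite ler_pdivlMr// mulrC mulrA.
have h : 16 * C0 / cc <= tj.
  apply: le_trans big; rewrite /tau0.
  have h1 : 0 <= c0 ^+ 2 * (1 + C0) by rewrite mulr_ge0 ?sqr_ge0// addr_ge0.
  have := sqr_ge0 K1; lra.
rewrite ler_pdivrMr// in h; lra.
Qed.

(** |Pi x_j| is 1-Lipschitz in X with mean square tau. As its variance is at most tau / 8, its mean
    lies between 7/8 sqrt(tau) and sqrt(tau); a deviation sqrt(tau) / 8 has the exponent 8 cc
    tau. *)
Lemma xi_norm : exists B : set T, [/\ measurable B, Pr B <= C0 * expR (- (cc * tj)) &
  {ae P, forall w, ~ B w -> tj / 2 <= fn (xi j w) ^+ 2 <= 2 * tj}].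
Proof.
have [|||h [hs _ hx]] := conc_X conc X_op (g := fun X1 => fn (coords (col j X1))) (L := 1) (b := sn * kX) ltr01.
- by rewrite mulr_ge0 ?sqrtr_ge0// ltW.
- move=> X1 X2 _ _; rewrite mul1r; apply: le_trans (fn_dist _ _) _.
  rewrite -coordsB; apply: le_trans (fn_coords _) _.
  by apply: le_trans (fn_col_le _ j); rewrite linearB.
- move=> X1 o1; rewrite ger0_norm ?fn_ge0//; apply: le_trans (fn_coords _) _.
  exact: opb_col.
rewrite mulr1 in hs; have [bh th] := hs.
have var := subg_var C00 c00 hs; have sq := Ex_sqr hs.
have Eh2 : Ex (fun w => h w ^+ 2) = tj.
  have b2 l : bdd (fun w => mdot (e l) (x j w) ^+ 2) by apply: bddX; exact: bdd_lin'.
  rewrite /tau -Ex_sum//; apply: Ex_ae; [exact: bddX|by apply: bdd_sum => l|].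
  apply: filterS hx => w ->; rewrite fn_sqrE; apply: eq_bigr => l _.
  by rewrite big_ord1 mxE.
have Eh0 : 0 <= Ex h.
  rewrite (@Ex_ae _ _ _ P _ (fun w => `|h w|))//; [|exact: bdd_norm|].
    by apply: Ex_ge0.
  by apply: filterS hx => w ->; rewrite ger0_norm ?fn_ge0.
pose st := Num.sqrt tj.
have st0 : 0 < st by rewrite sqrtr_gt0.
have stst : st ^+ 2 = tj by rewrite sqr_sqrtr// ltW.
have v0 : 0 <= Ex (fun w => (h w - Ex h) ^+ 2) by apply: Ex_ge0 => w; exact: sqr_ge0.
rewrite Eh2 in sq; move: (Ex (fun w => (h w - Ex h) ^+ 2)) v0 var sq => V v0 var sq.
have up : Ex h <= st.
  by apply: le_of_sqr; [exact: ltW|rewrite stst; lra].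
have lo : 7 / 8 * st <= Ex h.
  by apply: le_of_sqr => //; rewrite exprMn stst; have := c1; lra.
have dv : 0 < st / 8 by rewrite divr_gt0.
exists [set w | st / 8 <= `|h w - Ex h|]; split.
- apply: measurable_le_set; apply: measurableT_comp => //.
  by apply: measurable_funB => //; case: bh.
- apply: le_trans (th _ dv) _; rewrite ler_wpM2l// ler_expR lerN2.
  have -> : (st / 8 / c0) ^+ 2 = 8 * (cc * tj).
    by rewrite /cc -stst; field; rewrite gt_eqF.
  by rewrite ler_peMl ?ler1n// mulr_ge0//; exact: ltW.
apply: filterS hx => w /= hw /negP; rewrite -ltNge -hw => hd.
have h1 : 6 / 8 * st <= h w by move: hd; rewrite ltr_norml => /andP[]; lra.
have h2 : h w <= 9 / 8 * st by move: hd; rewrite ltr_norml => /andP[]; lra.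
have hw0 : 0 <= h w by apply: le_trans h1; rewrite mulr_ge0// ltW.
apply/andP; split.
  apply: le_trans (_ : (6 / 8 * st) ^+ 2 <= _).
    by rewrite exprMn stst; have := t0; lra.
  by rewrite ler_sqr ?nnegrE// mulr_ge0// ltW.
apply: le_trans (_ : (9 / 8 * st) ^+ 2 <= _).
  by rewrite ler_sqr ?nnegrE// mulr_ge0// ltW.
by rewrite exprMn stst; have := t0; lra.
Qed.

Lemma xi_inner (v : 'cV[R]_q) : fn v ^+ 2 <= 2 * tj ->
  Pr [set w | tj / 8 <= mdot v (xi j w)] <= C0 * expR (- (cc * tj)).
Proof.
move=> hv; pose L := Num.sqrt (2 * tj).
have tt0 : 0 < 2 * tj by rewrite mulr_gt0.
have L0 : 0 < L by rewrite sqrtr_gt0.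
have LL : L ^+ 2 = 2 * tj by rewrite sqr_sqrtr// ltW.
have vL : fn v <= L by apply: le_of_sqr; [exact: ltW|rewrite LL].
have vL' : fn (lift v) <= L by rewrite fn_lift.
have hs := subg_lin kX0 conc X_random X_op j L0 vL'.
have KL : L * K1 <= tj / 16.
  apply: le_of_sqr; first by rewrite divr_ge0// ltW.
  rewrite exprMn LL expr_div_n ler_pdivlMr ?exprn_gt0//.
  have := ler_wpM2r (ltW t0) c2; rewrite (expr2 tj) => hh.
  have -> : 2 * tj * K1 ^+ 2 * 16 ^+ 2 = 512 * K1 ^+ 2 * tj by ring.
  exact: hh.
have mE : Ex (fun w => mdot (lift v) (x j w)) <= L * K1.
  apply: le_trans (ler_norm _) _; apply: le_trans (Ex_lin X_random X_op X_mean _ _) _.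
  by rewrite fn_lift ler_wpM2r.
have tp : 0 < tj / 8 - L * K1 by have := t0; lra.
have cL : 0 < c0 * L by rewrite mulr_gt0.
have := subg_tail hs mE tp.
have -> : L * K1 + (tj / 8 - L * K1) = tj / 8 by ring.
under [X in Pr X <= _ -> _]eq_set do rewrite -mdot_lift.
move=> h; apply: le_trans h _; rewrite ler_wpM2l// ler_expR lerN2.
have h16 : tj / 16 <= tj / 8 - L * K1 by lra.
rewrite expr_div_n ler_pdivlMr ?exprn_gt0//.
apply: le_trans (_ : (tj / 16) ^+ 2 <= _).
  rewrite exprMn LL /cc le_eqVlt; apply/orP; left; apply/eqP; field.
  by rewrite gt_eqF.
by rewrite ler_sqr ?nnegrE// ?divr_ge0// ltW.
Qed.

(** Values of [xi] at successively chosen sample points play the part of independent copies. A new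
    point avoids the set of atypical norm and one set for each earlier point; the total probability
    of these sets stays below 1. [B] carries an almost sure property along. *)
Lemma xi_points (B : T -> Prop) m : {ae P, forall w, B w} ->
  m%:R * (C0 * expR (- (cc * tj))) < 1 ->
  exists ws : nat -> T,
    (forall i, (i < m)%N -> B (ws i) /\ tj / 2 <= fn (xi j (ws i)) ^+ 2 <= 2 * tj) /\
    (forall i k, (i < k < m)%N -> mdot (xi j (ws i)) (xi j (ws k)) <= tj / 8).
Proof.
move=> hB; have [A [mA PA hA]] := xi_norm.
set E := C0 * expR _ in PA *.
have E0 : 0 <= E by rewrite mulr_ge0 ?expR_ge0.
elim: m => [|m IH] hm.
  by exists (fun=> point); split => [i|i k]; rewrite ?ltn0 ?andbF.
have [|ws [h1 h2]] := IH.
  by apply: le_lt_trans hm; rewrite ler_wpM2r// ler_nat.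
pose F (i : 'I_m) := [set w | tj / 8 <= mdot (xi j (ws i)) (xi j w)].
have mF i : measurable (F i).
  apply: measurable_le_set; under eq_fun do rewrite mdot_lift.
  by case: (bdd_lin' (lift (xi j (ws i))) j).
have mFF : measurable [set w | exists i, F i w].
  rewrite (_ : [set w | _] = \bigcup_i (if insub i is Some o then F o else set0)).
    by apply: bigcupT_measurable => i; case: insub.
  apply/seteqP; split => w.
    by move=> [i Fi]; exists (i : nat) => //; rewrite valK.
  by move=> [i _]; case: insubP => // o _ _ Fo; exists o.
have PF : Pr [set w | exists i, F i w] <= m%:R * E.
  apply: le_trans (Pr_bigU P mF) _.
  apply: le_trans (_ : \sum_(i < m) E <= _).
    by apply: ler_sum => i _; apply: xi_inner; case: (h1 i (ltn_ord i)) => _ /andP[].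
  by rewrite sumr_const card_ord mulr_natl.
pose BAD := A `|` [set w | exists i, F i w].
have mBAD : measurable BAD by exact: measurableU.
have PBAD : 0 < Pr (~` BAD).
  rewrite PrC// subr_gt0; apply: le_lt_trans hm.
  by apply: le_trans (PrU P mA mFF) _; rewrite -natr1 mulrDl mul1r addrC lerD.
have [w [nb [Bw Aw]]] := Pr_ex (measurableC mBAD) PBAD (filterI hB hA).
exists (fun i => if (i < m)%N then ws i else w); split.
  move=> i; rewrite ltnS => im; case: ltnP => // im'; first exact: h1.
  by split => //; apply: Aw => Aw'; apply: nb; left.
move=> i k /andP[ik]; rewrite ltnS => km; have im : (i < m)%N by exact: leq_trans ik km.
rewrite im; case: ltnP => km'; first by apply: h2; rewrite ik.
rewrite leNgt; apply/negP => hlt; apply: nb; right; exists (Ordinal im) => /=.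
exact: ltW hlt.
Qed.

(** The grid: the mesh [dl] is so fine that rounding a vector to it costs at most theta sqrt(tau0) /
    64, the cutoff [Z] contains the rounded vectors theta xi, and at [L] the enlargement by [Z] at
    most doubles the mass. *)
Variables (dl : R) (L Z : nat).
(** Chosen so that the rounded vectors theta xi have norm at most 2 theta sqrt(tau), hence half
    squared norm at most cc tau / 2: a translation costs only exp(-cc tau / 2), while about exp(cc
    tau) points are available. *)
Definition theta := Num.sqrt cc / 2.
Hypotheses (dl0 : 0 < dl) (dlq : dl * Num.sqrt q%:R <= theta * Num.sqrt tau0 / 64)
  (dlZ : theta * Num.sqrt (2 * tj) <= dl * Z%:R)
  (LZ : gtot dl q (L + Z) <= 2 * gtot dl q L).

Let th0 : 0 < theta. Proof. by rewrite divr_gt0// sqrtr_gt0. Qed.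
Let th2 : theta ^+ 2 = cc / 4.
Proof. by rewrite expr_div_n sqr_sqrtr ?ltW//; congr (_ / _); ring. Qed.

Definition narrow : pred 'cV[R]_q := fun v =>
  `[< {ae P, forall w, `|mdot v (xi j w)| <= theta * tj / 8} >].

Lemma round_index (y : R) : `|y| <= Z%:R -> exists u : 'I_(2 * Z).+1, `|u%:R - Z%:R - y| <= 1.
Proof.
rewrite ler_norml => /andP[y1 y2].
have yz : 0 <= y + Z%:R by lra.
have /andP[h1 h2] := truncn_itv yz.
have hu : (Num.truncn (y + Z%:R) < (2 * Z).+1)%N.
  by rewrite ltnS -(@ler_nat R); apply: le_trans h1 _; rewrite natrM; lra.
exists (Ordinal hu) => /=; rewrite -natr1 in h2; rewrite ler_norml; lra.
Qed.

(* Dual Sudakov minoration: for at least half of the directions [v] (in discrete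
   Gaussian measure) the linear form <v, .> essentially exceeds theta tau / 8.
   Otherwise many well separated values of [xi] would yield too many disjoint
   translates of the set of narrow directions. *)
Lemma narrow_half :
  \sum_(a : grid q L | narrow (gpt dl a)) gwt (gpt dl a) <= gtot dl q L / 2.
Proof.
rewrite leNgt; apply/negP => hlt.
set E := expR (cc * tj).
have E0 : 0 < E by exact: expR_gt0.
(* Few enough points for [xi_points], as N C0 < E, yet more than E / (2 C0). *)
pose N := (Num.truncn (E / (2 * C0))).+1.
have EC0 : 0 <= E / (2 * C0) by rewrite divr_ge0 ?mulr_ge0//; exact: ltW.
have /andP[n1 n2] := truncn_itv EC0.
have Ehalf : expR (cc * tj / 2) > 8 * C0.
  by apply: lt_le_trans (expR_ge1Dx _); have := c3; lra.
have E8 : 8 * C0 < E.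
  apply: lt_le_trans Ehalf _; rewrite ler_expR ler_pdivrMr//.
  by rewrite ler_peMr ?ler1n// mulr_ge0//; exact: ltW.
have hN : N%:R * (C0 * expR (- (cc * tj))) < 1.
  rewrite expRN -/E mulrA ltr_pdivrMr// mul1r /N -natr1.
  have h : (Num.truncn (E / (2 * C0)))%:R * (2 * C0) <= E by rewrite -ler_pdivlMr// mulr_gt0.
  lra.
(* The grid is countable, so a single null set serves all narrow directions on it. *)
pose B w := forall a : grid q L, narrow (gpt dl a) -> `|mdot (gpt dl a) (xi j w)| <= theta * tj / 8.
have hB : {ae P, forall w, B w}.
  have hb : \forall w \ae P, forall i, (fun i w => if unpickle i is Some a then
      (narrow (gpt dl (a : grid q L)) -> `|mdot (gpt dl a) (xi j w)| <= theta * tj / 8) else True) i w.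
    apply: ae_foralln => i; case: unpickle => [a|]; last exact: filterE.
    have [na|na] := boolP (narrow (gpt dl a)); last by apply: filterE.
    by have := asboolW na; apply: filterS => w.
  by apply: filterS hb => w h a; have := h (pickle a); rewrite pickleK.
have [ws [w1 w2]] := xi_points hB hN.
have t0' := t0.
pose Xi (i : 'I_N) := xi j (ws i).
have Xi2 i : fn (Xi i) ^+ 2 <= 2 * tj by case: (w1 i (ltn_ord i)) => _ /andP[].
have Xi1 i : tj / 2 <= fn (Xi i) ^+ 2 by case: (w1 i (ltn_ord i)) => _ /andP[].
have XiL i : fn (Xi i) <= Num.sqrt (2 * tj).
  by apply: le_of_sqr; [exact: sqrtr_ge0|rewrite [leRHS]sqr_sqrtr ?Xi2// mulr_ge0// ltW].
have Xik i k : i != k -> mdot (Xi i) (Xi k) <= tj / 8.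
  rewrite neq_ltn => /orP[ik|ik]; first by apply: w2; rewrite ik ltn_ord.
  by rewrite mdotC; apply: w2; rewrite ik ltn_ord.
have /choice[u hu] : forall il : 'I_N * 'I_q, exists v : 'I_(2 * Z).+1,
    `|v%:R - Z%:R - theta * Xi il.1 il.2 0 / dl| <= 1.
  move=> [i l] /=; apply: round_index.
  have di : 0 < dl^-1 by rewrite invr_gt0.
  rewrite normrM (gtr0_norm di) ler_pdivrMr// normrM (gtr0_norm th0).
  rewrite [leRHS]mulrC; apply: le_trans dlZ; rewrite ler_pM2l//.
  apply: le_trans (XiL i); apply: le_of_sqr; first exact: fn_ge0.
  rewrite real_normK ?num_real// fn_sqrE (bigD1 l)//= big_ord1 lerDl.
  by apply: sumr_ge0 => k _; rewrite big_ord1 sqr_ge0.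
pose U i l := u (i, l).
pose zv i := zvec dl (U i).
have eta i : fn (zv i - theta *: Xi i) <= theta * Num.sqrt tj / 64.
  apply: le_trans (_ : dl * Num.sqrt q%:R <= _).
    apply: le_of_sqr; first by rewrite mulr_ge0 ?sqrtr_ge0//; exact: ltW.
    rewrite [leRHS]exprMn [in leRHS]sqr_sqrtr ?ler0n// fn_sqrE.
    apply: le_trans (_ : \sum_(l < q) dl ^+ 2 <= _); last by rewrite sumr_const card_ord mulr_natr.
    apply: ler_sum => l _; rewrite big_ord1 -[leLHS]real_normK ?num_real// ler_sqr ?nnegrE ?(ltW dl0)//.
    have h := hu (i, l).
    have -> : (zv i - theta *: Xi i) l 0 = dl * ((u (i, l))%:R - Z%:R - theta * Xi i l 0 / dl).
      rewrite !mxE /U.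
      by field; rewrite gt_eqF.
    rewrite normrM gtr0_norm// ler_piMr//; exact: ltW.
  apply: le_trans dlq _; rewrite ler_pM2r ?invr_gt0// ler_pM2l//.
  by rewrite ler_wsqrtr.
pose st := Num.sqrt tj.
have st0 : 0 < st by rewrite sqrtr_gt0.
have stst : st ^+ 2 = tj by rewrite sqr_sqrtr// ltW.
have Xist i : fn (Xi i) <= 3 / 2 * st.
  apply: le_of_sqr; first by rewrite mulr_ge0// ltW.
  by apply: le_trans (Xi2 i) _; rewrite exprMn stst; lra.
have zn i : fn (zv i) ^+ 2 / 2 <= cc * tj / 2.
  rewrite ler_pM2r ?invr_gt0//.
  have h : fn (zv i) <= 2 * theta * st.
    have := fnD (zv i - theta *: Xi i) (theta *: Xi i); rewrite subrK fnZ gtr0_norm// => h.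
    have h2 := eta i; rewrite -/st in h2; have h3 := ler_wpM2l (ltW th0) (Xist i).
    have h4 : 0 <= theta * st by rewrite mulr_ge0 ?ltW.
    lra.
  apply: le_trans (_ : (2 * theta * st) ^+ 2 <= _).
    by rewrite ler_sqr ?nnegrE ?fn_ge0// !mulr_ge0// ltW.
  have -> : (2 * theta * st) ^+ 2 = 4 * theta ^+ 2 * st ^+ 2 by ring.
  rewrite th2 stst le_eqVlt; apply/orP; left; apply/eqP; by field.
have As v : narrow (- v) = narrow v.
  have H y : narrow y -> narrow (- y).
    move=> /asboolW h; apply/asboolP; apply: filterS h => w.
    by rewrite mdotNl normrN.
  by apply/idP/idP => /H; rewrite ?opprK.
(* A common point of two translates is paired with Xi i. In units of theta tau, the diagonal term is
   at least 1/2, whereas two narrow terms and the off-diagonal one give at most 3/8 and the two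
   rounding errors 3/64. *)
have disj i k (v w : 'cV[R]_q) : narrow v -> narrow w -> (exists a : grid q L, v = gpt dl a) ->
    (exists a : grid q L, w = gpt dl a) -> i != k -> v + zv i != w + zv k.
  move=> nv nw [a va] [b wb] ik; apply/eqP => eq.
  have [Bi _] := w1 i (ltn_ord i); rewrite va in nv eq; rewrite wb in nw eq.
  have b1 := Bi a nv; have b2 := Bi b nw.
  have : mdot (gpt dl a + zv i) (Xi i) = mdot (gpt dl b + zv k) (Xi i) by rewrite eq.
  rewrite !mdotDl.
  have -> : zv i = (zv i - theta *: Xi i) + theta *: Xi i by rewrite subrK.
  have -> : zv k = (zv k - theta *: Xi k) + theta *: Xi k by rewrite subrK.
  rewrite !mdotDl !mdotZl -!fn_sqr.
  have e1 := le_trans (mdot_le (zv i - theta *: Xi i) (Xi i)) (ler_pM (fn_ge0 _) (fn_ge0 _) (eta i) (Xist i)).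
  have e2 := le_trans (mdot_le (zv k - theta *: Xi k) (Xi i)) (ler_pM (fn_ge0 _) (fn_ge0 _) (eta k) (Xist i)).
  have ee : theta * Num.sqrt tj / 64 * (3 / 2 * st) = 3 / 128 * (theta * tj).
    by rewrite -/st -stst; field.
  rewrite ee mdotDl in e1; rewrite ee mdotDl in e2.
  have x1 := ler_wpM2l (ltW th0) (Xi1 i).
  have ki : k != i by rewrite eq_sym.
  have x2 := ler_wpM2l (ltW th0) (Xik k i ki).
  move: b1 b2 e1 e2; rewrite !ler_norml -/(Xi i) => /andP[b1 b2] /andP[b3 b4] /andP[e1 e2] /andP[e3 e4] E'.
  have tt : 0 < theta * tj by rewrite mulr_gt0.
  lra.
(* [B] controls grid directions only, whereas [gpacking] quantifies over all vectors of the set;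
   hence the restriction to grid points. *)
pose narrow' : pred 'cV[R]_q := fun v => narrow v && `[< exists a : grid q L, v = gpt dl a >].
have n's (v : 'cV[R]_q) : narrow' (- v) = narrow' v.
  rewrite /narrow' As; congr (_ && _); apply/asboolP/asboolP => -[a ha].
    by exists (gneg a); rewrite gpt_neg -ha opprK.
  by exists (gneg a); rewrite gpt_neg ha.
have hd i k (v w : 'cV[R]_q) : narrow' v -> narrow' w -> i != k -> v + zvec dl (U i) != w + zvec dl (U k).
  by move=> /andP[nv /asboolW va] /andP[nw /asboolW wb]; exact: disj.
have pack := gpacking dl0 L n's zn hd.
have eqs : \sum_(a : grid q L | narrow' (gpt dl a)) gwt (gpt dl a) =
    \sum_(a : grid q L | narrow (gpt dl a)) gwt (gpt dl a).
  apply: eq_bigl => a; rewrite /narrow' (_ : `[< _ >] = true) ?andbT//.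
  by apply/asboolP; exists a.
rewrite eqs in pack; have W0 := gtot_gt0 dl q L.
have Eh0 : 0 < expR (- (cc * tj / 2)) by exact: expR_gt0.
have NE : 0 < N%:R * expR (- (cc * tj / 2)) by rewrite mulr_gt0// ltr0n.
(* The packing bound gives N < 4 exp(cc tau / 2). With N > exp(cc tau) / (2 C0) this forces exp(cc
   tau / 2) < 8 C0, against the choice of [tau0]. *)
have k1 : N%:R * expR (- (cc * tj / 2)) * (gtot dl q L / 2) < 2 * gtot dl q L.
  by apply: lt_le_trans (le_trans pack LZ); rewrite ltr_pM2l.
have k2 : N%:R * expR (- (cc * tj / 2)) < 4.
  have k3 : N%:R * expR (- (cc * tj / 2)) * gtot dl q L < 4 * gtot dl q L by lra.
  by rewrite ltr_pM2r in k3.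
rewrite expRN ltr_pdivrMr ?expR_gt0// in k2.
have EE : E = expR (cc * tj / 2) * expR (cc * tj / 2) by rewrite -expRD; congr expR; field.
have k4 : E / (2 * C0) < 4 * expR (cc * tj / 2) by apply: lt_trans n2 k2.
rewrite ltr_pdivrMr ?mulr_gt0// EE in k4.
have k5 : expR (cc * tj / 2) < 8 * C0.
  have : expR (cc * tj / 2) * expR (cc * tj / 2) < (8 * C0) * expR (cc * tj / 2) by lra.
  by rewrite ltr_pM2r// expR_gt0.
by have := lt_trans Ehalf k5; rewrite ltxx.
Qed.

End one_column.
End sudakov.

(** * Sum of the squared projected moments *)

Section tau_sum.
Context {d : measure_display} {T : measurableType d} {R : realType}
  (P : probability T R).
Local Notation fn := (@frobenius_norm R _ _).
Local Notation Ex := (Ex P).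
Local Notation Pr := (Pr P).
Local Notation bdd := (bdd P).
Variables (p n : nat) (X : T -> 'M[R]_(p, n)) (D : T -> 'M[R]_n) (C0 c0 kX K1 : R).
Local Notation sn := (Num.sqrt (n%:R : R)).
Hypotheses (C00 : 0 < C0) (c00 : 0 < c0) (kX0 : 0 < kX) (K10 : 0 <= K1) (n0 : (0 < n)%N).
Hypothesis conc : forall f : 'M[R]_(p, n) -> 'M[R]_n -> R, lipschitz1_mx_diag f ->
  let g := fun w => f (X w) (D w) in
  P.-integrable setT (EFin \o g) /\
  forall t : R, 0 < t ->
    (P [set w | (t <= `|g w - fine 'E_P[g]|)%R] <= (C0 * expR (- (t / c0) ^+ 2))%:E)%E.
Hypothesis X_random : random_mx X.
Hypothesis X_op : {ae P, forall w, opb (X w) (sn * kX)}.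
Hypothesis X_indep : mutually_independent_mx P (fun (i : 'I_n) w => col i (X w)).
Hypothesis X_mean : forall i, fn (expectation_mx P (fun w => col i (X w))) <= K1.

Local Notation x j := (fun w => col j (X w)).

Variables (q : nat) (e : nat -> 'cV[R]_p).
Hypotheses (q0 : (0 < q)%N) (e_ortho :
  forall l k, (l < q)%N -> (k < q)%N -> mdot (e l) (e k) = (l == k)%:R).

Local Notation th := (theta c0).
Local Notation t0 := (tau0 C0 c0 K1).
Local Notation tau := (tau P X q e).

Lemma theta_gt0 : 0 < th.
Proof. by rewrite divr_gt0// sqrtr_gt0 invr_gt0 mulr_gt0 ?ltr0n ?exprn_gt0. Qed.

Let t00 : 0 < t0. Proof. exact: tau0_gt0. Qed.

Lemma tau_ge0 j : 0 <= tau j.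
Proof. by apply: sumr_ge0 => l _; apply: Ex_ge0 => w; exact: sqr_ge0. Qed.

Lemma not_narrow_gt0 j (v : 'cV[R]_q) : ~~ narrow P X c0 e j v ->
  0 < Pr [set w | th * tau j / 8 < `|mdot (lift e v) (x j w)|].
Proof.
move=> nn; rewrite lt_neqAle Pr_ge0 andbT; apply/eqP => h.
move/negP: nn; apply; apply/asboolP.
have mA : measurable [set w | th * tau j / 8 < `|mdot (lift e v) (x j w)|].
  apply: measurable_ltr_set; apply: measurableT_comp => //.
  by case: (bdd_lin X_random X_op (lift e v) j).
exists [set w | th * tau j / 8 < `|mdot (lift e v) (x j w)|]; split => //.
  by rewrite PrE// -h.
by move=> w /= /negP; rewrite -ltNge mdot_lift.
Qed.

(* The a.s. bound on the operator norm of [X] holds for every choice of values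
   of the independent columns, hence for the simultaneously largest ones. *)
Lemma wide_sum (v : 'cV[R]_q) (J : pred 'I_n) :
  (forall j, J j -> ~~ narrow P X c0 e j v) ->
  \sum_(j | J j) (th * tau j / 8) ^+ 2 <= n%:R * kX ^+ 2 * fn v ^+ 2.
Proof.
move=> hJ.
pose F (j : 'I_n) : set 'cV[R]_p :=
  if J j then [set y | th * tau j / 8 < `|mdot (lift e v) y|] else setT.
have FB j : borel_mx (F j).
  rewrite /F; case: ifP => _; last exact: borel_setT.
  apply: (@borel_mdot _ _ _ (lift e v) [set r | th * tau j / 8 < `|r|]).
  by apply: measurable_ltr_set; exact: normr_measurable.
have mF j : measurable ((fun w => col j (X w)) @^-1` F j).
  rewrite /F; case: ifP => _; last by rewrite preimage_setT.
  apply: (@measurable_ltr_set _ _ _ (fun w => `|mdot (lift e v) (x j w)|)).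
  apply: measurableT_comp => //.
  by case: (bdd_lin X_random X_op (lift e v) j).
have pos j : 0 < Pr ((fun w => col j (X w)) @^-1` F j).
  rewrite /F; case: ifP => Jj; first by apply: not_narrow_gt0; exact: hJ.
  rewrite preimage_setT; have -> : Pr setT = 1 := congr1 fine (probability_setT P).
  exact: ltr01.
have := X_indep [set: 'I_n]%SET FB; set Ib := \bigcap_(j in _) _ => hI.
have mI : measurable Ib.
  rewrite (_ : Ib = \bigcap_i (if insub i is Some o then (fun w => col o (X w)) @^-1` F o else setT)).
    by apply: bigcapT_measurable => i; case: insub.
  apply/seteqP; split => w.
    by move=> h i _; case: insubP => // o _ _; apply: h; rewrite /= inE.
  by move=> h j _; have := h (val j) I; rewrite valK.
have PI : 0 < Pr Ib.
  have E : (\prod_(j in [set: 'I_n]%SET) P ((fun w => col j (X w)) @^-1` F j))%E =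
     (\prod_(j in [set: 'I_n]%SET) Pr ((fun w => col j (X w)) @^-1` F j))%:E.
    rewrite (big_morph EFin EFinM (erefl _)); apply: eq_bigr => j _; exact: PrE.
  have -> : Pr Ib = \prod_(j in [set: 'I_n]%SET) Pr ((fun w => col j (X w)) @^-1` F j).
    by move: hI; rewrite E PrE// => -[].
  by apply: prodr_gt0 => j _.
have [w [Iw ow]] := Pr_ex mI PI X_op.
apply: le_trans (_ : fn ((X w)^T *m lift e v) ^+ 2 <= _); last first.
  have h : fn ((X w)^T *m lift e v) <= sn * kX * fn v.
    rewrite -(fn_lift e_ortho); apply: opb_tr => //.
    by rewrite mulr_ge0 ?sqrtr_ge0// ltW.
  apply: le_trans (_ : (sn * kX * fn v) ^+ 2 <= _).
    by rewrite ler_sqr ?nnegrE ?fn_ge0// !mulr_ge0 ?sqrtr_ge0 ?fn_ge0// ltW.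
  have -> : (sn * kX * fn v) ^+ 2 = sn ^+ 2 * kX ^+ 2 * fn v ^+ 2 by ring.
  by rewrite sqr_sqrtr ?ler0n.
have -> : fn ((X w)^T *m lift e v) ^+ 2 = \sum_j mdot (lift e v) (x j w) ^+ 2.
  rewrite fn_sqrE; apply: eq_bigr => j _; rewrite big_ord1; congr (_ ^+ 2).
  rewrite mxE /mdot; apply: eq_bigr => i _; rewrite big_ord1 !mxE mulrC //.
rewrite [leRHS](bigID J) /= -[leLHS]addr0; apply: lerD; last first.
  by apply: sumr_ge0 => j _; exact: sqr_ge0.
apply: ler_sum => j Jj; have := Iw j; rewrite /F Jj /= inE => /(_ isT) h.
have s0 : 0 <= th * tau j / 8.
  by rewrite divr_ge0// mulr_ge0 ?tau_ge0//; exact: ltW theta_gt0.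
by rewrite -[leRHS]real_normK ?num_real// ler_sqr ?nnegrE// ltW.
Qed.

(** 2048 = 64 times 2 times 16: the width th tau / 8 squared, the half of the directions, and the
    second moment bound 16 q. Columns with tau below the threshold contribute at most t0^2 each. *)
Definition tau_const := 2048 * kX ^+ 2 / th ^+ 2 + t0 ^+ 2.

(** Double counting of the pairs of a direction and a column wide in it: [wide_sum] for a fixed
    direction, [narrow_half] for a fixed column. *)
Lemma tau_sum : \sum_j tau j ^+ 2 <= tau_const * n%:R * q%:R.
Proof.
have thp := theta_gt0.
have sq0 : 0 < Num.sqrt (q%:R : R) by rewrite sqrtr_gt0 ltr0n.
pose dl := th * Num.sqrt t0 / 64 / Num.sqrt q%:R.
have dl0 : 0 < dl.
  by apply: divr_gt0 => //; apply: divr_gt0; rewrite ?ltr0n//; apply: mulr_gt0; rewrite ?sqrtr_gt0.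
have dlq : dl * Num.sqrt q%:R <= th * Num.sqrt t0 / 64 by rewrite divfK ?gt_eqF.
(* The grid must be common to all columns: [Tm] bounds every [tau j], so one [Z], and then one [L],
   serves them all. *)
pose Tm := \sum_j tau j.
have tT j : tau j <= Tm.
  by rewrite /Tm (bigD1 j)//= lerDl; apply: sumr_ge0 => k _; exact: tau_ge0.
pose y := th * Num.sqrt (2 * Tm) / dl.
pose Z := Num.bound y.
have y0 : 0 <= y by rewrite divr_ge0 ?mulr_ge0 ?sqrtr_ge0//; exact: ltW.
have dlZ j : th * Num.sqrt (2 * tau j) <= dl * Z%:R.
  apply: le_trans (_ : dl * y <= _); last by rewrite ler_pM2l//; exact: ltW (archi_boundP y0).
  rewrite /y [leRHS]mulrC divfK ?gt_eqF// ler_pM2l// ler_wsqrtr// ler_pM2l//.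
have [L LZ] := gtot_double dl0 q Z.
have nh j : t0 <= tau j ->
    \sum_(a : grid q L | narrow P X c0 e j (gpt dl a)) gwt (gpt dl a) <= gtot dl q L / 2.
  move=> big; apply: (narrow_half C00 c00 kX0 K10 conc X_random X_op X_mean e_ortho big dl0 dlq (dlZ j) LZ).
have W0 := gtot_gt0 dl q L.
pose s j := (th * tau j / 8) ^+ 2.
have s0 j : 0 <= s j by exact: sqr_ge0.
have H1 : \sum_(a : grid q L) gwt (gpt dl a) * \sum_(j | (t0 <= tau j) && ~~ narrow P X c0 e j (gpt dl a)) s j
    <= n%:R * kX ^+ 2 * (16 * q%:R * gtot dl q L).
  apply: le_trans (ler_wpM2l _ (gmoment dl0 q L)); last by rewrite mulr_ge0 ?ler0n ?sqr_ge0.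
  rewrite mulr_sumr; apply: ler_sum => a _; rewrite mulrCA.
  rewrite ler_pM2l ?gwt_gt0//; apply: wide_sum => j /andP[].
  by [].
have H2 : \sum_(j | t0 <= tau j) s j * (gtot dl q L / 2) <=
    \sum_(a : grid q L) gwt (gpt dl a) * \sum_(j | (t0 <= tau j) && ~~ narrow P X c0 e j (gpt dl a)) s j.
  under [leRHS]eq_bigr do rewrite mulr_sumr big_mkcondr.
  rewrite exchange_big /=; apply: ler_sum => j big.
  have -> : \sum_(a : grid q L) (if ~~ narrow P X c0 e j (gpt dl a) then gwt (gpt dl a) * s j else 0) =
      s j * \sum_(a : grid q L | ~~ narrow P X c0 e j (gpt dl a)) gwt (gpt dl a).
    by rewrite -big_mkcond mulr_sumr; apply: eq_bigr => a _; rewrite mulrC.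
  rewrite ler_wpM2l//; have := nh j big.
  have : gtot dl q L = \sum_(a : grid q L | narrow P X c0 e j (gpt dl a)) gwt (gpt dl a) +
      \sum_(a : grid q L | ~~ narrow P X c0 e j (gpt dl a)) gwt (gpt dl a).
    by rewrite /gtot (bigID (fun a : grid q L => narrow P X c0 e j (gpt dl a))).
  lra.
have H3 : \sum_(j | t0 <= tau j) s j <= 32 * n%:R * kX ^+ 2 * q%:R.
  have := le_trans H2 H1; rewrite -mulr_suml.
  have -> : n%:R * kX ^+ 2 * (16 * q%:R * gtot dl q L) =
    32 * n%:R * kX ^+ 2 * q%:R * (gtot dl q L / 2) by field.
  by rewrite ler_pM2r// divr_gt0.
rewrite (bigID (fun j => t0 <= tau j)) /=.
have H4 : \sum_(j | t0 <= tau j) tau j ^+ 2 <= 2048 * kX ^+ 2 / th ^+ 2 * n%:R * q%:R.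
  have -> : \sum_(j | t0 <= tau j) tau j ^+ 2 = 64 / th ^+ 2 * \sum_(j | t0 <= tau j) s j.
    rewrite mulr_sumr; apply: eq_bigr => j _; rewrite /s; field; by rewrite gt_eqF.
  have c : 0 <= 64 / th ^+ 2 by rewrite divr_ge0 ?sqr_ge0.
  apply: le_trans (ler_wpM2l c H3) _.
  by rewrite le_eqVlt; apply/orP; left; apply/eqP; field; rewrite gt_eqF.
have H5 : \sum_(j | ~~ (t0 <= tau j)) tau j ^+ 2 <= t0 ^+ 2 * n%:R * q%:R.
  apply: le_trans (_ : \sum_(j < n) t0 ^+ 2 <= _).
    rewrite big_mkcond; apply: ler_sum => j _; case: ifP => // h; last exact: sqr_ge0.
    rewrite ler_sqr ?nnegrE ?tau_ge0 ?(ltW t00)//.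
    by move: h; rewrite -ltNge => /ltW.
  by rewrite sumr_const card_ord -[leLHS]mulr_natr ler_peMr ?ler1n// mulr_ge0 ?sqr_ge0.
have aux (u1 u2 a b u v : R) : a <= u1 * u * v -> b <= u2 * u * v -> a + b <= (u1 + u2) * u * v.
  by move=> h1 h2; rewrite 2!mulrDl lerD.
exact: aux H4 H5.
Qed.

End tau_sum.

(** * Spectrum of the average second moment matrix *)

Section spectral_sum.
Context {R : realType}.

Lemma abel_sum (a b : nat -> R) r :
  \sum_(l < r) a l * b l =
  \sum_(k < r) (a k - a k.+1) * (\sum_(l < k.+1) b l) + a r * \sum_(l < r) b l.
Proof.
elim: r => [|r IH]; first by rewrite !big_ord0 mulr0 addr0.
rewrite big_ord_recr IH [in RHS]big_ord_recr /= [in RHS]big_ord_recr /=; ring.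
Qed.

Lemma weighted_cauchy (I : finType) (w z : I -> R) : (forall i, 0 <= w i) ->
  (\sum_i w i * z i) ^+ 2 <= (\sum_i w i) * (\sum_i w i * z i ^+ 2).
Proof.
move=> w0; have := cauchy_sum (fun i => Num.sqrt (w i)) (fun i => Num.sqrt (w i) * z i).
under eq_bigr do rewrite mulrA -expr2 sqr_sqrtr//.
under [X in _ <= X * _ -> _]eq_bigr do rewrite sqr_sqrtr//.
by under [X in _ <= _ * X -> _]eq_bigr do rewrite exprMn sqr_sqrtr//.
Qed.

Definition harm (r : nat) : R := \sum_(k < r) k.+1%:R^-1.

Lemma harm_ge0 r : 0 <= harm r.
Proof. by apply: sumr_ge0 => k _; rewrite invr_ge0. Qed.

Lemma harm_le r s : (r <= s)%N -> harm r <= harm s.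
Proof.
move=> rs; rewrite /harm -!(big_mkord xpredT (fun k => k.+1%:R^-1)).
rewrite [leRHS](big_cat_nat (n := r))//= lerDl.
by apply: sumr_ge0 => k _; rewrite invr_ge0.
Qed.

Lemma sqrt_incr (k : nat) :
  (Num.sqrt k.+1%:R - Num.sqrt k%:R) * Num.sqrt k.+1%:R <= 1 :> R.
Proof.
have s1 := sqr_sqrtr (ler0n R k.+1); have s0 := sqr_sqrtr (ler0n R k).
have h : Num.sqrt k%:R <= Num.sqrt k.+1%:R :> R by rewrite ler_wsqrtr// ler_nat.
have h0 : 0 <= Num.sqrt k%:R :> R by exact: sqrtr_ge0.
have h1 : k.+1%:R = k%:R + 1 :> R by rewrite natr1.
set u := Num.sqrt k.+1%:R in s1 h *; set v := Num.sqrt k%:R in s0 h h0 *.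
have : 0 <= (u - v) * v by rewrite mulr_ge0// subr_ge0.
nra.
Qed.

Variables (n r : nat) (mu : 'I_n -> nat -> R) (lam : nat -> R) (C : R).
Hypotheses (n0 : (0 < n)%N) (mu0 : forall j l, 0 <= mu j l) (C0 : 0 <= C)
  (lam0 : forall l, (l < r)%N -> 0 <= lam l)
  (lam_sorted : forall l k, (l <= k)%N -> (k < r)%N -> lam k <= lam l)
  (lamE : forall l, (l < r)%N -> n%:R * lam l = \sum_j mu j l)
  (tau_le : forall q, (0 < q)%N -> (q <= r)%N ->
     \sum_j (\sum_(l < q) mu j l) ^+ 2 <= C * n%:R * q%:R).

Let nR0 : 0 < n%:R :> R. Proof. by rewrite ltr0n. Qed.

(* If the k-th largest eigenvalue is lam, the first k+1 eigendirections carry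
   total mass at least (k + 1) lam, which the bound on sum_j tau_j^2 limits. *)
Lemma lam_decay k : (k < r)%N -> lam k * Num.sqrt k.+1%:R <= Num.sqrt C.
Proof.
move=> kr; apply: le_of_sqr; first exact: sqrtr_ge0.
rewrite exprMn [in leRHS]sqr_sqrtr// [in leLHS]sqr_sqrtr ?ler0n//.
have h1 : n%:R * (k.+1%:R * lam k) <= \sum_j \sum_(l < k.+1) mu j l.
  rewrite exchange_big /=.
  apply: le_trans (_ : \sum_(l < k.+1) n%:R * lam k <= _).
    by rewrite sumr_const card_ord -[leRHS]mulr_natl mulrCA.
  apply: ler_sum => l _; have lr : (l < r)%N by apply: leq_trans kr; rewrite ltnS -ltnS.
  by rewrite -lamE// ler_pM2l//; apply: lam_sorted => //; rewrite -ltnS.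
have h2 := cauchy_sum (fun=> 1) (fun j => \sum_(l < k.+1) mu j l).
move: h2; under eq_bigr do rewrite mul1r.
under [X in _ <= X * _ -> _]eq_bigr do rewrite expr1n.
rewrite sumr_const card_ord => h2.
have h3 : (n%:R * (k.+1%:R * lam k)) ^+ 2 <= n%:R * (C * n%:R * k.+1%:R).
  apply: le_trans (_ : (\sum_j \sum_(l < k.+1) mu j l) ^+ 2 <= _).
    rewrite ler_sqr ?nnegrE ?mulr_ge0 ?ler0n ?lam0//.
    by apply: sumr_ge0 => j _; apply: sumr_ge0.
  by apply: le_trans h2 _; rewrite ler_wpM2l ?ler0n//; exact: tau_le.
have k0 : 0 < k.+1%:R :> R by rewrite ltr0n.
rewrite -(@ler_pM2l _ (n%:R * n%:R * k.+1%:R)) ?mulr_gt0//.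
have -> : n%:R * n%:R * k.+1%:R * (lam k ^+ 2 * k.+1%:R) = (n%:R * (k.+1%:R * lam k)) ^+ 2 by ring.
by have -> : n%:R * n%:R * k.+1%:R * C = n%:R * (C * n%:R * k.+1%:R) by ring.
Qed.

(** Abel summation writes the inner sum through the partial sums of mu, whose squares [tau_le]
    controls after summation over j. Cauchy-Schwarz with the weights (lam_k - lam_(k+1)) sqrt(k+1)
    makes every k contribute C n; the total weight, by Abel summation backwards and [lam_decay], is
    at most sqrt(C) times the harmonic sum. *)
Lemma spectral_sum :
  \sum_j (\sum_(l < r) lam l * mu j l) ^+ 2 <= C ^+ 2 * n%:R * harm r ^+ 2.
Proof.
(* Extension by 0 removes the boundary term of the Abel summation and keeps the sequence
   decreasing. *)
pose a l := if (l < r)%N then lam l else 0.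
have a_dec k : (k < r)%N -> 0 <= a k - a k.+1.
  move=> kr; rewrite subr_ge0 /a kr; case: ltnP => h; last exact: lam0.
  exact: lam_sorted.
pose w (k : 'I_r) := (a k - a k.+1) * Num.sqrt k.+1%:R.
have w0 k : 0 <= w k by rewrite mulr_ge0 ?sqrtr_ge0 ?a_dec.
pose S := \sum_k w k.
have S0 : 0 <= S by apply: sumr_ge0.
have ar : a r = 0 by rewrite /a ltnn.
have SE : S = \sum_(l < r) a l * (Num.sqrt l.+1%:R - Num.sqrt l%:R).
  rewrite (abel_sum a (fun l => Num.sqrt l.+1%:R - Num.sqrt l%:R)) ar mul0r addr0.
  apply: eq_bigr => k _; congr (_ * _).
  rewrite -(big_mkord xpredT (fun l => Num.sqrt l.+1%:R - Num.sqrt l%:R)).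
  by rewrite telescope_sumr// sqrtr0 subr0.
have Sle : S <= Num.sqrt C * harm r.
  rewrite SE mulr_sumr; apply: ler_sum => l _; rewrite /a ltn_ord.
  have s0 : 0 < Num.sqrt l.+1%:R :> R by rewrite sqrtr_gt0 ltr0n.
  have -> : l.+1%:R^-1 = (Num.sqrt l.+1%:R)^-1 * (Num.sqrt l.+1%:R)^-1 :> R.
    by rewrite -invfM -expr2 sqr_sqrtr ?ler0n.
  rewrite mulrA; apply: ler_pM; first exact: lam0.
  - by rewrite subr_ge0 ler_wsqrtr// ler_nat.
  - by rewrite ler_pdivlMr//; exact: lam_decay.
  by rewrite -[leRHS]mul1r ler_pdivlMr//; exact: sqrt_incr.
have tj j : (\sum_(l < r) lam l * mu j l) ^+ 2 <=
    S * \sum_k w k * ((\sum_(l < k.+1) mu j l) ^+ 2 / k.+1%:R).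
  have -> : \sum_(l < r) lam l * mu j l = \sum_k w k * ((\sum_(l < k.+1) mu j l) / Num.sqrt k.+1%:R).
    transitivity (\sum_(l < r) a l * mu j l).
      by apply: eq_bigr => l _; rewrite /a ltn_ord.
    rewrite (abel_sum a (mu j)) ar mul0r addr0; apply: eq_bigr => k _.
    by rewrite /w -mulrA [Num.sqrt _ * _]mulrC divfK// gt_eqF// sqrtr_gt0 ltr0n.
  apply: le_trans (weighted_cauchy _ w0) _; rewrite ler_wpM2l//.
  rewrite le_eqVlt; apply/orP; left; apply/eqP; apply: eq_bigr => k _.
  by rewrite expr_div_n sqr_sqrtr ?ler0n.
apply: le_trans (ler_sum _ (fun j _ => tj j)) _; rewrite -mulr_sumr exchange_big /=.
apply: le_trans (_ : S * (S * (C * n%:R)) <= _).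
  rewrite ler_wpM2l// mulr_suml; apply: ler_sum => k _.
  rewrite -mulr_sumr ler_wpM2l// -mulr_suml ler_pdivrMr ?ltr0n//.
  exact: tau_le.
rewrite mulrA -expr2; apply: le_trans (_ : (Num.sqrt C * harm r) ^+ 2 * (C * n%:R) <= _).
  apply: ler_wpM2r; first by rewrite mulr_ge0// ler0n.
  by rewrite ler_sqr ?nnegrE// mulr_ge0 ?sqrtr_ge0 ?harm_ge0.
rewrite exprMn sqr_sqrtr// le_eqVlt; apply/orP; left; apply/eqP; ring.
Qed.

End spectral_sum.

Lemma tau_const_ge0 (R : realType) (C0 c0 kX K1 : R) : 0 <= tau_const C0 c0 kX K1.
Proof.
apply: addr_ge0; last exact: sqr_ge0.
apply: divr_ge0; last exact: sqr_ge0.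
apply: mulr_ge0; [exact: ler0n|exact: sqr_ge0].
Qed.

(** * The traces tr(C_j H) *)

Section average_moment.
Context {d : measure_display} {T : measurableType d} {R : realType}
  (P : probability T R).
Local Notation fn := (@frobenius_norm R _ _).
Local Notation Ex := (Ex P).
Variables (p n : nat) (X : T -> 'M[R]_(p, n)) (D : T -> 'M[R]_n) (C0 c0 kX K1 : R).
Local Notation sn := (Num.sqrt (n%:R : R)).
Hypotheses (C00 : 0 < C0) (c00 : 0 < c0) (kX0 : 0 < kX) (K10 : 0 <= K1) (n0 : (0 < n)%N).
Hypothesis conc : forall f : 'M[R]_(p, n) -> 'M[R]_n -> R, lipschitz1_mx_diag f ->
  let g := fun w => f (X w) (D w) in
  P.-integrable setT (EFin \o g) /\
  forall t : R, 0 < t ->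
    (P [set w | (t <= `|g w - fine 'E_P[g]|)%R] <= (C0 * expR (- (t / c0) ^+ 2))%:E)%E.
Hypothesis X_random : random_mx X.
Hypothesis X_op : {ae P, forall w, opb (X w) (sn * kX)}.
Hypothesis X_indep : mutually_independent_mx P (fun (i : 'I_n) w => col i (X w)).
Hypothesis X_mean : forall i, fn (expectation_mx P (fun w => col i (X w))) <= K1.

Local Notation smom := (smom P X).

Definition avg_mom : 'M[R]_p := n%:R^-1 *: \sum_k smom k.

(** In an eigenbasis of H the trace is a sum of eigenvalues times diagonal entries of C_j, and
    [tau_sum] applies to the span of the q leading eigenvectors. *)
Lemma avg_mom_sum :
  \sum_j mdot (smom j) avg_mom ^+ 2 <=
    tau_const C0 c0 kX K1 ^+ 2 * n%:R * harm p ^+ 2.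
Proof.
have nR0 : 0 < n%:R :> R by rewrite ltr0n.
have Ht : avg_mom^T = avg_mom.
  by rewrite /avg_mom linearZ linear_sum /=; congr (_ *: _); apply: eq_bigr => k _; exact: smom_tr.
have Hq (v : 'cV[R]_p) : mdot v (avg_mom *m v) = n%:R^-1 * \sum_k mdot v (smom k *m v).
  by rewrite /avg_mom -scalemxAl mdotZr mulmx_suml mdot_sumr.
have Hp (v : 'cV[R]_p) : 0 <= mdot v (avg_mom *m v).
  rewrite Hq mulr_ge0 ?invr_ge0//.
  by apply: sumr_ge0 => k _; exact: smom_psd X_random X_op _ _.
have [r [lam [e [rp eo l0 ls HE]]]] := psd_spectral Ht Hp.
pose mu j l := mdot (e l) (smom j *m e l).
have eig l : (l < r)%N -> avg_mom *m e l = lam l *: e l.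
  move=> lr; rewrite HE mulmx_suml (bigD1 (Ordinal lr))//= -scalemxAl outer_mul eo// eqxx scale1r.
  rewrite big1 ?addr0// => k kl; rewrite -scalemxAl outer_mul eo//.
  by rewrite (_ : (k : nat) == l = false) ?scale0r ?scaler0//; apply: contraNF kl => /eqP kl; apply/eqP/val_inj.
have tE j : mdot (smom j) avg_mom = \sum_(l < r) lam l * mu j l.
  rewrite HE mdot_sumr; apply: eq_bigr => l _; rewrite mdotZr /outer mdot_rank1.
  by rewrite mdotC.
under eq_bigr do rewrite tE.
apply: le_trans (_ : tau_const C0 c0 kX K1 ^+ 2 * n%:R * harm r ^+ 2 <= _); last first.
  apply: ler_wpM2l; first by rewrite mulr_ge0 ?sqr_ge0// ltW.
  by rewrite ler_sqr ?nnegrE ?harm_ge0// harm_le.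
apply: spectral_sum => //.
- by move=> j l; exact: smom_psd X_random X_op _ _.
- exact: tau_const_ge0.
- by move=> l lr; apply: ltW; exact: l0.
- move=> l lr; have := Hq (e l); rewrite eig// mdotZr eo// eqxx mulr1 => ->.
  by rewrite mulrA divff ?gt_eqF// mul1r.
move=> q q0 qr.
have eo' l k : (l < q)%N -> (k < q)%N -> mdot (e l) (e k) = (l == k)%:R.
  by move=> lq kq; apply: eo; exact: leq_trans qr.
have := tau_sum C00 c00 kX0 K10 conc X_random X_op X_indep X_mean q0 eo'.
apply: le_trans; rewrite le_eqVlt; apply/orP; left; apply/eqP.
apply: eq_bigr => j _; congr (_ ^+ 2); apply: eq_bigr => l _.
by rewrite /mu (smom_quad X_random X_op).
Qed.

End average_moment.

(** * Concentration of the resolvent *)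

Lemma ln_ge_half (R : realType) (n : nat) : (1 < n)%N -> 2^-1 <= ln n%:R :> R.
Proof.
move=> n1; apply: le_trans (_ : ln 2 <= _); last first.
  by rewrite ler_ln ?posrE ?ltr0n ?ler_nat// ltnW.
have := @le_ln1Dx R (- 2^-1); rewrite (_ : 1 + - 2^-1 = 2^-1 :> R); last by field.
rewrite lnV ?posrE//; have h : -1 < - 2^-1 :> R by lra.
move=> /(_ h); lra.
Qed.

Lemma harm_ln (R : realType) (r : nat) : harm r <= 2 * ln r.+1%:R :> R.
Proof.
rewrite /harm; elim: r => [|r IH]; first by rewrite big_ord0 ln1 mulr0.
rewrite big_ord_recr /=.
have r1 : 0 < r.+1%:R :> R by rewrite ltr0n.
have e2 : r.+2%:R = r.+1%:R + 1 :> R by rewrite natr1.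
have x1 : 1 <= r.+1%:R :> R by rewrite ler1n.
have : ln r.+1%:R <= ln r.+2%:R - r.+2%:R^-1 :> R.
  have -> : r.+1%:R = r.+2%:R * (1 + - r.+2%:R^-1) :> R.
    by rewrite mulrDr mulrN divff ?gt_eqF ?ltr0n// e2; ring.
  have h : -1 < - r.+2%:R^-1 :> R.
    by rewrite ltrN2 invf_lt1 ?ltr0n// ltr1n.
  rewrite lnM ?posrE ?ltr0n//; last by rewrite -(subrr 1) ltrD2l.
  by rewrite lerD2l; exact: le_ln1Dx.
have : r.+1%:R^-1 <= 2 * r.+2%:R^-1 :> R.
  rewrite -ler_pdivrMr ?invr_gt0 ?ltr0n// invrK mulrC ler_pdivrMr// e2; move: x1; move: (r.+1%:R : R) => y; lra.
move: (ln r.+1%:R) (ln r.+2%:R) (r.+1%:R^-1) (r.+2%:R^-1) IH => a b e f. lra.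
Qed.

Lemma fn_opb (R : realType) m n (A : 'M[R]_(m, n)) c : 0 <= c -> opb A c ->
  frobenius_norm A <= Num.sqrt n%:R * c.
Proof.
move=> c0 hA; apply: le_of_sqr; first by rewrite mulr_ge0 ?sqrtr_ge0.
rewrite exprMn [in leRHS]sqr_sqrtr ?ler0n// fn_col -[n in n%:R]card_ord mulr_natl -sumr_const.
apply: ler_sum => j _; rewrite ler_sqr ?nnegrE ?fn_ge0//; exact: opb_col.
Qed.

Section gamma_zero.
Context {R : realType}.
Variables (p n r : nat) (C E : 'M[R]_(p, r)).

Lemma gam0 i : gam C E (0 : 'M[R]_(p, n)) i = 0.
Proof.
rewrite /gam linear0 !mulmx0 fn0 /beta !add0r.
rewrite (_ : offcol _ _ = 0) ?fn0 ?mul0r//.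
by apply/matrixP => k l; rewrite mxE [RHS]mxE; case: eqP => // _; rewrite trmx0 mul0mx mxE.
Qed.

Lemma sum4_0 : sum4 C E (0 : 'M[R]_(p, n)) = 0.
Proof. by rewrite /sum4 big1// => i _; rewrite gam0 expr0n. Qed.

Lemma gam4_0 : gam4 C E (0 : 'M[R]_(p, n)) = 0.
Proof. by rewrite /gam4 sum4_0 /root4 !sqrtr0. Qed.

Lemma opb0 c : 0 <= c -> opb (0 : 'M[R]_(p, n)) c.
Proof. by move=> c0 v; rewrite mul0mx fn0 mulr_ge0 ?fn_ge0. Qed.

End gamma_zero.

(** * Tail of the l^4 norm of gamma *)

Section gamma_tail.
Context {d : measure_display} {T : measurableType d} {R : realType}
  (P : probability T R).
Local Notation fn := (@frobenius_norm R _ _).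
Local Notation Ex := (Ex P).
Local Notation Pr := (Pr P).
Local Notation bdd := (bdd P).
Local Notation subg := (subg P).
Variables (p n r : nat) (X : T -> 'M[R]_(p, n)) (D : T -> 'M[R]_n) (C0 c0 kX K1 Kp : R).
Local Notation sn := (Num.sqrt (n%:R : R)).
Hypotheses (C01 : 1 <= C0) (c00 : 0 < c0) (kX0 : 0 < kX) (K10 : 0 <= K1) (n1 : (1 < n)%N)
  (Kp0 : 0 <= Kp) (pn : p%:R <= Kp * n%:R).
Hypothesis conc : forall f : 'M[R]_(p, n) -> 'M[R]_n -> R, lipschitz1_mx_diag f ->
  let g := fun w => f (X w) (D w) in
  P.-integrable setT (EFin \o g) /\
  forall t : R, 0 < t ->
    (P [set w | (t <= `|g w - fine 'E_P[g]|)%R] <= (C0 * expR (- (t / c0) ^+ 2))%:E)%E.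
Hypothesis X_random : random_mx X.
Hypothesis X_op : {ae P, forall w, opb (X w) (sn * kX)}.
Hypothesis X_indep : mutually_independent_mx P (fun (i : 'I_n) w => col i (X w)).
Hypothesis X_mean : forall i, fn (expectation_mx P (fun w => col i (X w))) <= K1.
Variables (C E : 'M[R]_(p, r)).
Hypotheses (C1 : fn C <= 1) (E1 : fn E <= 1).

Local Notation x j := (fun w => col j (X w)).
Local Notation smom := (smom P X).
Local Notation M := (second_moment_const C0 c0 K1).
Local Notation v := (c0 * gam_lip kX).
Let C00 : 0 < C0. Proof. exact: lt_le_trans C01. Qed.
Let n0 : (0 < n)%N. Proof. exact: ltnW. Qed.
Let nR0 : 0 < n%:R :> R. Proof. by rewrite ltr0n. Qed.
Let gl0 : 0 < gam_lip kX. Proof. by rewrite addr_gt0// mulr_gt0. Qed.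
Let v0 : 0 < v. Proof. exact: mulr_gt0. Qed.
Let snk : 0 <= sn * kX. Proof. by rewrite mulr_ge0 ?sqrtr_ge0 ?ltW. Qed.
Let bnd := gam_lip kX * (sn * (sn * kX)).
Let bnd0 : 0 <= bnd. Proof. by rewrite mulr_ge0 ?mulr_ge0 ?sqrtr_ge0 ?ltW. Qed.

Let avg := avg_mom P X.
Let t_ j := mdot (smom j) avg.

Lemma t_E j : t_ j = n%:R^-1 * \sum_k mdot (smom j) (smom k).
Proof. by rewrite /t_ /avg /avg_mom mdotZr mdot_sumr. Qed.

Lemma t_ge0 j : 0 <= t_ j.
Proof.
rewrite t_E mulr_ge0 ?invr_ge0//; apply: sumr_ge0 => k _.
exact: smom_dot_ge0 X_random X_op _ _.
Qed.

Lemma Ex_sandwich (B : 'M[R]_(p, r)) j : fn B <= 1 ->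
  bdd (fun w => fn (B^T *m x j w) ^+ 2) /\ Ex (fun w => fn (B^T *m x j w) ^+ 2) <= M.
Proof.
move=> B1; have -> : (fun w => fn (B^T *m x j w) ^+ 2) =
    (fun w => \sum_l mdot (col l B) (x j w) ^+ 2).
  apply/funext => w; rewrite fn_sqrE; apply: eq_bigr => l _; rewrite big_ord1; congr (_ ^+ 2).
  by rewrite mxE /mdot; apply: eq_bigr => a _; rewrite big_ord1 !mxE.
have bl l : bdd (fun w => mdot (col l B) (x j w) ^+ 2).
  by apply: bddX; exact: bdd_lin X_random X_op _ _.
split; first exact: bdd_sum.
rewrite Ex_sum//; apply: le_trans (ler_sum _ (fun l _ =>
  Ex_lin_sqr C00 c00 kX0 K10 conc X_random X_op X_mean (col l B) j)) _.
rewrite -mulr_suml -fn_col ler_piMl//.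
  by rewrite /second_moment_const addr_ge0 ?sqr_ge0// mulr_ge0 ?sqr_ge0 ?addr_ge0 ?(ltW C00).
by rewrite exprn_ile1// fn_ge0.
Qed.

(** Independence evaluates the terms k != j; the term k = j, absent from [beta], is nonnegative in
    [t_]. *)
Lemma Ex_beta j : bdd (fun w => beta (X w) j ^+ 2) /\ Ex (fun w => beta (X w) j ^+ 2) <= t_ j.
Proof.
pose G k w := if k == j then 0 else mdot (x j w) (x k w) ^+ 2.
have -> : (fun w => beta (X w) j ^+ 2) = (fun w => n%:R^-1 * \sum_k G k w).
  apply/funext => w; rewrite /beta expr_div_n [sn ^+ 2]sqr_sqrtr ?ler0n// mulrC; congr (_ * _).
  rewrite fn_sqrE; apply: eq_bigr => k _; rewrite big_ord1 mxE /G.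
  case: eqP => [_|_]; first by rewrite expr0n.
  congr (_ ^+ 2); rewrite mxE /mdot; apply: eq_bigr => a _.
  by rewrite big_ord1 !mxE mulrC.
have bG k : bdd (G k).
  rewrite /G; case: eqP => [_|_]; first exact: bdd_cst.
  apply: bddX; apply: bdd_sum => a; apply: bdd_sum => b.
  by apply: bddM; exact: bdd_col_entry X_random X_op _ _ _.
have bs : bdd (fun w => \sum_k G k w) by exact: bdd_sum.
split; first exact: bddZ.
rewrite ExZ// Ex_sum// t_E ler_wpM2l ?invr_ge0//; apply: ler_sum => k _.
rewrite /G; have [_|kj] := eqVneq k j.
  by rewrite (Ex_cst P 0); exact: smom_dot_ge0 X_random X_op _ _.
by rewrite (Ex_cross X_random X_op X_indep) // eq_sym.
Qed.

(** The deviation whose tail C0 exp(-(dev / v)^2) equals 1 / (2 n), for a union bound over the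
    columns. *)
Let dev := v * Num.sqrt (ln (2 * C0 * n%:R)).
(** From (a + b + c)^2 <= 3 (a^2 + b^2 + c^2), with M bounding the mean of the first two squares and
    t_j that of the third. *)
Let typ j := Num.sqrt (6 * M + 3 * t_ j).

Let M0 : 0 <= M.
Proof. by rewrite /second_moment_const addr_ge0 ?sqr_ge0// mulr_ge0 ?sqr_ge0 ?addr_ge0 ?(ltW C00). Qed.

Lemma gam_proxy j : exists2 h : T -> R, subg C0 v h /\ Ex h <= typ j &
  {ae P, forall w, h w = gam C E (X w) j}.
Proof.
have [||h [h1 h2 h3]] := conc_X (kX := kX) conc X_op (g := fun Y => gam C E Y j) gl0 bnd0.
- by move=> X1 X2 o1 o2; exact: gam_lipschitz.
- move=> X1 o1; have := gam_lipschitz (X' := 0) n0 kX0 C1 E1 j o1 (opb0 p snk).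
  rewrite gam0 !subr0 => /le_trans; apply; rewrite ler_wpM2l ?(ltW gl0)//.
  exact: fn_opb.
exists h => //; split => //; case: (h1) => bh _.
have [bC eC] := Ex_sandwich j C1; have [bE eE] := Ex_sandwich j E1.
have [bB eB] := Ex_beta j.
apply: le_of_sqr; first exact: sqrtr_ge0.
have t0 := t_ge0 j; have M0' := M0.
rewrite [leRHS]sqr_sqrtr; last by rewrite addr_ge0// mulr_ge0.
apply: le_trans (Ex_sqr_le bh) _.
have bCE : bdd (fun w => fn (C^T *m x j w) ^+ 2 + fn (E^T *m x j w) ^+ 2) by exact: bddD.
have bt : bdd (fun w => fn (C^T *m x j w) ^+ 2 + fn (E^T *m x j w) ^+ 2 + beta (X w) j ^+ 2).
  exact: bddD.
apply: le_trans (_ : Ex (fun w => 3 * (fn (C^T *m x j w) ^+ 2 + fn (E^T *m x j w) ^+ 2 + beta (X w) j ^+ 2)) <= _).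
  apply: Ex_le; [exact: bddX|exact: bddZ|].
  apply: filterS h3 => w ->; rewrite /gam.
  move: (fn _) (fn _) (beta _ _) => a b c.
  have := sqr_ge0 (a - b); have := sqr_ge0 (a - c); have := sqr_ge0 (b - c).
  rewrite !expr2; lra.
rewrite ExZ// ExD// ExD//; lra.
Qed.

(** With (a + b)^4 <= 8 (a^4 + b^4) and (6 M + 3 t)^2 <= 72 M^2 + 18 t^2: 144 = 8 times 18, and 2304
    = 8 times 72 times 4, where 4 l^2 >= 1. The remaining factors come from [harm_bound] and
    [dev_bound]. *)
Definition gam4_quart := 2304 * M ^+ 2 + 144 * tau_const C0 c0 kX K1 ^+ 2 * (4 * ln (Kp + 1) + 2) ^+ 2
  + 8 * v ^+ 4 * (2 * ln (2 * C0) + 1) ^+ 2.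

Let l := ln (n%:R : R).
Let l_half : 2^-1 <= l. Proof. exact: ln_ge_half. Qed.

(** The regime p <= Kp n enters here: the harmonic sum up to the rank, at most p, is of order log
    n. *)
Lemma harm_bound : harm p <= (4 * ln (Kp + 1) + 2) * l.
Proof.
apply: le_trans (harm_ln R p) _; rewrite -[p.+1%:R]natr1.
have n1R : 1 <= n%:R :> R by rewrite ler1n.
have q0 : 0 < Kp + 1 by exact: ltr_wpDl.
have h : ln (p%:R + 1) <= ln (Kp + 1) + l.
  rewrite -lnM ?posrE// ler_ln ?posrE ?mulr_gt0// ?ltr_wpDl//.
  rewrite mulrDl mul1r lerD//.
have K0 : 0 <= ln (Kp + 1) by rewrite ln_ge0// lerDr.
have hp := mulr_ge0 K0 (_ : 0 <= l - 2^-1); move: h hp K0 l_half.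
by move: (ln (p%:R + 1)) (ln (Kp + 1)) l => a b e h hp b0 e0; have := hp; rewrite subr_ge0 => /(_ e0); lra.
Qed.

Lemma dev_bound : dev ^+ 2 <= v ^+ 2 * ((2 * ln (2 * C0) + 1) * l).
Proof.
have n1R : 1 <= n%:R :> R by rewrite ler1n.
have c1 : 1 <= 2 * C0 by have := C01; lra.
have l0 : 0 <= ln (2 * C0) by rewrite ln_ge0.
have c2 : 0 < 2 * C0 by exact: lt_le_trans c1.
rewrite /dev exprMn [X in _ * X]sqr_sqrtr; last first.
  rewrite ln_ge0//; nra.
rewrite ler_wpM2l ?sqr_ge0// lnM ?posrE//.
have := l_half; rewrite /l; nra.
Qed.

Lemma typical_sum : \sum_j (typ j + dev) ^+ 4 <= gam4_quart * (n%:R * l ^+ 2).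
Proof.
have dev0 : 0 <= dev by rewrite mulr_ge0 ?sqrtr_ge0// ltW.
have H j : (typ j + dev) ^+ 4 <= 8 * (72 * M ^+ 2 + dev ^+ 4) + 144 * t_ j ^+ 2.
  have st : typ j ^+ 2 = 6 * M + 3 * t_ j.
    by rewrite [LHS]sqr_sqrtr// addr_ge0// mulr_ge0// t_ge0.
  have : (typ j + dev) ^+ 4 <= 8 * ((typ j ^+ 2) ^+ 2 + dev ^+ 4).
    move: (typ j) => a; have h1 : (a + dev) ^+ 2 <= 2 * (a ^+ 2 + dev ^+ 2).
      by have := sqr_ge0 (a - dev); rewrite !expr2; lra.
    rewrite (exprM _ 2 2); apply: le_trans (_ : (2 * (a ^+ 2 + dev ^+ 2)) ^+ 2 <= _).
      by rewrite ler_sqr ?nnegrE ?sqr_ge0// mulr_ge0// addr_ge0 ?sqr_ge0.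
    rewrite (exprM dev 2 2); move: (a ^+ 2) (dev ^+ 2) => b e.
    have := sqr_ge0 (b - e); rewrite !expr2; lra.
  rewrite st; have := sqr_ge0 (6 * M - 3 * t_ j); move: (t_ j) (M) (dev ^+ 4) ((typ j + dev) ^+ 4) => a b c e.
  rewrite !expr2; lra.
apply: le_trans (ler_sum _ (fun j _ => H j)) _.
rewrite big_split /= sumr_const card_ord -[_ *+ n]mulr_natl -mulr_sumr.
have h1 := avg_mom_sum C00 c00 kX0 K10 n0 conc X_random X_op X_indep X_mean.
have h2 : harm p ^+ 2 <= ((4 * ln (Kp + 1) + 2) * l) ^+ 2 :> R.
  rewrite ler_sqr ?nnegrE ?harm_ge0//; first exact: harm_bound.
  exact: le_trans (harm_ge0 p) harm_bound.
have h3 : dev ^+ 4 <= (v ^+ 2 * ((2 * ln (2 * C0) + 1) * l)) ^+ 2.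
  rewrite (exprM dev 2 2) ler_sqr ?nnegrE ?sqr_ge0//; first exact: dev_bound.
  exact: le_trans (sqr_ge0 _) dev_bound.
have h4 : 1 <= 4 * l ^+ 2 by have := l_half; rewrite !expr2; nra.
move: h1 h2 h3 h4; rewrite /gam4_quart -/avg.
set Sg := \sum_j _.
move: (4 * ln (Kp + 1) + 2) (2 * ln (2 * C0) + 1) (tau_const _ _ _ _) (v) (M) l (harm p) (dev) Sg (n%:R : R) nR0.
move=> a b tc u m ell h de S N N0 h1 h2 h3 h4.
have e1 : 144 * S <= 144 * tc ^+ 2 * a ^+ 2 * (N * ell ^+ 2).
  have -> : 144 * tc ^+ 2 * a ^+ 2 * (N * ell ^+ 2) = 144 * (tc ^+ 2 * N * (a * ell) ^+ 2) by ring.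
  rewrite ler_wpM2l//; apply: le_trans h1 _; rewrite ler_wpM2l//.
  by apply: mulr_ge0; [exact: sqr_ge0|exact: ltW].
have e2 : N * (8 * (72 * m ^+ 2 + de ^+ 4)) <= N * (576 * (m ^+ 2 * (4 * ell ^+ 2)) + 8 * (u ^+ 2 * (b * ell)) ^+ 2).
  rewrite ler_wpM2l ?(ltW N0)//.
  have : m ^+ 2 <= m ^+ 2 * (4 * ell ^+ 2) by rewrite ler_peMr ?sqr_ge0.
  move: h3; lra.
apply: le_trans (lerD e2 e1) _; rewrite le_eqVlt; apply/orP; left; apply/eqP; ring.
Qed.

(** The first term bounds the median of [gam4] in units of root4(n l^2), the second the passage from
    median to mean; the factor 2 is there because this unit is at least 1/2. *)
Definition gam4_const := root4 gam4_quart + 2 * v * (1 + 2 * C0).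

Lemma gam4_quart_ge0 : 0 <= gam4_quart.
Proof.
rewrite /gam4_quart; move: (M) (v) (tau_const _ _ _ _) (ln _) (ln _) => a b c e f.
apply: addr_ge0; first apply: addr_ge0.
- by apply: mulr_ge0; [exact: ler0n|exact: sqr_ge0].
- by apply: mulr_ge0; [apply: mulr_ge0; [exact: ler0n|exact: sqr_ge0]|exact: sqr_ge0].
- apply: mulr_ge0; last exact: sqr_ge0.
  by apply: mulr_ge0; [exact: ler0n|rewrite exprn_even_ge0].
Qed.

Lemma gam4_const_gt0 : 0 < gam4_const.
Proof.
rewrite /gam4_const ltr_wpDl ?root4_ge0// mulr_gt0 ?mulr_gt0//.
by rewrite addr_gt0// mulr_gt0.
Qed.

(** With probability at least 1/2 every gamma_j stays below typ j + dev, which bounds the median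
    through [typical_sum]. Beyond twice the bound on the mean, W exceeds the mean by W / 2, whence
    the exponent. *)
Lemma gam4_tail : exists h : T -> R,
  [/\ measurable_fun setT h, {ae P, forall w, h w = gam4 C E (X w)} &
   forall W, 2 * gam4_const * root4 (n%:R * l ^+ 2) <= W ->
     Pr [set w | W <= h w] <= C0 * expR (- (W / (2 * v)) ^+ 2)].
Proof.
have [||h [h1 h2 h3]] := conc_X (kX := kX) conc X_op (g := gam4 C E) gl0 bnd0.
- by move=> X1 X2 o1 o2; exact: gam4_lipschitz.
- move=> X1 o1; have := gam4_lipschitz (X' := 0) n0 kX0 C1 E1 o1 (opb0 p snk).
  rewrite gam4_0 !subr0 => /le_trans; apply; rewrite ler_wpM2l ?(ltW gl0)//.
  exact: fn_opb.
case: (h1) => -[mh _] _; exists h; split => //.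
pose N := root4 (n%:R * l ^+ 2).
have nl : 2^-1 <= n%:R * l ^+ 2.
  have : 2 <= n%:R :> R by rewrite ler_nat.
  have : 4^-1 <= l ^+ 2 by have := l_half; rewrite expr2; nra.
  nra.
have N_half : 2^-1 <= N.
  apply: le_of_pow4; first exact: root4_ge0.
  rewrite root4K; last by apply: le_trans nl; rewrite invr_ge0.
  by apply: le_trans nl; rewrite !exprS expr0; lra.
have medK : Pr [set w | root4 gam4_quart * N < h w] <= 2^-1.
  pose hp j := sval (cid2 (gam_proxy j)).
  have hp1 j : subg C0 v (hp j) /\ Ex (hp j) <= typ j by rewrite /hp; case: cid2.
  have hp2 : {ae P, forall w, forall j, hp j w = gam C E (X w) j}.
    have : forall j, {ae P, forall w, hp j w = gam C E (X w) j} by move=> j; rewrite /hp; case: cid2.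
    exact: filter_forall.
  have C2 : 1 < 2 * C0 * n%:R.
    have : 1 < n%:R :> R by rewrite ltr1n.
    have := C01; nra.
  have dev0 : 0 < dev by rewrite mulr_gt0// sqrtr_gt0 ln_gt0.
  have mj j : measurable [set w | typ j + dev <= hp j w].
    by apply: measurable_le_set; case: (hp1 j) => -[[]].
  have mE : measurable [set w | exists j, typ j + dev <= hp j w].
    rewrite (_ : [set w | _] = \bigcup_j [set w | typ j + dev <= hp j w]).
      by apply: fin_bigcup_measurable.
    by apply/seteqP; split => w /= [j]; [exists j|move=> _; exists j].
  apply: le_trans (_ : Pr [set w | exists j, typ j + dev <= hp j w] <= _).
    apply: Pr_ae_le => //; first exact: measurable_ltr_set.
    apply: filterS2 hp2 h3 => w e1 e2 /=; rewrite e2 => hw.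
    apply: contrapT => hn; move: hw; apply/negP; rewrite -leNgt.
    apply: le_of_pow4; first by rewrite mulr_ge0 ?root4_ge0.
    rewrite /gam4 root4K ?sum4_ge0// exprMn root4K ?gam4_quart_ge0// /N root4K; last first.
      by apply: le_trans nl; rewrite invr_ge0.
    apply: le_trans typical_sum; apply: ler_sum => j _.
    rewrite lerXn2r ?nnegrE ?gam_ge0//; first by rewrite addr_ge0 ?sqrtr_ge0// ltW.
    by rewrite leNgt; apply/negP => hl; apply: hn; exists j; rewrite e1 ltW.
  apply: le_trans (Pr_bigU P mj) _.
  apply: le_trans (_ : \sum_(j < n) C0 * expR (- (dev / v) ^+ 2) <= _).
    by apply: ler_sum => j _; have [s1 s2] := hp1 j; exact: subg_tail.
  rewrite /dev mulrAC divff ?gt_eqF// mul1r sqr_sqrtr; last by rewrite ltW// ln_gt0.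
  rewrite expRN lnK ?posrE; last exact: lt_trans C2.
  rewrite sumr_const card_ord -mulr_natl le_eqVlt; apply/orP; left; apply/eqP.
  by field; rewrite !gt_eqF.
have meanK := subg_median C00 v0 h1 medK.
have vN : v * (1 + 2 * C0) <= 2 * v * (1 + 2 * C0) * N.
  have : 0 < v * (1 + 2 * C0) by rewrite mulr_gt0// addr_gt0// mulr_gt0.
  rewrite (_ : 2 * v * (1 + 2 * C0) = 2 * (v * (1 + 2 * C0))); last by rewrite !mulrA.
  by have := N_half; move: (v * (1 + 2 * C0)) (N : R) => a N' hN a0; nra.
move=> W hW; have W2 : Ex h <= W / 2.
  apply: le_trans meanK _; rewrite ler_pdivlMr//; apply: le_trans hW.
  rewrite -/N /gam4_const; move: vN; lra.
have W0 : 0 < W / 2.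
  rewrite divr_gt0//; apply: lt_le_trans hW; rewrite mulr_gt0 ?mulr_gt0 ?gam4_const_gt0//.
  exact: lt_le_trans N_half.
have := subg_tail h1 W2 W0; rewrite -splitr.
by rewrite -mulrA -invfM.
Qed.

End gamma_tail.

(** * Measurability of the resolvent *)

Section measurable_matrices.
Context {d : measure_display} {T : measurableType d} {R : realType}.

(** 1 / g = g (g^2)^(-1) reduces inversion to a real power of a nonnegative variable; both sides are
    0 where g vanishes. *)
Lemma measurable_invr (g : T -> R) : measurable_fun setT g ->
  measurable_fun setT (fun w => (g w)^-1).
Proof.
move=> mg; have -> : (fun w => (g w)^-1) = (fun w => g w * (g w ^+ 2) `^ (- 1)).
  apply/funext => w; rewrite powR_inv1 ?sqr_ge0//.
  have [->|g0] := eqVneq (g w) 0; first by rewrite invr0 mul0r.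
  by field.
apply: measurable_funM => //.
exact: measurableT_comp (measurable_powR (- 1)) (measurable_funX 2 mg).
Qed.

Lemma random_det q (A : T -> 'M[R]_q) : random_mx A ->
  measurable_fun setT (fun w => \det (A w)).
Proof.
move=> mA; apply: measurable_sum => s; apply: measurable_funM => //.
by apply: measurable_prod => i _; exact: mA.
Qed.

(* The second summand accounts for the junk value [invmx A = A] of singular
   matrices. *)
Lemma invmx_entry q (A : 'M[R]_q) i j :
  invmx A i j = (\det A)^-1 * (\adj A) i j + (1 - \det A * (\det A)^-1) * A i j.
Proof.
rewrite /invmx unitmxE unitfE; have [->|dA] := eqVneq (\det A) 0.
  by rewrite /= invr0 !mul0r subr0 mul1r add0r.
by rewrite /= mxE divff// subrr mul0r addr0.
Qed.

Lemma random_invmx q (A : T -> 'M[R]_q) : random_mx A ->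
  random_mx (fun w => invmx (A w)).
Proof.
move=> mA i j; under eq_fun do rewrite invmx_entry.
have md := random_det mA; have mi := measurable_invr md.
apply: measurable_funD; apply: measurable_funM => //.
  under eq_fun do rewrite mxE; apply: measurable_funM => //.
  by apply: random_det => a b; under eq_fun do rewrite !mxE; exact: mA.
by apply: measurable_funB => //; exact: measurable_funM.
Qed.

Lemma random_resolvent p n (X : T -> 'M[R]_(p, n)) (D : T -> 'M[R]_n) :
  random_mx X -> random_mx D -> random_mx (fun w => resolvent (X w) (D w)).
Proof.
move=> mX mD; apply: random_invmx => i j; under eq_fun do rewrite !mxE.
apply: measurable_funB => //; apply: measurable_funM => //.
apply: measurable_sum => k; apply: measurable_funM.
  under eq_fun do rewrite mxE; apply: measurable_sum => l; exact: measurable_funM.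
by under eq_fun do rewrite mxE; exact: mX.
Qed.

End measurable_matrices.

(** Passes from bounds that may vary with (p, n) to the uniform K and k. *)
Lemma loo_const_le (R : realType) (kX kD eps K k : R) :
  0 < kX -> 0 < kD -> 0 < k -> kX <= K -> kD <= K -> k <= eps ->
  loo_const kX kD eps <= loo_const K K k.
Proof.
move=> kX0 kD0 k0 hX hD he; have eps0 : 0 < eps by exact: lt_le_trans he.
have ie : eps^-1 <= k^-1 by rewrite lef_pV2.
have X2 : kX ^+ 2 <= K ^+ 2 by rewrite ler_sqr ?nnegrE ?(ltW kX0)// (le_trans (ltW kX0)).
have := ltW kX0; have := ltW kD0 => D0 X0.
have i0 : 0 <= eps^-1 by rewrite invr_ge0 ltW.
rewrite /loo_const; apply: ler_pM.
- by rewrite addr_ge0// mulr_ge0// mulr_ge0// sqr_ge0.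
- by rewrite addr_ge0// mulr_ge0// mulr_ge0.
- rewrite lerD2l; apply: ler_pM => //; first by rewrite mulr_ge0// sqr_ge0.
  by apply: ler_pM => //; exact: sqr_ge0.
- rewrite lerD2l; apply: ler_pM => //; first by rewrite mulr_ge0.
  by apply: ler_pM.
Qed.

(** * Deviation of a linear functional at a given level *)

Section resolvent_concentration.
Context {d : measure_display} {T : measurableType d} {R : realType}
  (P : probability T R).
Local Notation fn := (@frobenius_norm R _ _).
Local Notation Ex := (Ex P).
Local Notation Pr := (Pr P).
Local Notation bdd := (bdd P).
Local Notation subg := (subg P).
Variables (p n : nat) (X : T -> 'M[R]_(p, n)) (D : T -> 'M[R]_n)
  (C0 c0 kX kD eps K k K1 Kp : R).
Local Notation sn := (Num.sqrt (n%:R : R)).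
Hypotheses (C01 : 1 <= C0) (c00 : 0 < c0) (K10 : 0 <= K1) (n1 : (1 < n)%N)
  (Kp0 : 0 <= Kp) (pn : p%:R <= Kp * n%:R).
Hypotheses (kX0 : 0 < kX) (kD0 : 0 < kD) (k0 : 0 < k) (kXK : kX <= K) (kDK : kD <= K)
  (keps : k <= eps) (kk : kX ^+ 2 * kD <= 1 - eps).
Hypothesis conc : forall f : 'M[R]_(p, n) -> 'M[R]_n -> R, lipschitz1_mx_diag f ->
  let g := fun w => f (X w) (D w) in
  P.-integrable setT (EFin \o g) /\
  forall t : R, 0 < t ->
    (P [set w | (t <= `|g w - fine 'E_P[g]|)%R] <= (C0 * expR (- (t / c0) ^+ 2))%:E)%E.
Hypotheses (X_random : random_mx X) (D_random : random_mx D)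
  (D_diag : forall w, is_diag_mx (D w)).
Hypothesis X_op : {ae P, forall w, opb (X w) (sn * kX)}.
Hypothesis D_op : {ae P, forall w, opb (D w) kD}.
Hypothesis X_indep : mutually_independent_mx P (fun (i : 'I_n) w => col i (X w)).
Hypothesis X_mean : forall i, fn (expectation_mx P (fun w => col i (X w))) <= K1.

Variable f : {scalar 'M[R]_p}.
Hypothesis f_spec : forall A, `|f A| <= spectral_norm A.

Let eps0 : 0 < eps. Proof. exact: lt_le_trans keps. Qed.
Let K0 : 0 < K. Proof. exact: lt_le_trans kXK. Qed.
Let C00 : 0 < C0. Proof. exact: lt_le_trans C01. Qed.
Let n0 : (0 < n)%N. Proof. exact: ltnW. Qed.
Let nR0 : 0 < n%:R :> R. Proof. by rewrite ltr0n. Qed.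
Let sn0 : 0 < sn. Proof. by rewrite sqrtr_gt0. Qed.

Definition res_functional w := f (resolvent (X w) (D w)).
Local Notation F := res_functional.

Lemma adm_ae : {ae P, forall w, adm kX kD (X w) (D w)}.
Proof. by move: X_op D_op; apply: filterS2 => w a b; split. Qed.

Lemma res_functionalE w : F w = \sum_i \sum_j f (delta_mx i j) * resolvent (X w) (D w) i j.
Proof.
rewrite /F [in LHS](matrix_sum_delta (resolvent (X w) (D w))) linear_sum; apply: eq_bigr => i _.
by rewrite linear_sum; apply: eq_bigr => j _; rewrite linearZ /= mulrC.
Qed.

Lemma bdd_res_entry i j : bdd (fun w => resolvent (X w) (D w) i j).
Proof.
split; first exact: random_resolvent.
exists eps^-1; apply: filterS adm_ae => w h; apply: opb_entry.
exact (res_opb n0 kX0 kD0 eps0 kk h).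
Qed.

Lemma bdd_res_functional : bdd F.
Proof.
have -> : F = fun w => \sum_i \sum_j f (delta_mx i j) * resolvent (X w) (D w) i j.
  by apply/funext => w; exact: res_functionalE.
by apply: bdd_sum => i; apply: bdd_sum => j; apply: bddZ; exact: bdd_res_entry.
Qed.

(** The centre of f(Q) is thus the value of [f] at a matrix that does not depend on [f]. *)
Lemma Ex_res_functional :
  Ex F = f (expectation_mx P (fun w => resolvent (X w) (D w))).
Proof.
have -> : F = fun w => \sum_i \sum_j f (delta_mx i j) * resolvent (X w) (D w) i j.
  by apply/funext => w; exact: res_functionalE.
have b i j := bdd_res_entry i j.
rewrite Ex_sum; last by move=> i; apply: bdd_sum => j; exact: bddZ.
rewrite [in RHS](matrix_sum_delta (expectation_mx _ _)) linear_sum; apply: eq_bigr => i _.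
rewrite Ex_sum; last by move=> j; exact: bddZ.
rewrite linear_sum; apply: eq_bigr => j _; rewrite linearZ /= ExZ// mulrC.
by congr (_ * _); rewrite mxE unlock.
Qed.

Local Notation v := (c0 * gam_lip K).
Local Notation B := (gam4_const C0 c0 K K1 Kp).
Let l := ln (n%:R : R).
Let l_half : 2^-1 <= l. Proof. exact: ln_ge_half. Qed.
(** The lowest level to which [gam4_tail] applies. *)
Let W0 := 2 * B * root4 (n%:R * l ^+ 2).

(** From W0 on, W^2 >= 2 B^2 sqrt(n), so the n^-1/2 term of [res_lip] is absorbed into W^2 / n. *)
Definition res_lip_const := 2 * (K * K / k ^+ 2) / (2 * B ^+ 2) + loo_const K K k ^+ 2.

Let B0 : 0 < B. Proof. exact: gam4_const_gt0. Qed.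
Let v0 : 0 < v. Proof. by rewrite mulr_gt0// addr_gt0// mulr_gt0. Qed.

Lemma W0_sqr : W0 ^+ 2 = 4 * B ^+ 2 * (sn * l).
Proof.
have l0 : 0 <= l by apply: le_trans l_half; rewrite invr_ge0.
rewrite /W0 exprMn; congr (_ * _); first by rewrite exprMn expr2 -natrM.
by rewrite [LHS]sqr_sqrtr ?sqrtr_ge0// sqrtrM ?ler0n// sqrtr_sqr ger0_norm.
Qed.

Lemma W0_gt0 : 0 < W0.
Proof.
rewrite lt_neqAle eq_sym; apply/andP; split; last first.
  by apply: mulr_ge0; [rewrite mulr_ge0// ltW|exact: root4_ge0].
have l0 : 0 < l by apply: lt_le_trans l_half; rewrite invr_gt0.
by rewrite -sqrf_eq0 W0_sqr gt_eqF// mulr_gt0 ?mulr_gt0 ?exprn_gt0.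
Qed.

Lemma W0_sqr_ge : 2 * B ^+ 2 * sn <= W0 ^+ 2.
Proof.
rewrite W0_sqr; have := l_half; have : 0 <= B ^+ 2 * sn by rewrite mulr_ge0 ?sqr_ge0 ?ltW.
move: (B ^+ 2) (sn) l => a b e h1 h2; nra.
Qed.

Let A1_ge0 : 0 <= 2 * (K * K / k ^+ 2).
Proof. by rewrite mulr_ge0// divr_ge0 ?sqr_ge0// mulr_ge0// ltW. Qed.

Lemma res_lip_const_gt0 : 0 < res_lip_const.
Proof.
apply: ltr_wpDl; last first.
  by rewrite exprn_gt0// (lt_le_trans ltr01)//; apply: loo_const_ge1.
apply: divr_ge0; first exact: A1_ge0.
by apply: mulr_ge0 => //; exact: sqr_ge0.
Qed.

Lemma res_lip_le W : W0 <= W -> res_lip n kX kD eps W <= res_lip_const * (W ^+ 2 / n%:R).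
Proof.
move=> hW; have hW2 : 2 * B ^+ 2 * sn <= W ^+ 2.
  apply: le_trans W0_sqr_ge _; rewrite ler_sqr ?nnegrE ?(ltW W0_gt0)//.
  exact: le_trans (ltW W0_gt0) hW.
have -> : res_lip_const * (W ^+ 2 / n%:R) =
    2 * (K * K / k ^+ 2) / (2 * B ^+ 2) * (W ^+ 2 / n%:R) + loo_const K K k ^+ 2 * (W ^+ 2 / n%:R).
  by rewrite -mulrDl.
apply: lerD.
  have B20 : 0 < 2 * B ^+ 2 by rewrite mulr_gt0 ?exprn_gt0.
  apply: le_trans (_ : 2 * (K * K / k ^+ 2) / sn <= _).
    rewrite ler_wpM2r ?invr_ge0 ?sqrtr_ge0// ler_wpM2l// ler_pM ?mulr_ge0 ?invr_ge0 ?sqr_ge0 ?(ltW kX0) ?(ltW kD0)//.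
      by rewrite ler_pM ?(ltW kX0) ?(ltW kD0).
    by rewrite lef_pV2 ?posrE ?exprn_gt0// ler_sqr ?nnegrE ?(ltW k0) ?(ltW eps0).
  rewrite -[leRHS]mulrA ler_wpM2l//.
  move: hW2 B20; move: (2 * B ^+ 2) => q hW2 q0.
  have -> : sn^-1 = q^-1 * (q * sn / n%:R).
    rewrite -mulrA mulKf ?gt_eqF// -[X in _ / X](sqr_sqrtr (ltW nR0)) expr2 invfM mulrA divff ?gt_eqF//.
    by rewrite mul1r.
  by rewrite ler_wpM2l ?invr_ge0 ?(ltW q0)// ler_wpM2r ?invr_ge0 ?(ltW nR0).
rewrite /res_lip -mulrA ler_wpM2r ?divr_ge0 ?sqr_ge0 ?ler0n//.
have h1 : 1 <= loo_const kX kD eps by exact: loo_const_ge1.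
rewrite ler_sqr ?nnegrE; first exact: loo_const_le.
- exact: le_trans h1.
- by apply: le_trans (le_trans h1 _); last exact: loo_const_le.
Qed.

Definition gam_tail_at W := C0 * expR (- (W / (2 * v)) ^+ 2).

(** Both f(Q) and its extension are bounded by 1 / k and differ only where gamma exceeds the level,
    so their means differ by at most 2 / k times that probability. This takes at most half of t; the
    other half is a deviation of the extension. *)
Lemma res_tail_at W t : W0 <= W -> 0 < t -> 2 / k * gam_tail_at W <= t / 2 ->
  Pr [set w | t <= `|F w - Ex F|] <=
    gam_tail_at W + C0 * expR (- (t * n%:R / (2 * c0 * res_lip_const * W ^+ 2)) ^+ 2).
Proof.
move=> hW t0 bias.
have [r [Cm [Em [C1 E1 fE]]]] := spectral_form_factor f_spec.
have W00 : 0 < W by exact: lt_le_trans W0_gt0 hW.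
(* The tail of [gam4] is taken with K in place of kX, for its constants to be uniform in (p, n). *)
have snK : sn * kX <= sn * K by rewrite ler_wpM2l ?sqrtr_ge0.
have X_opK : {ae P, forall w, opb (X w) (sn * K)}.
  by apply: filterS X_op => w; exact: opb_le.
have [h4 [m4 e4 t4]] := gam4_tail C01 c00 K0 K10 n1 Kp0 pn conc X_random X_opK X_indep X_mean C1 E1.
pose A (Y : 'M[R]_(p, n)) (Dl : 'M[R]_n) := adm kX kD Y Dl /\ sum4 Cm Em Y <= W ^+ 4.
pose g (Y : 'M[R]_(p, n)) (Dl : 'M[R]_n) := f (resolvent Y Dl).
pose L := res_lip_const * (W ^+ 2 / n%:R).
have L0 : 0 < L by rewrite mulr_gt0 ?res_lip_const_gt0// divr_gt0// exprn_gt0.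
have k00 : 0 <= k^-1 by rewrite invr_ge0 ltW.
have epsk : eps^-1 <= k^-1 by rewrite lef_pV2.
have fb (Y : 'M[R]_(p, n)) (Dl : 'M[R]_n) : adm kX kD Y Dl -> `|f (resolvent Y Dl)| <= k^-1.
  move=> a1; apply: le_trans (f_spec _) _; apply: opb_spectral => //.
  by apply: opb_le epsk _; exact (res_opb n0 kX0 kD0 eps0 kk a1).
have [||h [h1 h2 h3]] := conc_ext conc (A := A) (g := g) L0 k00.
- move=> X1 D1 X2 D2 [a1 s1] [a2 s2]; rewrite /g.
  apply: le_trans (res_lipschitz n0 kX0 kD0 eps0 kk C1 E1 f_spec fE a1 a2 (ltW W00) s1 s2) _.
  by rewrite ler_wpM2r ?sqrtr_ge0//; exact: res_lip_le.
- by move=> Y Dl [a1 _]; exact: fb.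
have [[mh _] htail] := h1; have bh : bdd h by case: h1.
have mF : measurable_fun setT F by case: bdd_res_functional.
have mbad : measurable [set w | W <= h4 w] by exact: measurable_le_set.
have good : {ae P, forall w, ~ (W <= h4 w) -> h w = F w}.
  move: adm_ae e4; apply: filterS2 => w a1 e /negP; rewrite -ltNge e => hlt.
  apply: h3; split => //; rewrite -[leLHS](root4K (sum4_ge0 _ _ _)).
  by rewrite lerXn2r ?nnegrE ?root4_ge0 ?(ltW W00)//; exact: ltW.
have small : Pr [set w | W <= h4 w] <= gam_tail_at W by exact: t4.
have close : `|Ex F - Ex h| <= t / 2.
  rewrite -ExB//; last exact: bdd_res_functional.
  apply: le_trans (Ex_norm _) _; first by apply: bddB => //; exact: bdd_res_functional.
  apply: le_trans (_ : Ex (fun w => 2 / k * \1_[set w | W <= h4 w] w) <= _).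
    apply: Ex_le; first by apply: bdd_norm; apply: bddB => //; exact: bdd_res_functional.
      by apply: bddZ; exact: bdd_ind.
    move: good adm_ae; apply: filterS2 => w e a1.
    have [hw|hw] := pselect (W <= h4 w).
      rewrite indicE mem_set// mulr1; apply: le_trans (ler_normB _ _) _.
      by have := fb _ _ a1; have := h2 w; rewrite /F; lra.
    by rewrite (e hw) subrr normr0 mulr_ge0 ?divr_ge0 ?(ltW k0).
  rewrite ExZ; last exact: bdd_ind.
  rewrite Ex_ind//; apply: le_trans bias; rewrite ler_wpM2l// divr_ge0// ltW//.
have t2 : 0 < t / 2 by exact: divr_gt0.
have md : measurable [set w | t / 2 <= `|h w - Ex h|].
  by apply: measurable_le_set; apply: measurableT_comp => //; exact: measurable_funB.
apply: le_trans (_ : Pr ([set w | W <= h4 w] `|` [set w | t / 2 <= `|h w - Ex h|]) <= _).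
  apply: Pr_ae_le.
  - by apply: measurable_le_set; apply: measurableT_comp => //; exact: measurable_funB.
  - exact: measurableU.
  apply: filterS good => w e /= ht; have [hw|hw] := pselect (W <= h4 w); [by left|right].
  rewrite (e hw); have := ler_normD (F w - Ex h) (Ex h - Ex F).
  rewrite addrA subrK => hh; have := close; rewrite distrC; lra.
apply: le_trans (PrU _ mbad md) _; apply: lerD => //.
apply: le_trans (htail _ t2) _; rewrite le_eqVlt; apply/orP; left; apply/eqP.
congr (_ * expR (- _ ^+ 2)); rewrite /L.
have := res_lip_const_gt0 => q0.
by field; rewrite !gt_eqF// mulr_gt0.
Qed.

End resolvent_concentration.

(** * Choice of the level as a function of the deviation *)

Section choice_of_level.
Context {R : realType}.
Variables (n : nat) (C0 c0 k v B q W0 : R) (pr : R -> R).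
Local Notation sn := (Num.sqrt (n%:R : R)).
Let l := ln (n%:R : R).
Hypotheses (n1 : (1 < n)%N) (C00 : 0 < C0) (c00 : 0 < c0) (k0 : 0 < k) (v0 : 0 < v)
  (B0 : 0 < B) (q0 : 0 < q) (W00 : 0 < W0) (W0E : W0 ^+ 2 = 4 * B ^+ 2 * (sn * l)).
Hypothesis pr_le1 : forall t, pr t <= 1.
Hypothesis pr_at : forall W t, W0 <= W -> 0 < t ->
  2 / k * (C0 * expR (- (W / (2 * v)) ^+ 2)) <= t / 2 ->
  pr t <= C0 * expR (- (W / (2 * v)) ^+ 2) +
          C0 * expR (- (t * n%:R / (2 * c0 * q * W ^+ 2)) ^+ 2).

Let nR0 : 0 < n%:R :> R. Proof. by rewrite ltr0n ltnW. Qed.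
Let sn0 : 0 < sn. Proof. by rewrite sqrtr_gt0. Qed.
Let snn : sn * sn = n%:R. Proof. by rewrite -expr2 sqr_sqrtr// ltW. Qed.
Let sn1 : 1 <= sn. Proof. by rewrite -[leLHS]sqrtr1 ler_wsqrtr// ler1n ltnW. Qed.
Let l_half : 2^-1 <= l. Proof. exact: ln_ge_half. Qed.
Let l0 : 0 < l. Proof. by apply: lt_le_trans l_half; rewrite invr_gt0. Qed.
Let B20 : 0 < B ^+ 2. Proof. exact: exprn_gt0. Qed.
Let v20 : 0 < v ^+ 2. Proof. exact: exprn_gt0. Qed.

(** From exp(-y) <= 1 / y with y = B^2 sqrt(n) / (2 v^2): the bias at any level W >= W0 is at most
    small_dev / (2 sqrt(n)). *)
Definition small_dev := 8 * C0 * v ^+ 2 / (k * B ^+ 2).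
(** 2 c0 q W^2 at W = W0, divided by sqrt(n) log n. *)
Definition gauss_scale := 8 * c0 * q * B ^+ 2.
(** Dominates the scales of both exponents at W^2 = sqrt(t n): the tail of [gam4] and the deviation
    of the extension. *)
Definition sqrt_scale := 4 * v ^+ 2 + 2 * c0 ^+ 2 * q ^+ 2 / B ^+ 2.

Lemma small_dev_gt0 : 0 < small_dev.
Proof. by rewrite divr_gt0// mulr_gt0// mulr_gt0. Qed.

Lemma gauss_scale_gt0 : 0 < gauss_scale.
Proof. by rewrite mulr_gt0// mulr_gt0// mulr_gt0. Qed.

Lemma sqrt_scale_gt0 : 0 < sqrt_scale.
Proof.
rewrite addr_gt0 ?mulr_gt0 ?invr_gt0 ?exprn_gt0//.
Qed.

Lemma W0_big : 2 * B ^+ 2 * sn <= W0 ^+ 2.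
Proof.
rewrite W0E; have h : 0 < B ^+ 2 * sn by rewrite mulr_gt0.
have -> : 4 * B ^+ 2 * (sn * l) = 4 * (B ^+ 2 * sn * l) by rewrite !mulrA.
rewrite -[leLHS]mulrA; move: l_half h.
by move: (B ^+ 2 * sn) (l : R) => a b h1 h2; nra.
Qed.

(* The level is W0 as long as root4 (t n) <= W0, which gives the Gaussian term;
   beyond, W = root4 (t n) balances the two exponents. *)
Lemma pr_large t : small_dev / sn <= t ->
  pr t <= 2 * C0 * (expR (- (t * sn / (gauss_scale * l)) ^+ 2) +
                    expR (- (Num.sqrt (t * n%:R) / sqrt_scale))).
Proof.
move=> ht; have t0 : 0 < t by apply: lt_le_trans ht; rewrite divr_gt0// small_dev_gt0.
pose s := Num.sqrt (t * n%:R); have s0 : 0 < s by rewrite sqrtr_gt0 mulr_gt0.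
have s2 : s ^+ 2 = t * n%:R by rewrite sqr_sqrtr// ltW// mulr_gt0.
have c20 := sqrt_scale_gt0.
pose W := Num.max W0 (Num.sqrt s).
have W0W : W0 <= W by rewrite le_max lexx.
have Wp : 0 < W by exact: lt_le_trans W0W.
have W0W2 : W0 ^+ 2 <= W ^+ 2 by rewrite ler_sqr ?nnegrE ?(ltW W00) ?(ltW Wp).
have sW : s <= W ^+ 2.
  rewrite -[leLHS](sqr_sqrtr (ltW s0)) ler_sqr ?nnegrE ?sqrtr_ge0 ?(ltW Wp)//.
  by rewrite le_max lexx orbT.
have WvE : (W / (2 * v)) ^+ 2 = W ^+ 2 / (4 * v ^+ 2).
  by rewrite expr_div_n exprMn -natrX.
have bias : 2 / k * (C0 * expR (- (W / (2 * v)) ^+ 2)) <= t / 2.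
  have y0 : 0 < B ^+ 2 * sn / (2 * v ^+ 2) by rewrite divr_gt0 ?mulr_gt0.
  have le_y : B ^+ 2 * sn / (2 * v ^+ 2) <= (W / (2 * v)) ^+ 2.
    rewrite WvE; have -> : B ^+ 2 * sn / (2 * v ^+ 2) = 2 * B ^+ 2 * sn / (4 * v ^+ 2).
      by field; rewrite gt_eqF.
    rewrite ler_wpM2r ?invr_ge0 ?mulr_ge0 ?(ltW v0)//.
    exact: le_trans W0_big W0W2.
  have ex : expR (- (W / (2 * v)) ^+ 2) <= (B ^+ 2 * sn / (2 * v ^+ 2))^-1.
    rewrite expRN lef_pV2 ?posrE ?expR_gt0//.
    apply: le_trans le_y _; apply: le_trans (expR_ge1Dx _); rewrite lerDr//.
  apply: le_trans (_ : 2 / k * (C0 * (B ^+ 2 * sn / (2 * v ^+ 2))^-1) <= _).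
    by rewrite ler_wpM2l ?divr_ge0 ?(ltW k0)// ler_wpM2l// ltW.
  have -> : 2 / k * (C0 * (B ^+ 2 * sn / (2 * v ^+ 2))^-1) = small_dev / sn / 2.
    by rewrite /small_dev; field; rewrite !gt_eqF.
  by rewrite ler_wpM2r.
apply: le_trans (pr_at W0W t0 bias) _.
have T1 : expR (- (W / (2 * v)) ^+ 2) <= expR (- (s / sqrt_scale)).
  rewrite ler_expR lerN2 WvE; apply: ler_pM; rewrite ?invr_ge0 ?(ltW s0) ?(ltW c20)//.
  rewrite lef_pV2 ?posrE ?mulr_gt0//.
  by rewrite /sqrt_scale lerDl; apply: ltW; rewrite divr_gt0 ?mulr_gt0 ?exprn_gt0.
have T2 : expR (- (t * n%:R / (2 * c0 * q * W ^+ 2)) ^+ 2) <=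
    expR (- (t * sn / (gauss_scale * l)) ^+ 2) + expR (- (s / sqrt_scale)).
  have [hs|hs] := leP (Num.sqrt s) W0.
    have -> : W ^+ 2 = 4 * B ^+ 2 * (sn * l) by rewrite /W max_l// W0E.
    have -> : t * n%:R / (2 * c0 * q * (4 * B ^+ 2 * (sn * l))) = t * sn / (gauss_scale * l).
      rewrite /gauss_scale; move: snn sn0; move: (sn) => u <- u0.
      by field; rewrite !gt_eqF.
    by rewrite lerDl expR_ge0.
  have WE : W ^+ 2 = s by rewrite /W max_r ?(ltW hs)// sqr_sqrtr// ltW.
  apply: ler_wpDl; first exact: expR_ge0.
  rewrite WE -s2 ler_expR lerN2.
  have -> : s ^+ 2 / (2 * c0 * q * s) = s / (2 * c0 * q).
    by field; rewrite !gt_eqF.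
  (* Turns the square (s / (2 c0 q))^2 into a multiple of s, the form of the other exponent. *)
  have sB : 2 * B ^+ 2 <= s.
    apply: le_trans (_ : W0 ^+ 2 <= _); last by rewrite -WE.
    apply: le_trans W0_big; rewrite ler_peMr// mulr_ge0 ?ltW//.
  apply: le_trans (_ : s / (2 * c0 ^+ 2 * q ^+ 2 / B ^+ 2) <= _).
    rewrite ler_wpM2l ?(ltW s0)// lef_pV2 ?posrE//.
      by rewrite /sqrt_scale lerDr mulr_ge0// ltW.
    by rewrite divr_gt0// mulr_gt0 ?exprn_gt0// mulr_gt0 ?exprn_gt0.
  have -> : s / (2 * c0 ^+ 2 * q ^+ 2 / B ^+ 2) = s * (2 * B ^+ 2) / (2 * c0 * q) ^+ 2.
    by field; rewrite !gt_eqF.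
  rewrite expr_div_n ler_wpM2r ?invr_ge0 ?sqr_ge0// expr2 ler_wpM2l// ltW//.
apply: le_trans (lerD (ler_wpM2l (ltW C00) T1) (ler_wpM2l (ltW C00) T2)) _.
rewrite -/s; have := mulr_ge0 (ltW C00) (expR_ge0 (- (t * sn / (gauss_scale * l)) ^+ 2)).
by move: (expR _) (expR _) => a b; lra.
Qed.

(** The factor 2 comes from l / 2 <= l^(3/2), the factors 4 from 1/4 <= l^(3/2). *)
Definition dev_scale := 2 * gauss_scale + 4 * sqrt_scale ^+ 2 + 4 * small_dev.
(** The summand [expR 1] covers t < small_dev / sqrt(n), where the Gaussian term is at least
    exp(-1). *)
Definition dev_factor := 2 * C0 + expR 1.

Lemma dev_scale_gt0 : 0 < dev_scale.
Proof.
have := small_dev_gt0; have := gauss_scale_gt0; have := sqr_ge0 sqrt_scale.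
rewrite /dev_scale; move: gauss_scale small_dev (sqrt_scale ^+ 2) => a b e; lra.
Qed.

Lemma dev_factor_gt0 : 0 < dev_factor.
Proof. by rewrite addr_gt0 ?mulr_gt0 ?expR_gt0. Qed.

(** [pr_large] has the scales log n / sqrt(n) and 1 / n; since log n >= 1/2, both are dominated by
    those with (log n)^(3/2). *)
Lemma pr_dev t : 0 < t ->
  pr t <= dev_factor * (expR (- (t / (dev_scale * (l `^ (3 / 2) / sn))) `^ 2) +
                        expR (- (t / (dev_scale * (l `^ (3 / 2) / n%:R))) `^ (1 / 2))).
Proof.
move=> t0; have d0 := dev_scale_gt0; set c := dev_scale in d0 *.
have g0 := gauss_scale_gt0; have h0 := small_dev_gt0; have c20 := sqrt_scale_gt0.
have sq0 := sqr_ge0 sqrt_scale.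
have cE : c = 2 * gauss_scale + 4 * sqrt_scale ^+ 2 + 4 * small_dev by [].
pose y := l `^ (3 / 2).
have yE : y = l * Num.sqrt l.
  rewrite /y (_ : 3 / 2 = 1 + 2^-1 :> R); last by field.
  rewrite powRD; last by rewrite gt_eqF// implybT.
  by rewrite powRr1 ?(ltW l0)// powR12_sqrt// ltW.
have sl : 2^-1 <= Num.sqrt l.
  apply: le_of_sqr; first exact: sqrtr_ge0.
  rewrite [leRHS]sqr_sqrtr ?(ltW l0)//; apply: le_trans l_half.
  by rewrite expr2; lra.
have y_l : l / 2 <= y by rewrite yE ler_wpM2l// ltW.
have y4 : 4^-1 <= y by apply: le_trans y_l; have := l_half; lra.
have y0 : 0 < y by apply: lt_le_trans y4; rewrite invr_gt0.
rewrite -/y.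
have -> : t / (c * (y / sn)) = t * sn / (c * y) by field; rewrite !gt_eqF.
have -> : t / (c * (y / n%:R)) = t * n%:R / (c * y) by field; rewrite !gt_eqF.
have cy0 : 0 < c * y by exact: mulr_gt0.
rewrite powR_mulrn; last by rewrite divr_ge0 ?mulr_ge0 ?(ltW t0) ?(ltW sn0) ?(ltW d0) ?(ltW y0).
rewrite div1r powR12_sqrt; last by rewrite divr_ge0 ?mulr_ge0 ?(ltW t0) ?(ltW d0) ?(ltW y0).
have [hs|hs] := leP (small_dev / sn) t; last first.
  apply: le_trans (pr_le1 t) _.
  have hx : (t * sn / (c * y)) ^+ 2 <= 1.
    rewrite exprn_ile1//; first by rewrite divr_ge0 ?mulr_ge0 ?(ltW t0) ?(ltW sn0) ?(ltW d0) ?(ltW y0).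
    rewrite ler_pdivrMr// mul1r; move: hs; rewrite ltr_pdivlMr// => /ltW/le_trans; apply.
    have : 4 * small_dev * 4^-1 <= c * y; last lra.
    apply: ler_pM => //; first by rewrite mulr_ge0// ltW.
    by rewrite cE; move: g0 sq0; lra.
  apply: le_trans (_ : expR 1 * expR (- (t * sn / (c * y)) ^+ 2) <= _).
    rewrite -expRD -[leLHS]expR0 ler_expR; lra.
  apply: ler_pM; rewrite ?expR_ge0//.
    by rewrite /dev_factor lerDr mulr_ge0// ltW.
  by rewrite lerDl expR_ge0.
apply: le_trans (pr_large hs) _; apply: ler_pM.
- by rewrite mulr_ge0// ltW.
- by rewrite addr_ge0 ?expR_ge0.
- by rewrite /dev_factor lerDl expR_ge0.
apply: lerD; rewrite ler_expR lerN2.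
  have gl0 : 0 < gauss_scale * l by exact: mulr_gt0.
  have tsn : 0 <= t * sn by rewrite mulr_ge0 ?ltW.
  rewrite ler_sqr ?nnegrE ?divr_ge0 ?(ltW cy0) ?(ltW gl0)//.
  rewrite ler_wpM2l// lef_pV2 ?posrE//.
  apply: le_trans (_ : (2 * gauss_scale) * (l / 2) <= _); first lra.
  apply: ler_pM => //; [by rewrite mulr_ge0// ltW|by rewrite divr_ge0// ltW|].
  by rewrite cE; move: h0 sq0; lra.
have tn0 : 0 <= t * n%:R by rewrite mulr_ge0 ?ltW.
rewrite sqrtrM// ler_wpM2l ?sqrtr_ge0// sqrtrV ?(ltW cy0)// lef_pV2 ?posrE ?sqrtr_gt0//.
apply: le_of_sqr; first exact: sqrtr_ge0.
rewrite [leRHS]sqr_sqrtr ?(ltW cy0)//.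
have : 4 * sqrt_scale ^+ 2 * 4^-1 <= c * y; last lra.
apply: ler_pM => //; first by rewrite mulr_ge0.
by rewrite cE; move: h0 g0; lra.
Qed.

End choice_of_level.

Theorem theorem8p1 (R : realType)
    (S : nat -> nat -> Prop)
    (d : nat -> nat -> measure_display)
    (T : forall p n : nat, measurableType (d p n))
    (P : forall p n : nat, probability (T p n) R)
    (X : forall p n : nat, T p n -> 'M[R]_(p, n))
    (D : forall p n : nat, T p n -> 'M[R]_n)
    (n_gt1 : forall p n, S p n -> (1 < n)%N)
    (regime : exists K : R, forall p n, S p n -> p%:R <= K * n%:R)
    (X_random : forall p n, S p n -> random_mx (X p n))
    (D_random : forall p n, S p n -> random_mx (D p n))
    (D_diag : forall p n, S p n -> forall w, is_diag_mx (D p n w))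
    (XD_concentrated : lipschitz_concentrated2 S P X D)
    (col_independent : forall p n, S p n ->
       mutually_independent_mx (P p n) (fun (i : 'I_n) w => col i (X p n w)))
    (col_mean : exists K k : R, 0 < k /\ forall p n, S p n ->
       k <= \big[Num.max/0]_(i < n)
              frobenius_norm (expectation_mx (P p n) (fun w => col i (X p n w)))
         <= K)
    (D_decoupled : exists K : R, forall p n, S p n -> forall i : 'I_n,
       exists Di : T p n -> 'M[R]_n,
         [/\ random_mx Di,
             forall w, is_diag_mx (Di w),
             independent_mx (P p n) Di (fun w => col i (X p n w)) &
             {ae P p n, forall w,
                frobenius_norm (diag_remove i (D p n w) - diag_remove i (Di w))
                <= K}])
    (XD_bounded : exists K k : R, 0 < k /\ forall p n, S p n ->
       exists kappaX kappaD eps : R,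
         [/\ [/\ 0 < kappaX, 0 < kappaD & 0 < eps],
             [/\ kappaX <= K, kappaD <= K & k <= eps],
             {ae P p n, forall w,
                spectral_norm (X p n w) <= Num.sqrt n%:R * kappaX},
             {ae P p n, forall w, spectral_norm (D p n w) <= kappaD} &
             kappaX ^+ 2 * kappaD <= 1 - eps]) :
  linearly_concentrated S P
    (E := fun p _ => 'M[R]_p) (fun p _ => @spectral_norm R p p)
    (fun p n w => resolvent (X p n w) (D p n w))
    [:: (2, fun _ n => ln n%:R `^ (3 / 2) / Num.sqrt n%:R);
        (1 / 2, fun _ n => ln n%:R `^ (3 / 2) / n%:R)].
Proof.
have [Kp Hp] := regime; have [C [c [C00 c0 conc]]] := XD_concentrated.
have [K1 [k1 [_ Hmean]]] := col_mean; have [K [k [k0 Hbd]]] := XD_bounded.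
(* The estimates use C at least 1, K positive and nonnegative K1 and Kp; enlarging these upper
   bounds preserves the hypotheses. *)
pose C1 := Num.max C 1; pose K' := Num.max K 1; pose K1' := Num.max K1 0; pose Kp' := Num.max Kp 0.
have C11 : 1 <= C1 by rewrite le_max lexx orbT.
have C10 : 0 < C1 by exact: lt_le_trans C11.
have K'0 : 0 < K' by apply: lt_le_trans ltr01 _; rewrite le_max lexx orbT.
have K10 : 0 <= K1' by rewrite le_max lexx orbT.
have Kp0 : 0 <= Kp' by rewrite le_max lexx orbT.
pose v := c * gam_lip K'; pose B := gam4_const C1 c K' K1' Kp'.
pose q := res_lip_const C1 c K' k K1' Kp'.
have v0 : 0 < v by rewrite mulr_gt0// addr_gt0// mulr_gt0.
have B0 : 0 < B by exact: gam4_const_gt0.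
have q0 : 0 < q by exact: (res_lip_const_gt0 _ _ _ _ K'0 k0 (lexx _)).
exists (fun p n => expectation_mx (P p n) (fun w => resolvent (X p n w) (D p n w))).
exists (dev_factor C1), (dev_scale C1 c k v B q); split.
- exact: dev_factor_gt0.
- exact: dev_scale_gt0.
move=> p n Spn f f_spec t t0.
have [kX [kD [eps [[kX0 kD0 eps0] [kXK kDK keps] hX hD kk]]]] := Hbd p n Spn.
have n1 := n_gt1 _ _ Spn.
have kXK' : kX <= K' by rewrite le_max kXK.
have kDK' : kD <= K' by rewrite le_max kDK.
have pn : p%:R <= Kp' * n%:R.
  by apply: le_trans (Hp p n Spn) _; rewrite ler_wpM2r ?ler0n// le_max lexx.
have cc (g : 'M[R]_(p, n) -> 'M[R]_n -> R) : lipschitz1_mx_diag g ->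
    let h := fun w => g (X p n w) (D p n w) in
    (P p n).-integrable setT (EFin \o h) /\
    forall t : R, 0 < t ->
      (P p n [set w | (t <= `|h w - fine 'E_(P p n)[h]|)%R] <= (C1 * expR (- (t / c) ^+ 2))%:E)%E.
  move=> gl; have [hi ht] := conc p n Spn g gl; split => // u u0.
  apply: le_trans (ht u u0) _; rewrite lee_fin ler_wpM2r ?expR_ge0//.
  by rewrite le_max lexx.
have X_op : {ae P p n, forall w, opb (X p n w) (Num.sqrt n%:R * kX)}.
  by apply: filterS hX => w; exact: spectral_opb.
have D_op : {ae P p n, forall w, opb (D p n w) kD}.
  by apply: filterS hD => w; exact: spectral_opb.
have X_mean (i : 'I_n) :
    frobenius_norm (expectation_mx (P p n) (fun w => col i (X p n w))) <= K1'.
  rewrite le_max; apply/orP; left; have /andP[_] := Hmean p n Spn.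
  by apply: le_trans; exact: le_bigmax.
have Xr := X_random _ _ Spn; have Dr := D_random _ _ Spn; have Dd := D_diag _ _ Spn.
have Xi := col_independent _ _ Spn.
have EF := Ex_res_functional n1 kX0 kD0 k0 keps kk Xr Dr Dd X_op D_op f.
have bF := bdd_res_functional n1 kX0 kD0 k0 keps kk Xr Dr Dd X_op D_op f.
set F := res_functional (X p n) (D p n) f in EF bF.
rewrite -EF /= !big_cons big_nil addr0 /=.
have mdev u : measurable [set w | u <= `|F w - Ex (P p n) F|].
  apply: measurable_le_set; apply: measurableT_comp => //.
  by apply: measurable_funB => //; case: bF.
rewrite (_ : [set w | _] = [set w | t <= `|F w - Ex (P p n) F|])// PrE//.
rewrite lee_fin.
apply: (pr_dev (pr := fun u => Pr (P p n) [set w | u <= `|F w - Ex (P p n) F|])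
  n1 C10 c0 k0 v0 B0 q0 (W0_gt0 K1' Kp' C11 c0 n1 K'0 (lexx K')) (W0_sqr _ _ _ _ _ n1)) => //.
  by move=> u; exact: Pr_le1.
move=> W u hW u0 bias.
exact: (res_tail_at C11 c0 K10 n1 Kp0 pn kX0 kD0 k0 kXK' kDK' keps kk cc Xr Dr Dd X_op D_op Xi X_mean f_spec hW u0 bias).
Qed.
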